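(* Let $\varphi_{SG}(z):=\dfrac{2}{1+e^{-z}}$ for $z\in\mathbb{D}$, let $$\ell(z)=\int_0^z\frac{e^t-1}{t(e^t+1)}\,dt,$$ and let $\varphi_{Ne}(z):=1+z-z^3/3$. Let $\beta\in\mathbb{R}$. Then, for $p\in\mathcal{H}$ with $p(0)=1$, each of the following differential subordinations is sufficient for the subordination $p\prec\varphi_{Ne}$: (a) $1+\beta zp'(z)\prec\varphi_{SG}(z)$, for $\beta\geq\dfrac{3\,\ell(1)}{2}\approx0.730333$; (b) $1+\beta\,\dfrac{zp'(z)}{p(z)}\prec\varphi_{SG}(z)$, for $\beta\geq\dfrac{\ell(1)}{\log(5/3)}\approx0.953141$; (c) $1+\beta\,\dfrac{zp'(z)}{p^2(z)}\prec\varphi_{SG}(z)$, for $\beta\geq\dfrac{5\,\ell(1)}{2}\approx1.21722$. The bounds on $\beta$ cannot be improved further.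
   Context: $\mathbb{D}=\{z\in\mathbb{C}:|z|<1\}$ and $\mathcal{H}$ is the set of all analytic functions on $\mathbb{D}$. For $f,g\in\mathcal{H}$, $f\prec g$ ($f$ is subordinate to $g$) means that there is $w\in\mathcal{H}$ with $w(0)=0$ and $|w(z)|<1$ for $z\in\mathbb{D}$ such that $f(z)=g(w(z))$ on $\mathbb{D}$; in particular, writing a subordination presupposes that both sides are analytic in $\mathbb{D}$. $\log$ of a positive number is the natural logarithm. That a bound $\beta\ge\beta_0$ cannot be improved means that $\beta_0$ cannot be replaced by any smaller real number so that the implication remains valid for all such $p$ and all $\beta$ at least that number. *)

(* Defs.v *)
From Stdlib Require Export Reals.
From Coquelicot Require Export Coquelicot.

Open Scope R_scope.

Definition in_disk (z : C) : Prop := Cmod z < 1.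

(* Membership in the class H. Elements of H are represented by total functions
   C -> C of which only the restriction to the open unit disk matters. The
   derivative is the complex one: scalars in C_AbsRing. *)
Definition analytic_on_disk (f : C -> C) : Prop :=
  forall z : C, in_disk z -> @ex_derive C_AbsRing C_NormedModule f z.

Definition subordinate (f g : C -> C) : Prop :=
  analytic_on_disk f /\ analytic_on_disk g /\
  exists w : C -> C,
    analytic_on_disk w /\ w (RtoC 0) = RtoC 0 /\
    (forall z : C, in_disk z -> Cmod (w z) < 1) /\
    (forall z : C, in_disk z -> f z = g (w z)).

Definition Cexp (z : C) : C := (exp (Re z) * cos (Im z), exp (Re z) * sin (Im z)).

Definition phi_SG (z : C) : C := (2 / (1 + Cexp (- z)))%C.

Definition phi_Ne (z : C) : C := (1 + z - z ^ 3 / 3)%C.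

(* The singularity at 0 is removable; the value that the total division gives
   there does not affect the integral below. *)
Definition ell_integrand (t : C) : C := ((Cexp t - 1) / (t * (Cexp t + 1)))%C.

(* Integral from 0 to z along the segment t = s z, 0 <= s <= 1. *)
Definition ell (z : C) : C :=
  (z * @RInt C_R_CompleteNormedModule (fun s : R => ell_integrand (RtoC s * z)) 0 1)%C.

(* The real number ell(1): the integrand is real on the segment [0,1]. *)
Definition ell1 : R := Re (ell (RtoC 1)).

(* The left-hand sides of the three differential subordinations. Division in C
   is total, but for beta <> 0 and p analytic with p(0) = 1, a zero of p is a
   pole of z p'/p and of z p'/p^2 (the zero is not at the origin), whatever
   value is assigned at the zero itself. Hence the analyticity of the left-hand
   side, which [subordinate] demands, excludes zeros of p in the disk. *)
Definition expr_a (beta : R) (p : C -> C) (z : C) : C :=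
  (1 + RtoC beta * (z * C_derive p z))%C.

Definition expr_b (beta : R) (p : C -> C) (z : C) : C :=
  (1 + RtoC beta * (z * C_derive p z / p z))%C.

Definition expr_c (beta : R) (p : C -> C) (z : C) : C :=
  (1 + RtoC beta * (z * C_derive p z / p z ^ 2))%C.

Definition sufficient_for_Ne (expr : R -> (C -> C) -> C -> C) (beta : R) : Prop :=
  forall p : C -> C,
    analytic_on_disk p -> p (RtoC 0) = RtoC 1 ->
    subordinate (expr beta p) phi_SG -> subordinate p phi_Ne.

Definition cannot_be_improved (P : R -> Prop) (beta0 : R) : Prop :=
  forall b : R, b < beta0 -> ~ (forall beta : R, beta >= b -> P beta).

(* Main.v *)
Require Import Defs.
From Stdlib Require Import Lra Psatz Classical ClassicalEpsilon.

(** With [h = expr - 1], the hypothesis reads [h = tanh (w / 2)] for a Schwarz function [w].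
    Dividing by [t] and integrating [h (t z)] along the ray to [z] produces [G] with
    [p = 1 + G / beta], [p = exp (G / beta)] and [p = 1 / (1 - G / beta)] respectively. By the
    Schwarz lemma and [Re (tanh (zeta / 2)) <= tanh (|zeta| / 2)] on the unit disk,
    [|Re G| < ell 1], and [|Im G|] is bounded by a crude constant; hence [p - 1] lies in the box
    [|x| < 2/3, |y| <= 1]. This box, whose vertical sides pass through
    the cusps of the nephroid, is inside the image of the disk under the univalent map
    [zeta - zeta^3 / 3], which can be inverted there. Sharpness comes from [w z = z]: then
    [G (x) -> ell 1] as [x -> 1] along the reals, and [p x] passes the cusp value [5/3].

    Complex differentiability alone gives the Schwarz lemma through Goursat's argument on
    rectangles in logarithmic coordinates, which yields the mean value property. *)

(** * Complex derivatives *)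

(** A bound on the modulus of [G] would not do. On the imaginary axis |tanh (zeta / 2)| equals tan
    (|zeta| / 2), which exceeds tanh (|zeta| / 2), so for w z = z the values of [G] leave the disc
    of radius [ell1]. Only the real part has the sharp bound, and this dictates a box instead of a
    disc. The three thresholds come from its right-hand side: the largest admissible |Re (G / beta)|
    is 2/3 for 1 + G / beta, ln (5/3) for the exponential and 2/5 for 1 / (1 - G / beta), each
    reaching exactly the value 5/3. The left-hand side and the height of the box leave slack, hence
    the crude constants there. Two obstacles remain. At the cusps the derivative 1 - zeta^2
    vanishes, so first-order arguments fail and a second-order step takes their place. In (b) and
    (c) the formulas for p hold only as long as p has no zero on the ray, so nonvanishing is
    propagated along the ray together with the formula. *)

Definition is_Cderive (f : C -> C) (z l : C) : Prop :=
  @is_derive C_AbsRing C_NormedModule f z l.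

Lemma is_Cderive_eps (f : C -> C) (z l : C) :
  is_Cderive f z l <->
  forall eps : R, 0 < eps -> exists delta : R, 0 < delta /\
    forall y : C, Cmod (y - z) < delta ->
      Cmod (f y - f z - l * (y - z)) <= eps * Cmod (y - z).
Proof.
  split.
  - intros [_ H] eps He.
    destruct (H z (fun P HP => HP) (mkposreal eps He)) as [d Hd].
    exists d; split; [apply cond_pos|]. intros y Hy.
    specialize (Hd y Hy). rewrite (Cmult_comm l). exact Hd.
  - intros H; split.
    + apply (is_linear_scal_l (K := C_AbsRing) (V := C_NormedModule) l).
    + intros x Hx eps.
      assert (E : z = x) by (apply (is_filter_lim_locally_unique (K := C_AbsRing) (V := AbsRing_NormedModule C_AbsRing)); exact Hx).
      subst x.
      destruct (H eps (cond_pos eps)) as [d [Hd K]].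
      exists (mkposreal d Hd). intros y Hy. specialize (K y Hy).
      rewrite (Cmult_comm l) in K. exact K.
Qed.

Lemma is_Cderive_ex (f : C -> C) (z l : C) :
  is_Cderive f z l -> @ex_derive C_AbsRing C_NormedModule f z.
Proof. intros H; exists l; exact H. Qed.

Lemma is_Cderive_ext_loc (f g : C -> C) (z l : C) (r : R) :
  0 < r -> (forall y, Cmod (y - z) < r -> f y = g y) ->
  is_Cderive f z l -> is_Cderive g z l.
Proof.
  intros Hr E. apply is_derive_ext_loc.
  exists (mkposreal r Hr). intros y Hy. apply E. exact Hy.
Qed.

Lemma is_Cderive_const (c z : C) : is_Cderive (fun _ => c) z 0.
Proof. apply (is_derive_const (K := C_AbsRing) (V := C_NormedModule)). Qed.

Lemma is_Cderive_id (z : C) : is_Cderive (fun y => y) z 1.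
Proof.
  apply is_Cderive_eps. intros eps He. exists 1; split; [lra|]. intros y _.
  replace (y - z - 1 * (y - z))%C with (RtoC 0) by ring.
  rewrite Cmod_0. apply Rmult_le_pos; [lra|apply Cmod_ge_0].
Qed.

Lemma is_Cderive_plus (f g : C -> C) (z a b : C) :
  is_Cderive f z a -> is_Cderive g z b ->
  is_Cderive (fun y => f y + g y)%C z (a + b)%C.
Proof. apply (is_derive_plus (K := C_AbsRing) (V := C_NormedModule)). Qed.

(** C carries two normed-module structures, its own and that of the ring over itself. The chain and
    product rules want inner functions and factors to land in the second; the remainder estimate is
    the same for both. *)
Lemma is_Cderive_AbsRing (f : C -> C) (z l : C) :
  is_Cderive f z l <-> @is_derive C_AbsRing (AbsRing_NormedModule C_AbsRing) f z l.
Proof.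
  split; intros [_ H]; (split; [|exact H]).
  - apply (is_linear_scal_l (K := C_AbsRing) (V := AbsRing_NormedModule C_AbsRing) l).
  - apply (is_linear_scal_l (K := C_AbsRing) (V := C_NormedModule) l).
Qed.

Lemma is_Cderive_comp (f g : C -> C) (z a b : C) :
  is_Cderive f (g z) a -> is_Cderive g z b ->
  is_Cderive (fun y => f (g y)) z (b * a)%C.
Proof.
  intros Hf Hg. apply is_Cderive_AbsRing in Hg.
  exact (is_derive_comp (K := C_AbsRing) (V := C_NormedModule) f g z a b Hf Hg).
Qed.

Lemma is_Cderive_mult (f g : C -> C) (z a b : C) :
  is_Cderive f z a -> is_Cderive g z b ->
  is_Cderive (fun y => f y * g y)%C z (a * g z + f z * b)%C.
Proof.
  intros Hf Hg. apply is_Cderive_AbsRing in Hf. apply is_Cderive_AbsRing in Hg.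
  apply is_Cderive_AbsRing.
  assert (H := filterdiff_mult_fct (K := C_AbsRing) (U := AbsRing_NormedModule C_AbsRing) f g z _ _ Cmult_comm Hf Hg).
  unfold is_derive.
  eapply filterdiff_ext_lin; [exact H|].
  intros y. unfold plus, mult, scal; simpl. unfold mult; simpl.
  ring.
Qed.

Lemma is_Cderive_continuous (f : C -> C) (z l : C) :
  is_Cderive f z l ->
  forall eps, 0 < eps -> exists delta, 0 < delta /\
    forall y, Cmod (y - z) < delta -> Cmod (f y - f z) < eps.
Proof.
  intros H eps He. destruct (proj1 (is_Cderive_eps f z l) H 1 Rlt_0_1) as [d [Hd K]].
  assert (Hl : 0 < Cmod l + 1) by (generalize (Cmod_ge_0 l); lra).
  exists (Rmin d (eps / (Cmod l + 1))). split.
  - apply Rmin_pos; [lra|]. apply Rdiv_lt_0_compat; lra.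
  - intros y Hy.
    assert (Hy1 := Rlt_le_trans _ _ _ Hy (Rmin_l _ _)).
    assert (Hy2 := Rlt_le_trans _ _ _ Hy (Rmin_r _ _)).
    specialize (K y Hy1).
    replace (f y - f z)%C with ((f y - f z - l * (y - z)) + l * (y - z))%C by ring.
    eapply Rle_lt_trans; [apply Cmod_triangle|]. rewrite Cmod_mult.
    apply Rle_lt_trans with ((Cmod l + 1) * Cmod (y - z)); [lra|].
    apply Rlt_le_trans with ((Cmod l + 1) * (eps / (Cmod l + 1))).
    + apply Rmult_lt_compat_l; lra.
    + right. field. lra.
Qed.

Lemma is_Cderive_inv_id (z : C) : z <> 0 -> is_Cderive Cinv z (- / (z * z))%C.
Proof.
  intros Hz. assert (Pz : 0 < Cmod z) by (apply Cmod_gt_0; exact Hz).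
  apply is_Cderive_eps. intros eps He.
  set (m := Cmod z) in *.
  (* The remainder has modulus |y - z|^2 / (|y| m^2). The first radius gives |y| >= m / 2, and the
     second then makes |y - z| <= eps |y| m^2. *)
  exists (Rmin (m / 2) (eps * (m * m * m) / 2)). split.
  - assert (0 < m * m * m) by (repeat apply Rmult_lt_0_compat; lra).
    apply Rmin_pos; [lra|]. apply Rdiv_lt_0_compat; [|lra]. apply Rmult_lt_0_compat; lra.
  - intros y Hy.
    assert (Hy1 := Rlt_le_trans _ _ _ Hy (Rmin_l _ _)).
    assert (Hy2 := Rlt_le_trans _ _ _ Hy (Rmin_r _ _)).
    assert (My : m / 2 <= Cmod y).
    { assert (T := Cmod_triangle y (z - y)%C).
      replace (y + (z - y))%C with z in T by ring.
      replace (z - y)%C with (- (y - z))%C in T by ring. rewrite Cmod_opp in T.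
      fold m in T. lra. }
    assert (Ny : y <> 0). { apply Cmod_gt_0. lra. }
    replace (/ y - / z - - / (z * z) * (y - z))%C with ((y - z) * (y - z) * / (y * (z * z)))%C
      by (field; split; assumption).
    rewrite !Cmod_mult, Cmod_inv, !Cmod_mult by (repeat apply Cmult_neq_0; assumption).
    fold m. set (d := Cmod (y - z)) in *. set (n := Cmod y) in *.
    assert (0 <= d) by apply Cmod_ge_0.
    rewrite (Rmult_assoc d), (Rmult_comm eps).
    apply Rmult_le_compat_l; [assumption|].
    assert (0 < n * (m * m)) by (repeat apply Rmult_lt_0_compat; lra).
    apply Rmult_le_reg_r with (n * (m * m)); [assumption|].
    rewrite Rmult_assoc, Rinv_l by lra. rewrite Rmult_1_r.
    apply Rle_trans with (eps * (m * m * m) / 2); [lra|].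
    replace (eps * (m * m * m) / 2) with (eps * ((m / 2) * (m * m))) by field.
    apply Rmult_le_compat_l; [lra|]. apply Rmult_le_compat_r; [nra|lra].
Qed.

Lemma is_Cderive_div (f g : C -> C) (z a b : C) :
  g z <> 0 -> is_Cderive f z a -> is_Cderive g z b ->
  is_Cderive (fun y => f y / g y)%C z ((a * g z - f z * b) / (g z * g z))%C.
Proof.
  intros Hg Df Dg.
  assert (D := is_Cderive_mult _ _ _ _ _ Df (is_Cderive_comp Cinv g z _ _ (is_Cderive_inv_id _ Hg) Dg)).
  unfold Cdiv.
  replace ((a * g z - f z * b) * / (g z * g z))%C
    with (a * / g z + f z * (b * - / (g z * g z)))%C; [exact D|].
  field. exact Hg.
Qed.

(** * The complex exponential and the Cauchy-Riemann equations *)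

Lemma Cexp_plus (z w : C) : Cexp (z + w) = (Cexp z * Cexp w)%C.
Proof.
  unfold Cexp. destruct z as [x y], w as [u v]. unfold Cmult, Cplus, Re, Im; simpl.
  rewrite exp_plus, cos_plus, sin_plus. f_equal; ring.
Qed.

Lemma Cexp_0 : Cexp 0 = RtoC 1.
Proof. unfold Cexp, Re, Im; simpl. rewrite exp_0, cos_0, sin_0, Rmult_1_l, Rmult_0_r. reflexivity. Qed.

Lemma Cexp_neq_0 (z : C) : Cexp z <> 0.
Proof.
  intros H. assert (E : (Cexp z * Cexp (- z))%C = 1).
  { rewrite <- Cexp_plus. replace (z + - z)%C with (RtoC 0) by ring. apply Cexp_0. }
  rewrite H, Cmult_0_l in E. injection E. lra.
Qed.

Lemma Cexp_opp (z : C) : Cexp (- z) = (/ Cexp z)%C.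
Proof.
  assert (E : (Cexp (- z) * Cexp z)%C = 1).
  { rewrite <- Cexp_plus. replace (- z + z)%C with (RtoC 0) by ring. apply Cexp_0. }
  rewrite <- (Cmult_1_l (/ Cexp z)), <- E, <- Cmult_assoc, Cinv_r by apply Cexp_neq_0.
  ring.
Qed.

Lemma Cmod_le_abs (x y : R) : Cmod (x, y) <= Rabs x + Rabs y.
Proof.
  replace (x, y) with (RtoC x + RtoC y * Ci)%C.
  - eapply Rle_trans; [apply Cmod_triangle|]. rewrite Cmod_mult, Cmod_Ci, !Cmod_R. lra.
  - unfold Cplus, Cmult, RtoC, Ci; simpl. f_equal; ring.
Qed.

(** The Cauchy-Riemann equations are built into the gradients (a, -b) and (b, a). Each coordinate
    contributes an error eps/2 in the max norm, which is at most the modulus. *)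
Lemma is_Cderive_of_partials (U V : R -> R -> R) (x y a b : R) :
  differentiable_pt_lim U x y a (- b) -> differentiable_pt_lim V x y b a ->
  is_Cderive (fun z => (U (Re z) (Im z), V (Re z) (Im z))) (x, y) (a, b).
Proof.
  intros HU HV. apply is_Cderive_eps. intros eps He.
  assert (He2 : 0 < eps / 2) by lra.
  destruct (HU (mkposreal _ He2)) as [d1 H1], (HV (mkposreal _ He2)) as [d2 H2].
  exists (Rmin d1 d2). split; [apply Rmin_pos; apply cond_pos|].
  intros [u v] Hy. simpl in *.
  assert (Hm := Rmax_Cmod ((u, v) - (x, y))%C). simpl in Hm.
  fold (Rminus u x) in Hm. fold (Rminus v y) in Hm.
  set (m := Rmax (Rabs (u - x)) (Rabs (v - y))) in *.
  assert (Hu : Rabs (u - x) <= m) by apply Rmax_l.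
  assert (Hv : Rabs (v - y) <= m) by apply Rmax_r.
  assert (Hy1 := Rlt_le_trans _ _ _ Hy (Rmin_l _ _)).
  assert (Hy2 := Rlt_le_trans _ _ _ Hy (Rmin_r _ _)).
  specialize (H1 u v ltac:(lra) ltac:(lra)). specialize (H2 u v ltac:(lra) ltac:(lra)).
  fold m in H1, H2.
  eapply Rle_trans.
  - match goal with |- Cmod ?X <= _ => rewrite (surjective_pairing X) end.
    apply Cmod_le_abs.
  - simpl.
    match goal with |- Rabs ?A + Rabs ?B <= _ =>
      replace A with (U u v - U x y - (a * (u - x) + - b * (v - y))) by ring;
      replace B with (V u v - V x y - (b * (u - x) + a * (v - y))) by ring end.
    apply Rle_trans with (eps / 2 * m + eps / 2 * m); [lra|].
    replace (eps / 2 * m + eps / 2 * m) with (eps * m) by field.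
    apply Rmult_le_compat_l; lra.
Qed.

Lemma differentiable_of_is_Cderive (f : C -> C) (x y : R) (l : C) :
  is_Cderive f (x, y) l ->
  differentiable_pt_lim (fun u v => Re (f (u, v))) x y (Re l) (- Im l) /\
  differentiable_pt_lim (fun u v => Im (f (u, v))) x y (Im l) (Re l).
Proof.
  intros H. assert (K := proj1 (is_Cderive_eps _ _ _) H).
  assert (T : forall eps : posreal, exists d : posreal, forall u v, Rabs (u - x) < d -> Rabs (v - y) < d ->
     Cmod (f (u, v) - f (x, y) - l * ((u, v) - (x, y)))%C <= eps * Rmax (Rabs (u - x)) (Rabs (v - y))).
  (* The modulus is at most twice the max norm, so both the error and the radius are halved. *)
  { intros eps. assert (He2 : 0 < eps / 2) by (generalize (cond_pos eps); lra).
    destruct (K _ He2) as [d [Hd L]].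
    assert (Hd2 : 0 < d / 2) by lra.
    exists (mkposreal _ Hd2). simpl. intros u v Hu Hv.
    assert (B := Cmod_le_abs (u - x) (v - y)).
    change ((u, v) - (x, y))%C with (u - x, v - y).
    specialize (L (u, v)). change ((u, v) - (x, y))%C with (u - x, v - y) in L.
    assert (L' := L ltac:(lra)). clear L.
    eapply Rle_trans; [exact L'|].
    replace (eps * Rmax (Rabs (u - x)) (Rabs (v - y))) with
      (eps / 2 * (2 * Rmax (Rabs (u - x)) (Rabs (v - y)))) by field.
    apply Rmult_le_compat_l; [lra|].
    generalize (Rmax_l (Rabs (u - x)) (Rabs (v - y))) (Rmax_r (Rabs (u - x)) (Rabs (v - y))). lra. }
  split; intros eps; destruct (T eps) as [d L]; exists d; intros u v Hu Hv;
    (eapply Rle_trans; [|exact (L u v Hu Hv)]);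
    (eapply Rle_trans; [|apply Rmax_Cmod]).
  - eapply Rle_trans; [|apply Rmax_l]. right. f_equal. unfold Re, Im; simpl. ring.
  - eapply Rle_trans; [|apply Rmax_r]. right. f_equal. unfold Re, Im; simpl. ring.
Qed.

Lemma differentiable_pt_lim_mult (f g : R -> R) (x y a b : R) :
  is_derive f x a -> is_derive g y b ->
  differentiable_pt_lim (fun u v => f u * g v) x y (a * g y) (f x * b).
Proof.
  intros Hf Hg. apply filterdiff_differentiable_pt_lim.
  assert (Lf : filterdiff (fun p : R * R => f (fst p)) (locally (x, y)) (fun p => scal (fst p) a)).
  { apply (filterdiff_comp' fst f (x, y) fst (fun t => scal t a)); [|exact Hf].
    apply filterdiff_linear, is_linear_fst. }
  assert (Lg : filterdiff (fun p : R * R => g (snd p)) (locally (x, y)) (fun p => scal (snd p) b)).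
  { apply (filterdiff_comp' snd g (x, y) snd (fun t => scal t b)); [|exact Hg].
    apply filterdiff_linear, is_linear_snd. }
  eapply filterdiff_ext_lin.
  - exact (filterdiff_mult_fct (K := R_AbsRing) _ _ (x, y) _ _ Rmult_comm Lf Lg).
  - intros p. unfold plus, mult, scal; simpl. unfold mult; simpl. ring.
Qed.

Lemma is_Cderive_Cexp (z : C) : is_Cderive Cexp z (Cexp z).
Proof.
  destruct z as [x y].
  assert (E := is_derive_exp x). assert (Dc := is_derive_cos y). assert (Ds := is_derive_sin y).
  apply (is_Cderive_of_partials (fun u v => exp u * cos v) (fun u v => exp u * sin v)).
  - replace (- (exp (Re (x, y)) * sin (Im (x, y)))) with (exp x * (- sin y)) by (simpl; ring).
    apply (differentiable_pt_lim_mult exp cos); assumption.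
  - apply (differentiable_pt_lim_mult exp sin); assumption.
Qed.

(** * Goursat's lemma for closed differential forms *)

(** Quadrisection for an arbitrary property inherited by at least one quarter; it serves both
    Goursat's argument and the existence of a maximum on a closed disc. *)
Lemma bisection2 (B : R -> R -> R -> R -> Prop) (a b c d : R) :
  (forall a b c d, a <= b -> c <= d -> B a b c d ->
     B a ((a + b) / 2) c ((c + d) / 2) \/ B a ((a + b) / 2) ((c + d) / 2) d \/
     B ((a + b) / 2) b c ((c + d) / 2) \/ B ((a + b) / 2) b ((c + d) / 2) d) ->
  a <= b -> c <= d -> B a b c d ->
  exists x y, (a <= x <= b /\ c <= y <= d) /\
    forall n, exists a' b' c' d',
      a <= a' <= x /\ x <= b' <= b /\ c <= c' <= y /\ y <= d' <= d /\
      b' - a' = (b - a) / 2 ^ n /\ d' - c' = (d - c) / 2 ^ n /\ B a' b' c' d'.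
Proof.
  intros Hsplit Hab Hcd HB.
  (* As an implication, [step] is solvable from every tuple, so choice yields a total successor
     function. *)
  set (step := fun (p q : R * R * R * R) => let '(a, b, c, d) := p in let '(a', b', c', d') := q in
     a <= b -> c <= d -> B a b c d ->
     (a <= a' /\ b' <= b /\ c <= c' /\ d' <= d /\ b' - a' = (b - a) / 2 /\ d' - c' = (d - c) / 2 /\ B a' b' c' d')).
  assert (Hs : forall p, exists q, step p q).
  { intros [[[a0 b0] c0] d0]. unfold step.
    destruct (classic (a0 <= b0 /\ c0 <= d0 /\ B a0 b0 c0 d0)) as [[H1 [H2 H3]]|H].
    - destruct (Hsplit _ _ _ _ H1 H2 H3) as [K|[K|[K|K]]];
        [exists (a0, (a0 + b0) / 2, c0, (c0 + d0) / 2)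
        |exists (a0, (a0 + b0) / 2, (c0 + d0) / 2, d0)
        |exists ((a0 + b0) / 2, b0, c0, (c0 + d0) / 2)
        |exists ((a0 + b0) / 2, b0, (c0 + d0) / 2, d0)]; intros; repeat split; try lra; exact K.
    - exists (a0, b0, c0, d0). intros; exfalso; apply H; auto. }
  set (nxt := fun p => proj1_sig (constructive_indefinite_description _ (Hs p))).
  assert (Hn : forall p, step p (nxt p)) by (intros p; exact (proj2_sig (constructive_indefinite_description _ (Hs p)))).
  clearbody nxt.
  set (s := fix s (n : nat) := match n with O => (a, b, c, d) | S n => nxt (s n) end).
  set (sa := fun n => fst (fst (fst (s n)))). set (sb := fun n => snd (fst (fst (s n)))).
  set (sc := fun n => snd (fst (s n))). set (sd := fun n => snd (s n)).
  assert (Inv : forall n, sa n <= sb n /\ sc n <= sd n /\ B (sa n) (sb n) (sc n) (sd n) /\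
     sb n - sa n = (b - a) / 2 ^ n /\ sd n - sc n = (d - c) / 2 ^ n /\
     sa n <= sa (S n) /\ sb (S n) <= sb n /\ sc n <= sc (S n) /\ sd (S n) <= sd n).
  { induction n as [|n IH].
    - assert (K := Hn (s O)). unfold sa, sb, sc, sd. simpl in *.
      destruct (nxt (a, b, c, d)) as [[[a1 b1] c1] d1]. simpl in *.
      specialize (K Hab Hcd HB). repeat split; try lra; assumption.
    - destruct IH as (I1 & I2 & I3 & I4 & I5 & _).
      assert (K := Hn (s n)). assert (K' := Hn (s (S n))).
      unfold sa, sb, sc, sd in *. change (s (S (S n))) with (nxt (s (S n))).
      change (s (S n)) with (nxt (s n)) in *.
      destruct (s n) as [[[a0 b0] c0] d0]. simpl in *.
      destruct (nxt (a0, b0, c0, d0)) as [[[a1 b1] c1] d1]. simpl in *.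
      specialize (K I1 I2 I3). destruct K as (K1 & K2 & K3 & K4 & K5 & K6 & K7).
      assert (Q1 : a1 <= b1) by lra. assert (Q2 : c1 <= d1) by lra.
      destruct (nxt (a1, b1, c1, d1)) as [[[a2 b2] c2] d2]. simpl in *.
      specialize (K' Q1 Q2 K7).
      assert (P2 : 2 ^ n <> 0) by (apply pow_nonzero; lra).
      repeat split; try lra; try assumption.
      + rewrite K5, I4. field. assumption.
      + rewrite K6, I5. field. assumption. }
  assert (Mono : forall n k, sa n <= sa (n + k)%nat /\ sb (n + k)%nat <= sb n /\ sc n <= sc (n + k)%nat /\ sd (n + k)%nat <= sd n).
  { intros n k; induction k as [|k IH].
    - rewrite Nat.add_0_r. lra.
    - rewrite Nat.add_succ_r. generalize (Inv (n + k)%nat). lra. }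
  (* Every left end lies below every right end, so the suprema of the left and of the lower ends
     belong to all rectangles of the sequence. *)
  assert (Cross : forall n m, sa n <= sb m /\ sc n <= sd m).
  { intros n m. generalize (Mono n m) (Mono m n) (Inv (n + m)%nat). rewrite (Nat.add_comm m n). lra. }
  destruct (completeness (fun t => exists n, t = sa n)) as [x [Hx1 Hx2]].
  { exists (sb O). intros t [n ->]. apply Cross. }
  { exists (sa O), O. reflexivity. }
  destruct (completeness (fun t => exists n, t = sc n)) as [y [Hy1 Hy2]].
  { exists (sd O). intros t [n ->]. apply Cross. }
  { exists (sc O), O. reflexivity. }
  assert (Xa : forall n, sa n <= x) by (intros n; apply Hx1; exists n; reflexivity).
  assert (Yc : forall n, sc n <= y) by (intros n; apply Hy1; exists n; reflexivity).
  assert (Xb : forall n, x <= sb n) by (intros n; apply Hx2; intros t [m ->]; apply Cross).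
  assert (Yd : forall n, y <= sd n) by (intros n; apply Hy2; intros t [m ->]; apply Cross).
  exists x, y. split.
  - generalize (Xa O) (Xb O) (Yc O) (Yd O). unfold sa, sb, sc, sd; simpl. lra.
  - intros n. exists (sa n), (sb n), (sc n), (sd n).
    generalize (Xa n) (Xb n) (Yc n) (Yd n) (Inv n) (Mono O n).
    unfold sa at 5, sb at 5, sc at 5, sd at 5. simpl. intros ? ? ? ? I M.
    decompose [and] I. repeat split; try lra; try assumption;
    revert M; unfold sa at 1, sb at 2, sc at 1, sd at 2; simpl; lra.
Qed.

(** The integral of P dx + Q dy counterclockwise round the boundary of [a, b] x [c, d]. *)
Definition circulation (P Q : R -> R -> R) (a b c d : R) : R :=
  RInt (fun x => P x c) a b + RInt (fun y => Q b y) c d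
  - RInt (fun x => P x d) a b - RInt (fun y => Q a y) c d.

(** The shared [q] is both dP/dy and dQ/dx: this is closedness of P dx + Q dy at the point. *)
Definition closed_form_at (P Q : R -> R -> R) (x y : R) : Prop :=
  exists p q r, differentiable_pt_lim P x y p q /\ differentiable_pt_lim Q x y q r.

Lemma differentiable_continuous_sections (P : R -> R -> R) x y p q :
  differentiable_pt_lim P x y p q ->
  continuous (fun u => P u y) x /\ continuous (fun v => P x v) y.
Proof.
  intros H.
  assert (K : continuity_2d_pt P x y) by (apply differentiable_continuity_pt; exists p, q; exact H).
  split; apply (filterlim_locally (U := R_UniformSpace)); intros eps; destruct (K eps) as [e L]; exists e; intros t Ht.
  - apply L; [exact Ht|]. rewrite Rminus_diag, Rabs_R0. apply cond_pos.
  - apply L; [|exact Ht]. rewrite Rminus_diag, Rabs_R0. apply cond_pos.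
Qed.

Lemma closed_form_ex_RInt (P Q : R -> R -> R) (D : R -> R -> Prop) :
  (forall x y, D x y -> closed_form_at P Q x y) ->
  (forall a b y, (forall t, Rmin a b <= t <= Rmax a b -> D t y) -> ex_RInt (fun x => P x y) a b) /\
  (forall c d x, (forall t, Rmin c d <= t <= Rmax c d -> D x t) -> ex_RInt (fun y => Q x y) c d).
Proof.
  intros H. split; intros a b z Hz; apply (ex_RInt_continuous (V := R_CompleteNormedModule)); intros t Ht;
    destruct (H _ _ (Hz t Ht)) as (p & q & r & HP & HQ).
  - apply (differentiable_continuous_sections _ _ _ _ _ HP).
  - apply (differentiable_continuous_sections _ _ _ _ _ HQ).
Qed.

Lemma RInt_minus_const (f : R -> R) a b k : ex_RInt f a b ->
  RInt (fun t => f t - k) a b = RInt f a b - k * (b - a).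
Proof.
  intros H. rewrite (RInt_minus (V := R_CompleteNormedModule) f (fun _ => k)); [|exact H|apply ex_RInt_const].
  rewrite RInt_const. unfold minus, plus, opp, scal; simpl. unfold mult; simpl. ring.
Qed.

(** A closed form with affine coefficients has circulation 0, so only the linearization error, at
    most [E] on each side, contributes. *)
Lemma circulation_bound (P Q : R -> R -> R) a b c d x y p q r E :
  a <= b -> c <= d ->
  (forall u v, a <= u <= b -> c <= v <= d -> closed_form_at P Q u v) ->
  (forall u v, a <= u <= b -> c <= v <= d ->
     Rabs (P u v - P x y - (p * (u - x) + q * (v - y))) <= E /\
     Rabs (Q u v - Q x y - (q * (u - x) + r * (v - y))) <= E) ->
  Rabs (circulation P Q a b c d) <= 2 * E * ((b - a) + (d - c)).
Proof.
  intros Hab Hcd Hcl HE.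
  destruct (closed_form_ex_RInt P Q (fun u v => a <= u <= b /\ c <= v <= d)) as [EP EQ].
  { intros u v [Hu Hv]; apply Hcl; assumption. }
  assert (EPv : forall v, c <= v <= d -> ex_RInt (fun u => P u v) a b).
  { intros v Hv; apply EP. intros t Ht. rewrite Rmin_left, Rmax_right in Ht by assumption. auto. }
  assert (EQv : forall u, a <= u <= b -> ex_RInt (fun v => Q u v) c d).
  { intros v Hv; apply EQ. intros t Ht. rewrite Rmin_left, Rmax_right in Ht by assumption. auto. }
  assert (E1 := EPv c ltac:(lra)). assert (E2 := EPv d ltac:(lra)).
  assert (E3 := EQv a ltac:(lra)). assert (E4 := EQv b ltac:(lra)).
  set (F := fun u => P u c - P u d). set (G := fun v => Q b v - Q a v).
  assert (EF : ex_RInt F a b) by (apply (ex_RInt_minus (V := R_NormedModule)); assumption).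
  assert (EG : ex_RInt G c d) by (apply (ex_RInt_minus (V := R_NormedModule)); assumption).
  (* The affine parts of [F] and [G] are the constants q (c - d) and q (b - a), whose integrals over
     [a, b] and [c, d] cancel. *)
  assert (Eq : circulation P Q a b c d =
    RInt (fun u => F u - q * (c - d)) a b + RInt (fun v => G v - q * (b - a)) c d).
  { rewrite !RInt_minus_const by assumption. unfold circulation, F, G.
    rewrite (RInt_minus (V := R_CompleteNormedModule) (fun u => P u c) (fun u => P u d)) by assumption.
    rewrite (RInt_minus (V := R_CompleteNormedModule) (fun u => Q b u) (fun u => Q a u)) by assumption.
    unfold minus, plus, opp; simpl. ring. }
  rewrite Eq. eapply Rle_trans; [apply Rabs_triang|].
  apply Rle_trans with ((b - a) * (2 * E) + (d - c) * (2 * E)); [|lra].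
  apply Rplus_le_compat; apply abs_RInt_le_const; try assumption.
  - apply (ex_RInt_minus (V := R_NormedModule)); [assumption|apply ex_RInt_const].
  - intros t Ht. unfold F.
    destruct (HE t c Ht ltac:(lra)) as [H1 _]. destruct (HE t d Ht ltac:(lra)) as [H2 _].
    apply Rabs_le_between in H1. apply Rabs_le_between in H2. apply Rabs_le_between. lra.
  - apply (ex_RInt_minus (V := R_NormedModule)); [assumption|apply ex_RInt_const].
  - intros t Ht. unfold G.
    destruct (HE a t ltac:(lra) Ht) as [_ H1]. destruct (HE b t ltac:(lra) Ht) as [_ H2].
    apply Rabs_le_between in H1. apply Rabs_le_between in H2. apply Rabs_le_between. lra.
Qed.

Lemma circulation_split (P Q : R -> R -> R) a m b c n d :
  a <= m <= b -> c <= n <= d ->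
  (forall u v, a <= u <= b -> c <= v <= d -> closed_form_at P Q u v) ->
  circulation P Q a b c d = circulation P Q a m c n + circulation P Q a m n d +
    (circulation P Q m b c n + circulation P Q m b n d).
Proof.
  intros Hm Hn Hcl.
  destruct (closed_form_ex_RInt P Q (fun u v => a <= u <= b /\ c <= v <= d)) as [EP EQ].
  { intros u v [Hu Hv]; apply Hcl; assumption. }
  assert (CP : forall v, c <= v <= d -> RInt (fun u => P u v) a m + RInt (fun u => P u v) m b = RInt (fun u => P u v) a b).
  { intros v Hv. apply (RInt_Chasles (V := R_CompleteNormedModule)); apply EP; intros t;
      rewrite Rmin_left, Rmax_right by lra; lra. }
  assert (CQ : forall u, a <= u <= b -> RInt (fun v => Q u v) c n + RInt (fun v => Q u v) n d = RInt (fun v => Q u v) c d).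
  { intros v Hv. apply (RInt_Chasles (V := R_CompleteNormedModule)); apply EQ; intros t;
      rewrite Rmin_left, Rmax_right by lra; lra. }
  unfold circulation.
  rewrite <- (CP c), <- (CP d), <- (CQ a), <- (CQ b) by lra. ring.
Qed.

(* Goursat's argument: only differentiability is needed, not continuity of the partial derivatives. *)
Lemma circulation_zero_ordered (P Q : R -> R -> R) a b c d :
  a <= b -> c <= d ->
  (forall u v, a <= u <= b -> c <= v <= d -> closed_form_at P Q u v) ->
  circulation P Q a b c d = 0.
Proof.
  intros Hab Hcd Hcl.
  destruct (Req_dec a b) as [<-|Nab].
  { unfold circulation. rewrite !RInt_point. unfold zero; simpl. ring. }
  destruct (Req_dec c d) as [<-|Ncd].
  { unfold circulation. rewrite !RInt_point. unfold zero; simpl. ring. }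
  destruct (Req_dec (circulation P Q a b c d) 0) as [?|N0]; [assumption|exfalso].
  set (A := (b - a) * (d - c)).
  assert (HA : 0 < A) by (apply Rmult_lt_0_compat; lra).
  (* The property kept under bisection is that the circulation is at least [k] times the area: by
     additivity it survives on some quarter. *)
  set (k := Rabs (circulation P Q a b c d) / A).
  assert (Hk : 0 < k) by (apply Rdiv_lt_0_compat; [apply Rabs_pos_lt; exact N0|exact HA]).
  destruct (bisection2 (fun a' b' c' d' => (a <= a' /\ b' <= b /\ c <= c' /\ d' <= d) /\
      k * ((b' - a') * (d' - c')) <= Rabs (circulation P Q a' b' c' d')) a b c d) as (x & y & [Hx Hy] & Hn).
  - intros a' b' c' d' H1 H2 [HI HB].
    set (m := (a' + b') / 2). set (n := (c' + d') / 2).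
    assert (Hm : a' <= m <= b') by (unfold m; lra). assert (Hn : c' <= n <= d') by (unfold n; lra).
    rewrite (circulation_split P Q a' m b' c' n d') in HB; [|lra|lra|intros; apply Hcl; lra].
    set (I1 := circulation P Q a' m c' n) in *. set (I2 := circulation P Q a' m n d') in *.
    set (I3 := circulation P Q m b' c' n) in *. set (I4 := circulation P Q m b' n d') in *.
    assert (T : Rabs (I1 + I2 + (I3 + I4)) <= Rabs I1 + Rabs I2 + (Rabs I3 + Rabs I4)).
    { eapply Rle_trans; [apply Rabs_triang|]. apply Rplus_le_compat; apply Rabs_triang. }
    assert (D1 : m - a' = (b' - a') / 2) by (unfold m; lra). assert (D2 : b' - m = (b' - a') / 2) by (unfold m; lra).
    assert (D3 : n - c' = (d' - c') / 2) by (unfold n; lra). assert (D4 : d' - n = (d' - c') / 2) by (unfold n; lra).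
    rewrite D1, D2, D3, D4.
    set (K := k * ((b' - a') / 2 * ((d' - c') / 2))).
    assert (EK : k * ((b' - a') * (d' - c')) = 4 * K) by (unfold K; field).
    destruct (Rle_dec K (Rabs I1)); [left; split; [lra|assumption]|].
    destruct (Rle_dec K (Rabs I2)); [right; left; split; [lra|assumption]|].
    destruct (Rle_dec K (Rabs I3)); [right; right; left; split; [lra|assumption]|].
    right; right; right; split; lra.
  - assumption.
  - assumption.
  - split; [lra|]. fold A. unfold k. right. field. lra.
  - destruct (Hcl x y Hx Hy) as (p & q & r & HP & HQ).
    set (D := (b - a) + (d - c)).
    assert (HD : 0 < D) by (unfold D; lra).
    (* At scale [s] the linearization bounds the circulation by 2 eps D^2 s^2. This choice makes it
       half of the lower bound k A s^2. *)
    set (eps := k * A / (4 * D * D)).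
    assert (He : 0 < eps).
    { unfold eps. apply Rdiv_lt_0_compat; [apply Rmult_lt_0_compat; lra|]. repeat apply Rmult_lt_0_compat; lra. }
    destruct (HP (mkposreal eps He)) as [d1 L1]. destruct (HQ (mkposreal eps He)) as [d2 L2]. simpl in L1, L2.
    assert (Hd : 0 < Rmin d1 d2) by (apply Rmin_pos; apply cond_pos).
    assert (Hlim : exists n : nat, D / 2 ^ n < Rmin d1 d2).
    { destruct (pow_lt_1_zero (1 / 2)) with (y := Rmin d1 d2 / D) as [n Kn].
      - rewrite Rabs_pos_eq; lra.
      - apply Rdiv_lt_0_compat; assumption.
      - exists n. specialize (Kn n (Nat.le_refl n)).
        assert (0 < 2 ^ n) by (apply pow_lt; lra).
        rewrite Rabs_pos_eq in Kn by (apply pow_le; lra).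
        replace (D / 2 ^ n) with ((1 / 2) ^ n * D) by (unfold Rdiv; rewrite Rmult_1_l, pow_inv; ring).
        apply Rmult_lt_reg_r with (/ D); [apply Rinv_0_lt_compat; assumption|].
        rewrite Rmult_assoc, Rinv_r, Rmult_1_r by lra. exact Kn. }
    destruct Hlim as [n Hlim].
    destruct (Hn n) as (a' & b' & c' & d' & Ha & Hb & Hc & Hdd & Lab & Lcd & [_ HB]).
    assert (P2 : 0 < 2 ^ n) by (apply pow_lt; lra).
    set (s := / 2 ^ n). assert (Hs : 0 < s) by (apply Rinv_0_lt_compat; assumption).
    unfold Rdiv in Hlim, Lab, Lcd. fold s in Hlim, Lab, Lcd.
    assert (Hlim1 := Rlt_le_trans _ _ _ Hlim (Rmin_l _ _)). assert (Hlim2 := Rlt_le_trans _ _ _ Hlim (Rmin_r _ _)).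
    assert (Wx : b' - a' <= D * s) by (rewrite Lab; apply Rmult_le_compat_r; unfold D; lra).
    assert (Wy : d' - c' <= D * s) by (rewrite Lcd; apply Rmult_le_compat_r; unfold D; lra).
    assert (Bd : Rabs (circulation P Q a' b' c' d') <= 2 * (eps * (D * s)) * ((b' - a') + (d' - c'))).
    { apply (circulation_bound P Q a' b' c' d' x y p q r); try lra.
      - intros; apply Hcl; lra.
      - intros u v Hu Hv.
        assert (Au : Rabs (u - x) <= D * s) by (apply Rabs_le_between; lra).
        assert (Av : Rabs (v - y) <= D * s) by (apply Rabs_le_between; lra).
        split; (eapply Rle_trans; [apply L1 || apply L2; lra|]);
          apply Rmult_le_compat_l; try lra; apply Rmax_lub; assumption. }
    rewrite Lab, Lcd in Bd, HB.
    assert (Eq1 : 2 * (eps * (D * s)) * ((b - a) * s + (d - c) * s) = k * A / 2 * (s * s)).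
    { replace ((b - a) * s + (d - c) * s) with (D * s) by (unfold D; ring). unfold eps. field. lra. }
    assert (Eq2 : k * ((b - a) * s * ((d - c) * s)) = k * A * (s * s)) by (unfold A; ring).
    rewrite Eq1 in Bd. rewrite Eq2 in HB.
    assert (0 < k * A * (s * s)) by (apply Rmult_lt_0_compat; apply Rmult_lt_0_compat; assumption). lra.
Qed.

Lemma circulation_zero (P Q : R -> R -> R) a b c d :
  (forall u v, Rmin a b <= u <= Rmax a b -> Rmin c d <= v <= Rmax c d -> closed_form_at P Q u v) ->
  circulation P Q a b c d = 0.
Proof.
  intros H.
  destruct (closed_form_ex_RInt P Q (fun u v => Rmin a b <= u <= Rmax a b /\ Rmin c d <= v <= Rmax c d)) as [EP EQ].
  { intros u v [Hu Hv]; apply H; assumption. }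
  assert (Ia : Rmin a b <= a <= Rmax a b) by (split; [apply Rmin_l|apply Rmax_l]).
  assert (Ib : Rmin a b <= b <= Rmax a b) by (split; [apply Rmin_r|apply Rmax_r]).
  assert (Ic : Rmin c d <= c <= Rmax c d) by (split; [apply Rmin_l|apply Rmax_l]).
  assert (Id : Rmin c d <= d <= Rmax c d) by (split; [apply Rmin_r|apply Rmax_r]).
  assert (E1 := opp_RInt_swap _ a b (EP a b c (fun t Ht => conj Ht Ic))).
  assert (E2 := opp_RInt_swap _ a b (EP a b d (fun t Ht => conj Ht Id))).
  assert (E3 := opp_RInt_swap _ c d (EQ c d a (fun t Ht => conj Ia Ht))).
  assert (E4 := opp_RInt_swap _ c d (EQ c d b (fun t Ht => conj Ib Ht))).
  clear EP EQ Ia Ib Ic Id. unfold opp in E1, E2, E3, E4; simpl in E1, E2, E3, E4.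
  assert (Z : circulation P Q (Rmin a b) (Rmax a b) (Rmin c d) (Rmax c d) = 0).
  { apply circulation_zero_ordered; try assumption; apply Rmin_Rmax. }
  unfold circulation in *. unfold Rmin, Rmax in Z.
  destruct (Rle_dec a b), (Rle_dec c d); lra.
Qed.

(** * Potentials of closed forms and primitives on a strip *)

Lemma abs_RInt_le_const_gen (f : R -> R) a b M :
  ex_RInt f a b -> (forall t, Rmin a b <= t <= Rmax a b -> Rabs (f t) <= M) ->
  Rabs (RInt f a b) <= M * Rabs (b - a).
Proof.
  intros E H. destruct (Rle_dec a b) as [Hab|Hab].
  - rewrite (Rabs_pos_eq (b - a)), Rmult_comm by lra. apply abs_RInt_le_const; try assumption.
    intros t Ht. apply H. rewrite Rmin_left, Rmax_right by lra. exact Ht.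
  - rewrite <- (opp_RInt_swap (V := R_CompleteNormedModule)) by (apply ex_RInt_swap; exact E).
    unfold opp; simpl. rewrite Rabs_Ropp.
    rewrite (Rabs_left (b - a)) by lra. replace (M * - (b - a)) with ((a - b) * M) by ring.
    apply abs_RInt_le_const; [lra|apply ex_RInt_swap; exact E|].
    intros t Ht. apply H. rewrite Rmin_right, Rmax_left by lra. exact Ht.
Qed.

(** The path runs along the axis and then vertically. Since the circulation around the rectangle
    with sides [x, u] and [0, y] vanishes, the increment from (x, y) to (u, v) becomes the integral
    of [P] at height y plus that of [Q] at abscissa u, both short paths near (x, y), where
    continuity applies. *)
Lemma closed_form_potential (P Q : R -> R -> R) (c x y : R) :
  (forall u v, Rabs v < c -> closed_form_at P Q u v) -> Rabs y < c ->
  differentiable_pt_lim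
    (fun u v => RInt (fun t => P t 0) 0 u + RInt (fun t => Q u t) 0 v) x y (P x y) (Q x y).
Proof.
  intros Hcl Hy eps.
  destruct (closed_form_ex_RInt P Q (fun u v => Rabs v < c)) as [EP EQ].
  { intros u v Hv; apply Hcl; assumption. }
  destruct (Hcl x y Hy) as (p & q & r & HP & HQ).
  assert (KP : continuity_2d_pt P x y) by (apply differentiable_continuity_pt; exists p, q; exact HP).
  assert (KQ : continuity_2d_pt Q x y) by (apply differentiable_continuity_pt; exists q, r; exact HQ).
  assert (He : 0 < eps / 2) by (generalize (cond_pos eps); lra).
  destruct (KP (mkposreal _ He)) as [d1 L1]. destruct (KQ (mkposreal _ He)) as [d2 L2]. simpl in L1, L2.
  assert (Hd : 0 < Rmin (Rmin d1 d2) (c - Rabs y)).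
  { apply Rmin_pos; [apply Rmin_pos; apply cond_pos|lra]. }
  exists (mkposreal _ Hd). simpl. intros u v Hu Hv.
  assert (Hu1 := Rlt_le_trans _ _ _ Hu (Rmin_l _ _)). assert (Hv1 := Rlt_le_trans _ _ _ Hv (Rmin_l _ _)).
  assert (Hv2 := Rlt_le_trans _ _ _ Hv (Rmin_r _ _)). clear Hu Hv.
  assert (Hu11 := Rlt_le_trans _ _ _ Hu1 (Rmin_l _ _)). assert (Hu12 := Rlt_le_trans _ _ _ Hu1 (Rmin_r _ _)).
  assert (Hv11 := Rlt_le_trans _ _ _ Hv1 (Rmin_l _ _)). assert (Hv12 := Rlt_le_trans _ _ _ Hv1 (Rmin_r _ _)).
  assert (Hc0 : Rabs 0 < c) by (rewrite Rabs_R0; generalize (Rabs_pos y); lra).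
  assert (Hvc : Rabs v < c).
  { replace v with (y + (v - y)) by ring. eapply Rle_lt_trans; [apply Rabs_triang|lra]. }
  assert (Between : forall s t z, Rabs s < c -> Rabs t < c -> Rmin s t <= z <= Rmax s t -> Rabs z < c).
  { intros s t z Hs Ht Hz. apply Rabs_def2 in Hs. apply Rabs_def2 in Ht.
    apply Rabs_def1; [eapply Rle_lt_trans; [apply Hz|apply Rmax_lub_lt; lra]|eapply Rlt_le_trans; [|apply Hz]; apply Rmin_glb_lt; lra]. }
  assert (Near : forall s t z, Rmin s t <= z <= Rmax s t -> Rabs (z - s) <= Rabs (t - s)).
  { intros s t z Hz. unfold Rmin, Rmax in Hz. destruct (Rle_dec s t).
    - rewrite !Rabs_pos_eq; lra.
    - rewrite !Rabs_left1; lra. }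
  assert (C0 : circulation P Q x u 0 y = 0).
  { apply circulation_zero. intros s t _ Ht. apply Hcl. apply (Between 0 y); assumption. }
  unfold circulation in C0.
  assert (XP : forall s t z, Rabs z < c -> ex_RInt (fun w => P w z) s t) by (intros; apply EP; intros; assumption).
  assert (XQ : forall s t z, Rabs s < c -> Rabs t < c -> ex_RInt (fun w => Q z w) s t).
  { intros s t z Hs Ht. apply EQ. intros w Hw. apply (Between s t); assumption. }
  assert (Ch1 : RInt (fun t => P t 0) 0 x + RInt (fun t => P t 0) x u = RInt (fun t => P t 0) 0 u)
    by (apply (RInt_Chasles (V := R_CompleteNormedModule)); apply XP; assumption).
  assert (Ch2 : RInt (fun t => Q u t) 0 y + RInt (fun t => Q u t) y v = RInt (fun t => Q u t) 0 v)
    by (apply (RInt_Chasles (V := R_CompleteNormedModule)); apply XQ; assumption).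
  assert (M1 := RInt_minus_const (fun t => P t y) x u (P x y) (XP x u y Hy)).
  assert (M2 := RInt_minus_const (fun t => Q u t) y v (Q x y) (XQ y v u Hy Hvc)).
  match goal with |- Rabs ?A <= _ => replace A with
    (RInt (fun t => P t y - P x y) x u + RInt (fun t => Q u t - Q x y) y v) by lra end.
  eapply Rle_trans; [apply Rabs_triang|].
  set (m := Rmax (Rabs (u - x)) (Rabs (v - y))).
  assert (Mu : Rabs (u - x) <= m) by apply Rmax_l. assert (Mv : Rabs (v - y) <= m) by apply Rmax_r.
  replace (eps * m) with (eps / 2 * m + eps / 2 * m) by field.
  apply Rplus_le_compat.
  - apply Rle_trans with (eps / 2 * Rabs (u - x)); [|apply Rmult_le_compat_l; lra].
    apply abs_RInt_le_const_gen.
    + apply (ex_RInt_minus (V := R_NormedModule)); [apply XP; assumption|apply ex_RInt_const].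
    + intros t Ht. left. apply L1; [|rewrite Rminus_diag, Rabs_R0; apply cond_pos].
      eapply Rle_lt_trans; [apply (Near x u); exact Ht|assumption].
  - apply Rle_trans with (eps / 2 * Rabs (v - y)); [|apply Rmult_le_compat_l; lra].
    apply abs_RInt_le_const_gen.
    + apply (ex_RInt_minus (V := R_NormedModule)); [apply XQ; assumption|apply ex_RInt_const].
    + intros t Ht. left. apply L2; [assumption|].
      eapply Rle_lt_trans; [apply (Near y v); exact Ht|assumption].
Qed.

(** With f = U + i V, the form f dz is (U dx - V dy) + i (V dx + U dy), and both parts are closed by
    the Cauchy-Riemann equations. *)
Lemma Cderivable_closed_forms (f : C -> C) (x y : R) (l : C) :
  is_Cderive f (x, y) l ->
  closed_form_at (fun u v => Re (f (u, v))) (fun u v => - Im (f (u, v))) x y /\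
  closed_form_at (fun u v => Im (f (u, v))) (fun u v => Re (f (u, v))) x y.
Proof.
  intros H. destruct (differentiable_of_is_Cderive _ _ _ _ H) as [HU HV]. split.
  - exists (Re l), (- Im l), (- Re l). split; [exact HU|].
    intros eps. destruct (HV eps) as [d L]. exists d. intros u v Hu Hv.
    rewrite <- Rabs_Ropp. eapply Rle_trans; [|exact (L u v Hu Hv)]. right. f_equal. ring.
  - exists (Im l), (Re l), (- Im l). split; assumption.
Qed.

(** The potentials of the two parts of f dz are the coordinates of a primitive. Their base path
    follows the real axis, so there the primitive is an ordinary real integral; the extremal
    functions are evaluated in this way. *)
Lemma strip_primitive (f : C -> C) (c : R) :
  (forall z, Rabs (Im z) < c -> exists l, is_Cderive f z l) ->
  exists F : C -> C, (forall z, Rabs (Im z) < c -> is_Cderive F z (f z)) /\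
    forall x : R, Re (F (RtoC x)) = RInt (fun t => Re (f (RtoC t))) 0 x /\
                  Im (F (RtoC x)) = RInt (fun t => Im (f (RtoC t))) 0 x.
Proof.
  intros H.
  set (U := fun u v => Re (f (u, v))). set (V := fun u v => Im (f (u, v))).
  exists (fun z => (RInt (fun t => U t 0) 0 (Re z) + RInt (fun t => - V (Re z) t) 0 (Im z),
                    RInt (fun t => V t 0) 0 (Re z) + RInt (fun t => U (Re z) t) 0 (Im z))).
  split.
  - intros [x y] Hz. simpl in Hz.
    replace (f (x, y)) with (U x y, V x y) by (unfold U, V, Re, Im; destruct (f (x, y)); reflexivity).
    apply (is_Cderive_of_partials
      (fun a b => RInt (fun t => U t 0) 0 a + RInt (fun t => - V a t) 0 b)
      (fun a b => RInt (fun t => V t 0) 0 a + RInt (fun t => U a t) 0 b)).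
    + apply (closed_form_potential U (fun a b => - V a b) c); [|assumption].
      intros u v Hv. destruct (H (u, v) Hv) as [l Hl]. apply (Cderivable_closed_forms f u v l Hl).
    + apply (closed_form_potential V U c); [|assumption].
      intros u v Hv. destruct (H (u, v) Hv) as [l Hl]. apply (Cderivable_closed_forms f u v l Hl).
  - intros x. simpl. rewrite !RInt_point. unfold zero; simpl. rewrite !Rplus_0_r. split; reflexivity.
Qed.

(** * Mean value property and Schwarz lemma *)

Definition Ccontinuous_at (f : C -> C) (z : C) : Prop :=
  forall eps, 0 < eps -> exists delta, 0 < delta /\
    forall y, Cmod (y - z) < delta -> Cmod (f y - f z) < eps.

Lemma Cmod_Cexp (z : C) : Cmod (Cexp z) = exp (Re z).
Proof.
  unfold Cmod, Cexp; simpl.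
  replace (_ + _) with (exp (Re z) * exp (Re z) * ((sin (Im z))² + (cos (Im z))²)) by (unfold Rsqr; ring).
  rewrite sin2_cos2, Rmult_1_r. apply sqrt_square. left; apply exp_pos.
Qed.

(** The function f (z0 + exp) has period 2 pi i, so the horizontal sides of the rectangle
    [a, ln rho] x [0, 2 pi] cancel and the circle averages at radii exp a and rho agree. Continuity
    at the centre settles the limit of small radii. The centre is exempt from derivability with the
    quotient w z / z in view. *)
Lemma mean_value (f : C -> C) (z0 : C) (rho : R) :
  0 < rho ->
  (forall z, 0 < Cmod (z - z0) <= rho -> exists l, is_Cderive f z l) ->
  Ccontinuous_at f z0 ->
  ex_RInt (fun t => Re (f (z0 + Cexp (ln rho, t))%C)) 0 (2 * PI) /\
  RInt (fun t => Re (f (z0 + Cexp (ln rho, t))%C)) 0 (2 * PI) = 2 * PI * Re (f z0).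
Proof.
  intros Hr Hd Hc.
  set (b := ln rho). set (g := fun z => f (z0 + Cexp z)%C).
  assert (Hg : forall s t, s <= b -> exists l, is_Cderive g (s, t) l).
  { intros s t Hs.
    destruct (Hd (z0 + Cexp (s, t))%C) as [l Hl].
    - replace (z0 + Cexp (s, t) - z0)%C with (Cexp (s, t)) by ring. rewrite Cmod_Cexp. simpl. split; [apply exp_pos|].
      rewrite <- (exp_ln rho Hr). fold b. destruct Hs as [Hs| ->]; [left; apply exp_increasing; assumption|right; reflexivity].
    - exists ((0 + Cexp (s, t)) * l)%C. apply (is_Cderive_comp f (fun z => z0 + Cexp z)%C); [exact Hl|].
      apply is_Cderive_plus; [apply is_Cderive_const|apply is_Cderive_Cexp]. }
  set (P := fun s t => Im (g (s, t))). set (Q := fun s t => Re (g (s, t))).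
  assert (Hcl : forall s t, s <= b -> closed_form_at P Q s t).
  { intros s t Hs. destruct (Hg s t Hs) as [l Hl]. apply (Cderivable_closed_forms g s t l Hl). }
  destruct (closed_form_ex_RInt P Q (fun s t => s <= b)) as [_ EQ]; [intros; apply Hcl; assumption|].
  assert (XQ : forall a, a <= b -> ex_RInt (fun t => Q a t) 0 (2 * PI)) by (intros; apply EQ; intros; assumption).
  split; [exact (XQ b (Rle_refl b))|].
  assert (P2 := PI_RGT_0).
  assert (HJ : forall a, a <= b -> RInt (fun t => Q b t) 0 (2 * PI) = RInt (fun t => Q a t) 0 (2 * PI)).
  { intros a Hab.
    assert (Z : circulation P Q a b 0 (2 * PI) = 0).
    { apply circulation_zero_ordered; try lra. intros; apply Hcl; lra. }
    unfold circulation in Z.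
    rewrite (RInt_ext (fun x => P x (2 * PI)) (fun x => P x 0)) in Z; [lra|].
    intros x _. unfold P, g, Cexp; simpl. rewrite cos_2PI, sin_2PI, cos_0, sin_0. reflexivity. }
  change (RInt (fun t => Q b t) 0 (2 * PI) = 2 * PI * Re (f z0)).
  apply cond_eq. intros eps He.
  assert (He' : 0 < eps / (4 * PI)) by (apply Rdiv_lt_0_compat; lra).
  destruct (Hc _ He') as [d [Hdp Hdd]].
  (* The circle of radius exp a lies within the distance [d] on which [f] is close to its central
     value. *)
  set (a := Rmin b (ln (d / 2))).
  rewrite (HJ a (Rmin_l _ _)).
  assert (Ea : exp a < d).
  { apply Rle_lt_trans with (exp (ln (d / 2))).
    - assert (T : a <= ln (d / 2)) by apply Rmin_r.
      destruct T as [T| ->]; [left; apply exp_increasing; exact T|right; reflexivity].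
    - rewrite exp_ln; lra. }
  replace (2 * PI * Re (f z0)) with (Re (f z0) * (2 * PI - 0)) by ring.
  rewrite <- RInt_minus_const by (apply XQ, Rmin_l).
  eapply Rle_lt_trans; [apply (abs_RInt_le_const _ 0 (2 * PI) (eps / (4 * PI))); [lra| |]|].
  - apply (ex_RInt_minus (V := R_NormedModule)); [apply XQ, Rmin_l|apply ex_RInt_const].
  - intros t _. left. eapply Rle_lt_trans; [|apply (Hdd (z0 + Cexp (a, t))%C)].
    + unfold Q, g. eapply Rle_trans; [|apply re_le_Cmod]. right; reflexivity.
    + replace (z0 + Cexp (a, t) - z0)%C with (Cexp (a, t)) by ring. rewrite Cmod_Cexp. exact Ea.
  - replace ((2 * PI - 0) * (eps / (4 * PI))) with (eps / 2) by (field; lra). lra.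
Qed.

Lemma Re_conj_mult_le (a b : C) : 2 * Re (Cconj a * b)%C = Cmod a ^ 2 + Cmod b ^ 2 - Cmod (b - a) ^ 2.
Proof. rewrite !Cmod2_alt. destruct a, b; simpl. ring. Qed.

(* Adding eps |z|^2 makes the subharmonic function |g|^2 strictly subharmonic. *)
Lemma no_interior_max (g : C -> C) (z0 : C) (r eps : R) :
  0 < r -> 0 < eps ->
  (forall z, 0 < Cmod (z - z0) <= r -> exists l, is_Cderive g z l) ->
  Ccontinuous_at g z0 ->
  ~ (forall z, Cmod (z - z0) <= r ->
       Cmod (g z) ^ 2 + eps * Cmod z ^ 2 <= Cmod (g z0) ^ 2 + eps * Cmod z0 ^ 2).
Proof.
  intros Hr He Hd Hc Hmax.
  (* This function obeys the mean value property, and Re h at z0 is the assumed maximum M. By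
     polarization, on the circle Re h is at most M - eps r^2 / 2, so its average cannot be M. *)
  set (h := fun z => (Cconj (g z0) * g z + RtoC eps * Cconj z0 * z)%C).
  destruct (mean_value h z0 r Hr) as [Ex Mv].
  - intros z Hz. destruct (Hd z Hz) as [l Hl].
    eexists. apply is_Cderive_plus; apply is_Cderive_mult; [apply is_Cderive_const|exact Hl|apply is_Cderive_const|apply is_Cderive_id].
  - intros e He'.
    set (A := Cmod (g z0) + 1). set (B := eps * Cmod z0 + 1).
    assert (HA : 0 < A) by (unfold A; generalize (Cmod_ge_0 (g z0)); lra).
    assert (HB : 0 < B) by (unfold B; generalize (Cmod_ge_0 z0); intros; nra).
    destruct (Hc (e / (2 * A))) as [d [Hd1 Hd2]]; [apply Rdiv_lt_0_compat; lra|].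
    assert (Hq : 0 < e / (2 * B)) by (apply Rdiv_lt_0_compat; lra).
    exists (Rmin d (e / (2 * B))). split; [apply Rmin_pos; assumption|].
    intros y Hy. assert (Hy1 := Rlt_le_trans _ _ _ Hy (Rmin_l _ _)). assert (Hy2 := Rlt_le_trans _ _ _ Hy (Rmin_r _ _)).
    specialize (Hd2 y Hy1). unfold h.
    replace (Cconj (g z0) * g y + eps * Cconj z0 * y - (Cconj (g z0) * g z0 + eps * Cconj z0 * z0))%C
      with (Cconj (g z0) * (g y - g z0) + eps * Cconj z0 * (y - z0))%C by ring.
    eapply Rle_lt_trans; [apply Cmod_triangle|]. rewrite !Cmod_mult, !Cmod_conj, Cmod_R, (Rabs_pos_eq eps) by lra.
    apply Rle_lt_trans with (A * Cmod (g y - g z0) + eps * Cmod z0 * Cmod (y - z0)).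
    + apply Rplus_le_compat_r, Rmult_le_compat_r; [apply Cmod_ge_0|unfold A; lra].
    + apply Rlt_le_trans with (A * (e / (2 * A)) + B * (e / (2 * B))); [|right; field; lra].
      apply Rplus_lt_le_compat; [apply Rmult_lt_compat_l; assumption|].
      apply Rmult_le_compat; [generalize (Cmod_ge_0 z0); nra|apply Cmod_ge_0|unfold B; lra|lra].
  - set (M := Cmod (g z0) ^ 2 + eps * Cmod z0 ^ 2).
    assert (E0 : Re (h z0) = M).
    { unfold h, M. rewrite !Cmod2_alt. destruct (g z0), z0; simpl. ring. }
    rewrite E0 in Mv. assert (P2 := PI_RGT_0).
    assert (U : RInt (fun t => Re (h (z0 + Cexp (ln r, t))%C)) 0 (2 * PI) <= RInt (fun _ => M - eps * r ^ 2 / 2) 0 (2 * PI)).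
    { apply RInt_le; [lra|exact Ex|apply ex_RInt_const|].
      intros t _. set (z := (z0 + Cexp (ln r, t))%C).
      assert (Hz : Cmod (z - z0) = r).
      { unfold z. replace (z0 + Cexp (ln r, t) - z0)%C with (Cexp (ln r, t)) by ring.
        rewrite Cmod_Cexp; simpl. apply exp_ln; assumption. }
      assert (K := Hmax z ltac:(lra)). fold M in K.
      assert (R1 := Re_conj_mult_le (g z0) (g z)). assert (R2 := Re_conj_mult_le z0 z). rewrite Hz in R2.
      assert (E : Re (h z) = Re (Cconj (g z0) * g z)%C + eps * Re (Cconj z0 * z)%C).
      { unfold h. destruct (g z0), (g z), z0, z; simpl. ring. }
      assert (0 <= Cmod (g z - g z0) ^ 2) by apply pow2_ge_0.
      rewrite E. unfold M in *.
      assert (eps * (2 * Re (Cconj z0 * z)%C) = eps * (Cmod z0 ^ 2 + Cmod z ^ 2 - r ^ 2)) by (rewrite R2; ring). lra. }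
    rewrite RInt_const, Mv in U. unfold scal in U; simpl in U. unfold mult in U; simpl in U.
    assert (0 < eps * r ^ 2) by (apply Rmult_lt_0_compat; [|apply pow_lt]; assumption).
    assert (0 < PI * (eps * r ^ 2)) by (apply Rmult_lt_0_compat; assumption). simpl in *. nra.
Qed.

(** The bisected property says that each value of [F] on the disc is matched or exceeded at a disc
    point of the rectangle. If all four quarters failed, the largest of the four undominated values
    would still be dominated inside the whole rectangle, hence in a quarter. Continuity passes the
    domination to the limit point. *)
Lemma closed_disc_max (F : C -> R) (r : R) :
  0 <= r ->
  (forall z, Cmod z <= r -> forall eps, 0 < eps -> exists delta, 0 < delta /\
     forall y, Cmod y <= r -> Cmod (y - z) < delta -> Rabs (F y - F z) < eps) ->
  exists z0, Cmod z0 <= r /\ forall z, Cmod z <= r -> F z <= F z0.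
Proof.
  intros Hr Hc.
  destruct (bisection2 (fun a b c d => forall z, Cmod z <= r ->
     exists y, Cmod y <= r /\ a <= Re y <= b /\ c <= Im y <= d /\ F z <= F y) (-r) r (-r) r) as (x & y & _ & Hn).
  - intros a b c d Hab Hcd HB.
    set (m := (a + b) / 2). set (n := (c + d) / 2).
    apply NNPP. intros N.
    apply not_or_and in N as [N1 N]. apply not_or_and in N as [N2 N]. apply not_or_and in N as [N3 N4].
    apply not_all_ex_not in N1 as [z1 N1]. apply not_all_ex_not in N2 as [z2 N2].
    apply not_all_ex_not in N3 as [z3 N3]. apply not_all_ex_not in N4 as [z4 N4].
    apply imply_to_and in N1 as [K1 N1]. apply imply_to_and in N2 as [K2 N2].
    apply imply_to_and in N3 as [K3 N3]. apply imply_to_and in N4 as [K4 N4].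
    assert (Hz : exists z, Cmod z <= r /\ F z1 <= F z /\ F z2 <= F z /\ F z3 <= F z /\ F z4 <= F z).
    { assert (T : forall u v, Cmod u <= r -> Cmod v <= r -> exists w, Cmod w <= r /\ F u <= F w /\ F v <= F w).
      { intros u v Hu Hv. destruct (Rle_dec (F u) (F v)); [exists v|exists u]; repeat split; lra. }
      destruct (T z1 z2) as (u & Hu & ? & ?); [assumption..|].
      destruct (T z3 z4) as (v & Hv & ? & ?); [assumption..|].
      destruct (T u v) as (w & Hw & ? & ?); [assumption..|]. exists w. repeat split; lra. }
    destruct Hz as (z & Hz & L1 & L2 & L3 & L4).
    destruct (HB z Hz) as (p & Hp & Hx & Hy & Hf).
    destruct (Rle_dec (Re p) m), (Rle_dec (Im p) n);
      [apply N1|apply N2|apply N3|apply N4]; exists p; repeat split; lra.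
  - lra.
  - lra.
  - intros z Hz. exists z. repeat split; try lra.
    + generalize (re_le_Cmod z). intros. assert (T := Rle_trans _ _ _ H Hz). apply Rabs_le_between in T; lra.
    + generalize (re_le_Cmod z). intros. assert (T := Rle_trans _ _ _ H Hz). apply Rabs_le_between in T; lra.
    + generalize (Rmax_Cmod z) (Rmax_r (Rabs (fst z)) (Rabs (snd z))). intros. assert (T : Rabs (snd z) <= r) by lra. apply Rabs_le_between in T. unfold Im. lra.
    + generalize (Rmax_Cmod z) (Rmax_r (Rabs (fst z)) (Rabs (snd z))). intros. assert (T : Rabs (snd z) <= r) by lra. apply Rabs_le_between in T. unfold Im. lra.
  - assert (Near : forall d, 0 < d -> forall z, Cmod z <= r -> exists p, Cmod p <= r /\ Cmod (p - (x, y)) < d /\ F z <= F p).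
    { intros e He z Hz.
      destruct (pow_lt_1_zero (1 / 2)) with (y := e / (4 * r + 1)) as [n Kn].
      - rewrite Rabs_pos_eq; lra.
      - apply Rdiv_lt_0_compat; lra.
      - specialize (Kn n (Nat.le_refl n)). assert (0 < 2 ^ n) by (apply pow_lt; lra).
        rewrite Rabs_pos_eq in Kn by (apply pow_le; lra).
        replace ((1 / 2) ^ n) with (/ 2 ^ n) in Kn by (unfold Rdiv; rewrite Rmult_1_l, pow_inv; reflexivity).
        destruct (Hn n) as (a' & b' & c' & d' & Ha & Hb & Hcc & Hdd & Lab & Lcd & HB).
        destruct (HB z Hz) as (p & Hp & Hpx & Hpy & Hpf). exists p. repeat split; try assumption.
        unfold Rdiv in Lab, Lcd.
        set (s := / 2 ^ n) in *.
        assert (S2 : 4 * r * s < e).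
        { assert (0 < s) by (apply Rinv_0_lt_compat; assumption).
          apply Rle_lt_trans with ((4 * r + 1) * s); [nra|].
          apply Rlt_le_trans with ((4 * r + 1) * (e / (4 * r + 1))); [apply Rmult_lt_compat_l; lra|right; field; lra]. }
        eapply Rle_lt_trans; [|exact S2].
        destruct p as [px py]. simpl in Hpx, Hpy.
        eapply Rle_trans; [apply (Cmod_le_abs (px - x) (py - y))|].
        assert (Rabs (px - x) <= (r - - r) * s) by (apply Rabs_le_between; lra).
        assert (Rabs (py - y) <= (r - - r) * s) by (apply Rabs_le_between; lra). lra. }
    assert (K : Cmod (x, y) <= r).
    { apply Rnot_lt_le. intros Hlt.
      destruct (Near (Cmod (x, y) - r)) with (z := RtoC 0) as (p & Hp & Hd & _); [lra|rewrite Cmod_0; assumption|].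
      assert (T := Cmod_triangle p (- (p - (x, y)))%C). rewrite Cmod_opp in T.
      assert (ET : forall u v : C, (u + - (u - v))%C = v) by (intros; ring). rewrite ET in T. lra. }
    exists (x, y). split; [assumption|]. intros z Hz.
    apply Rnot_lt_le. intros Hlt.
    destruct (Hc (x, y) K (F z - F (x, y))) as [d [Hd L]]; [lra|].
    destruct (Near d Hd z Hz) as (p & Hp & Hpd & Hf).
    specialize (L p Hp Hpd). apply Rabs_def2 in L. lra.
Qed.

(** The function |w z / z|^2 + eps |z|^2 attains its maximum over |z| <= r on the circle, where |w z
    / z| r = |w z| < 1. This gives (|w z / z| r)^2 <= 1 + eps, and eps near 0 and r near 1
    conclude. *)
Lemma schwarz (w : C -> C) :
  analytic_on_disk w -> w (RtoC 0) = RtoC 0 -> (forall z, in_disk z -> Cmod (w z) < 1) ->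
  forall z, in_disk z -> Cmod (w z) <= Cmod z.
Proof.
  intros Hw W0 W1.
  destruct (Hw (RtoC 0)) as [l Hl]; [unfold in_disk; rewrite Cmod_0; lra|].
  fold (is_Cderive w 0 l) in Hl.
  set (g := fun z => if Ceq_dec z 0 then l else (w z / z)%C).
  assert (Hg0 : Ccontinuous_at g 0).
  { intros eps He. destruct (proj1 (is_Cderive_eps _ _ _) Hl (eps / 2)) as [d [Hd L]]; [lra|].
    exists d. split; [assumption|]. intros y Hy. specialize (L y Hy). rewrite W0 in L.
    unfold g. destruct (Ceq_dec 0 0) as [_|n]; [|elim n; reflexivity].
    destruct (Ceq_dec y 0) as [_|Ny].
    - replace (l - l)%C with (RtoC 0) by ring. rewrite Cmod_0. assumption.
    - replace (w y / y - l)%C with ((w y - 0 - l * (y - 0)) / y)%C by (field; assumption).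
      replace (y - 0)%C with y in * by ring.
      assert (Py := proj1 (Cmod_gt_0 y) Ny).
      rewrite Cmod_div by assumption. apply Rle_lt_trans with (eps / 2); [|lra].
      apply Rmult_le_reg_r with (Cmod y); [assumption|].
      unfold Rdiv at 1. rewrite Rmult_assoc, Rinv_l, Rmult_1_r by lra. exact L. }
  assert (Hgd : forall z, in_disk z -> z <> 0 -> exists l, is_Cderive g z l).
  { intros z Hz Nz. destruct (Hw z Hz) as [k Hk]. eexists.
    apply (is_Cderive_ext_loc (fun z => w z / z)%C g z _ (Cmod z)).
    - apply Cmod_gt_0; assumption.
    - intros y Hy. unfold g. destruct (Ceq_dec y 0) as [->|]; [|reflexivity].
      replace (0 - z)%C with (- z)%C in Hy by ring. rewrite Cmod_opp in Hy. lra.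
    - apply is_Cderive_div; [assumption|exact Hk|apply is_Cderive_id]. }
  assert (Hgc : forall z, in_disk z -> Ccontinuous_at g z).
  { intros z Hz. destruct (Ceq_dec z 0) as [->|Nz]; [assumption|].
    destruct (Hgd z Hz Nz) as [k Hk]. exact (is_Cderive_continuous g z k Hk). }
  assert (Bound : forall r eps z, 0 < r < 1 -> 0 < eps -> Cmod z <= r -> (Cmod (g z) * r) ^ 2 <= 1 + eps).
  { intros r eps z Hr He Hz.
    destruct (closed_disc_max (fun z => Cmod (g z) ^ 2 + eps * Cmod z ^ 2) r) as (z0 & Hz0 & Hmax).
    - lra.
    - intros u Hu e Hee.
      assert (Hud : in_disk u) by (unfold in_disk; lra).
      destruct (Hgc u Hud 1 Rlt_0_1) as [d0 [Hd0 L0]].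
      set (A := 2 * Cmod (g u) + 1). assert (HA : 0 < A) by (unfold A; generalize (Cmod_ge_0 (g u)); lra).
      destruct (Hgc u Hud (e / (2 * A))) as [d1 [Hd1 L1]]; [apply Rdiv_lt_0_compat; lra|].
      assert (He4 : 0 < e / (4 * eps)) by (apply Rdiv_lt_0_compat; lra).
      exists (Rmin d0 (Rmin d1 (e / (4 * eps)))). split; [repeat apply Rmin_pos; assumption|].
      intros y Hy Hyu.
      assert (Y0 := Rlt_le_trans _ _ _ Hyu (Rmin_l _ _)).
      assert (Y' := Rlt_le_trans _ _ _ Hyu (Rmin_r _ _)).
      assert (Y1 := Rlt_le_trans _ _ _ Y' (Rmin_l _ _)).
      assert (Y2 := Rlt_le_trans _ _ _ Y' (Rmin_r _ _)).
      specialize (L0 y Y0). specialize (L1 y Y1).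
      assert (Tri : forall a b : C, Rabs (Cmod a - Cmod b) <= Cmod (a - b)).
      { intros a b. assert (T1 := Cmod_triangle (a - b) b). assert (T2 := Cmod_triangle a (- (a - b))).
        rewrite Cmod_opp in T2. replace (a - b + b)%C with a in T1 by ring. replace (a + - (a - b))%C with b in T2 by ring.
        apply Rabs_le_between; lra. }
      assert (G1 := Tri (g y) (g u)). assert (G2 := Tri y u).
      replace (Cmod (g y) ^ 2 + eps * Cmod y ^ 2 - (Cmod (g u) ^ 2 + eps * Cmod u ^ 2))
        with ((Cmod (g y) - Cmod (g u)) * (Cmod (g y) + Cmod (g u)) + eps * ((Cmod y - Cmod u) * (Cmod y + Cmod u))) by ring.
      assert (N1 := Cmod_ge_0 (g y)). assert (N2 := Cmod_ge_0 (g u)). assert (N3 := Cmod_ge_0 y). assert (N4 := Cmod_ge_0 u).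
      assert (S1 : Cmod (g y) + Cmod (g u) <= A).
      { unfold A. assert (G := Rle_lt_trans _ _ _ G1 L0). apply Rabs_def2 in G. lra. }
      eapply Rle_lt_trans; [apply Rabs_triang|]. rewrite !Rabs_mult, (Rabs_pos_eq eps) by lra.
      rewrite (Rabs_pos_eq (Cmod (g y) + _)), (Rabs_pos_eq (Cmod y + _)) by lra.
      apply Rle_lt_trans with (Cmod (g y - g u) * A + eps * (Cmod (y - u) * 2)).
      { apply Rplus_le_compat; [apply Rmult_le_compat; try lra; apply Rabs_pos|].
        apply Rmult_le_compat_l; [lra|]. apply Rmult_le_compat; try lra; apply Rabs_pos. }
      apply Rlt_le_trans with (e / (2 * A) * A + eps * (e / (4 * eps) * 2)); [|right; field; lra].
      apply Rplus_lt_compat; [apply Rmult_lt_compat_r; assumption|].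
      apply Rmult_lt_compat_l; [assumption|]. apply Rmult_lt_compat_r; lra.
    - assert (Ez0 : Cmod z0 = r).
      { destruct Hz0 as [Hlt|]; [exfalso|assumption].
        (* The small disc must stay in |z| <= r and keep away from the origin, where derivability of
           the filled quotient is not established, unless the origin is its centre. *)
        set (e := if Ceq_dec z0 0 then r else Rmin (Cmod z0 / 2) (r - Cmod z0)).
        assert (He0 : 0 < e).
        { unfold e. destruct (Ceq_dec z0 0) as [|N]; [lra|]. apply Cmod_gt_0 in N. apply Rmin_pos; lra. }
        assert (Hin : forall y, Cmod (y - z0) <= e -> Cmod y <= r).
        { intros y Hy. assert (T := Cmod_triangle (y - z0) z0). replace (y - z0 + z0)%C with y in T by ring.
          unfold e in Hy. destruct (Ceq_dec z0 0) as [->|]; [rewrite Cmod_0 in T; lra|].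
          generalize (Rmin_r (Cmod z0 / 2) (r - Cmod z0)). lra. }
        apply (no_interior_max g z0 e eps He0 He).
        - intros y [Hy1 Hy2]. apply Hgd; [unfold in_disk; generalize (Hin y Hy2); lra|].
          intros ->. unfold e in Hy2. destruct (Ceq_dec z0 0) as [->|N].
          + replace (0 - 0)%C with (RtoC 0) in Hy1 by ring. rewrite Cmod_0 in Hy1. lra.
          + replace (0 - z0)%C with (- z0)%C in Hy2 by ring. rewrite Cmod_opp in Hy2. apply Cmod_gt_0 in N.
            generalize (Rmin_l (Cmod z0 / 2) (r - Cmod z0)). lra.
        - apply Hgc. unfold in_disk; lra.
        - intros y Hy. apply Hmax. apply Hin; assumption. }
      specialize (Hmax z Hz).
      assert (G0 : Cmod (g z0) * r <= 1).
      { unfold g. destruct (Ceq_dec z0 0) as [->|N]; [rewrite Cmod_0 in Ez0; lra|].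
        rewrite Cmod_div, Ez0 by assumption. unfold Rdiv. rewrite Rmult_assoc, Rinv_l, Rmult_1_r by lra.
        left; apply W1. unfold in_disk; lra. }
      rewrite Ez0 in Hmax. assert (N1 := Cmod_ge_0 (g z0)). assert (N2 := Cmod_ge_0 z).
      assert (r * r <= 1) by nra. assert (0 <= r * r) by nra.
      assert (Cmod (g z) ^ 2 <= Cmod (g z0) ^ 2 + eps * r ^ 2) by (assert (0 <= eps * Cmod z ^ 2) by (apply Rmult_le_pos; [lra|apply pow2_ge_0]); lra).
      rewrite Rpow_mult_distr.
      apply Rle_trans with ((Cmod (g z0) ^ 2 + eps * r ^ 2) * r ^ 2); [apply Rmult_le_compat_r; [apply pow2_ge_0|assumption]|].
      assert ((Cmod (g z0) * r) ^ 2 <= 1) by (rewrite <- (pow1 2); apply pow_incr; split; [apply Rmult_le_pos; lra|assumption]).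
      rewrite Rpow_mult_distr in H2.
      assert (eps * (r ^ 2 * r ^ 2) <= eps * 1) by (apply Rmult_le_compat_l; [lra|simpl; nra]). lra. }
  intros z Hz. unfold in_disk in Hz.
  destruct (Ceq_dec z 0) as [->|Nz]; [rewrite W0; lra|].
  assert (Pz := proj1 (Cmod_gt_0 z) Nz).
  assert (G : Cmod (g z) <= 1).
  { apply Rnot_lt_le. intros Hlt. set (a := Cmod (g z)) in *.
    (* If a > 1, this radius is below 1 and still has a r > 1; eps is then taken as half the excess
       of (a r)^2 over 1. *)
    set (r := Rmax (Cmod z) ((1 + / a) / 2)).
    assert (Ia : / a < 1) by (rewrite <- Rinv_1; apply Rinv_lt_contravar; lra).
    assert (0 < / a) by (apply Rinv_0_lt_compat; lra).
    assert (Hr1 : Cmod z <= r) by apply Rmax_l. assert (Hr2 : (1 + / a) / 2 <= r) by apply Rmax_r.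
    assert (Hr3 : r < 1) by (apply Rmax_lub_lt; lra).
    assert (Ar : 1 < a * r).
    { apply Rlt_le_trans with (a * ((1 + / a) / 2)); [|apply Rmult_le_compat_l; lra].
      replace (a * ((1 + / a) / 2)) with ((a + 1) / 2) by (field; lra). lra. }
    assert (B := Bound r (((a * r) ^ 2 - 1) / 2) z ltac:(lra)). fold a in B.
    assert (1 < (a * r) ^ 2) by nra. specialize (B ltac:(lra) Hr1). lra. }
  unfold g in G. destruct (Ceq_dec z 0); [contradiction|].
  rewrite Cmod_div in G by assumption.
  apply Rmult_le_compat_r with (r := Cmod z) in G; [|lra].
  unfold Rdiv in G. rewrite Rmult_assoc, Rinv_l in G by lra. lra.
Qed.

(** * The nephroid *)

Definition neph (z : C) : C := (z - z ^ 3 / 3)%C.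

Lemma phi_Ne_neph (z : C) : phi_Ne z = (1 + neph z)%C.
Proof. unfold phi_Ne, neph. ring. Qed.

Lemma RtoC_3_neq_0 : RtoC 3 <> 0.
Proof. intros H. injection H. lra. Qed.

Lemma is_Cderive_neph (z : C) : is_Cderive neph z (1 - z ^ 2)%C.
Proof.
  assert (D := is_Cderive_plus _ _ _ _ _ (is_Cderive_id z)
    (is_Cderive_mult _ _ _ _ _ (is_Cderive_const (- / 3)%C z)
      (is_Cderive_mult _ _ _ _ _ (is_Cderive_id z) (is_Cderive_mult _ _ _ _ _ (is_Cderive_id z) (is_Cderive_id z))))).
  cbv beta in D.
  assert (E : (1 + (0 * (z * (z * z)) + - / 3 * (1 * (z * z) + z * (1 * z + z * 1))))%C = (1 - z ^ 2)%C).
  { unfold Cpow. field. }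
  rewrite E in D. revert D. apply (is_Cderive_ext_loc _ _ _ _ 1 Rlt_0_1).
  intros y _. unfold neph, Cpow. field.
Qed.

(** Half the derivative of |f - v|^2 at z0 along h is Re (conj (f z0 - v) l h). A negative value
    makes |f - v| decrease for all short steps. *)
Lemma descent (f : C -> C) (z0 v l h : C) :
  is_Cderive f z0 l -> Re (Cconj (f z0 - v) * (l * h))%C < 0 ->
  exists t0, 0 < t0 /\ forall t, 0 < t < t0 -> Cmod (f (z0 + RtoC t * h) - v)%C < Cmod (f z0 - v)%C.
Proof.
  intros Hf Hneg. set (e := (f z0 - v)%C) in *. set (q := (l * h)%C) in *.
  set (k := - Re (Cconj e * q)%C) in *. assert (Hk : 0 < k) by (unfold k; lra).
  assert (Ne := Cmod_ge_0 e). assert (Nh := Cmod_ge_0 h). assert (Nq := Cmod_ge_0 q).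
  (* Of the first-order gain 2 t k in the squared modulus, the linearization error consumes at most
     t k / 2 through [e1], and the quadratic term at most t k / 2 through the bound on t. *)
  set (e1 := k / (4 * (Cmod e + 1))).
  assert (He1 : 0 < e1) by (apply Rdiv_lt_0_compat; lra).
  destruct (proj1 (is_Cderive_eps _ _ _) Hf (e1 / (Cmod h + 1))) as [d [Hd L]]; [apply Rdiv_lt_0_compat; lra|].
  set (W := Cmod q + e1). assert (HW : 0 < W) by (unfold W; lra).
  exists (Rmin (d / (Cmod h + 1)) (k / (2 * W ^ 2))).
  assert (HW2 : 0 < W ^ 2) by (apply pow_lt; assumption).
  split; [apply Rmin_pos; apply Rdiv_lt_0_compat; lra|].
  intros t [Ht Htt].
  assert (T1 := Rlt_le_trans _ _ _ Htt (Rmin_l _ _)). assert (T2 := Rlt_le_trans _ _ _ Htt (Rmin_r _ _)).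
  specialize (L (z0 + t * h)%C).
  replace (z0 + t * h - z0)%C with (t * h)%C in L by ring.
  rewrite Cmod_mult, Cmod_R, (Rabs_pos_eq t) in L by lra.
  assert (T1' : t * (Cmod h + 1) < d).
  { apply Rmult_lt_reg_r with (/ (Cmod h + 1)); [apply Rinv_0_lt_compat; lra|]. rewrite Rmult_assoc, Rinv_r by lra. unfold Rdiv in T1. lra. }
  specialize (L ltac:(lra)).
  assert (T2' : t * W ^ 2 < k / 2).
  { apply Rlt_le_trans with (k / (2 * W ^ 2) * W ^ 2); [apply Rmult_lt_compat_r; assumption|right; field; lra]. }
  set (r := (f (z0 + t * h) - f z0 - l * (t * h))%C) in *.
  assert (Hr : Cmod r <= e1 * t).
  { eapply Rle_trans; [exact L|]. replace (e1 / (Cmod h + 1) * (t * Cmod h)) with (e1 * t * (Cmod h / (Cmod h + 1))) by (field; lra).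
    rewrite <- (Rmult_1_r (e1 * t)) at 2. apply Rmult_le_compat_l; [nra|].
    apply Rmult_le_reg_r with (Cmod h + 1); [lra|]. unfold Rdiv. rewrite Rmult_assoc, Rinv_l by lra. lra. }
  set (w := (t * q + r)%C).
  assert (Ew : (f (z0 + t * h) - v)%C = (e + w)%C) by (unfold w, r, e, q; ring).
  rewrite Ew.
  assert (Hw : Cmod w <= t * W).
  { unfold w. eapply Rle_trans; [apply Cmod_triangle|]. rewrite Cmod_mult, Cmod_R, (Rabs_pos_eq t) by lra. unfold W. lra. }
  assert (Sq : Cmod (e + w) ^ 2 = Cmod e ^ 2 + 2 * Re (Cconj e * w)%C + Cmod w ^ 2).
  { rewrite !Cmod2_alt. destruct e, w; simpl. ring. }
  assert (Rw : Re (Cconj e * w)%C = - t * k + Re (Cconj e * r)%C).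
  { unfold w, k. destruct e, q, r; simpl. ring. }
  assert (Rr : Re (Cconj e * r)%C <= Cmod e * (e1 * t)).
  { eapply Rle_trans; [apply Rle_abs|]. eapply Rle_trans; [apply re_le_Cmod|]. rewrite Cmod_mult, Cmod_conj.
    apply Rmult_le_compat_l; assumption. }
  assert (Ee : Cmod e * e1 <= k / 4).
  { unfold e1. apply Rle_trans with ((Cmod e + 1) * (k / (4 * (Cmod e + 1)))); [|right; field; lra].
    apply Rmult_le_compat_r; [left; exact He1|lra]. }
  assert (Ww : Cmod w ^ 2 <= t * (k / 2)).
  { apply Rle_trans with ((t * W) ^ 2); [apply pow_incr; split; [apply Cmod_ge_0|assumption]|].
    replace ((t * W) ^ 2) with (t * (t * W ^ 2)) by ring. apply Rmult_le_compat_l; lra. }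
  assert (Fin : Cmod (e + w) ^ 2 < Cmod e ^ 2).
  { assert (Cmod e * (e1 * t) <= k / 4 * t) by (rewrite <- Rmult_assoc; apply Rmult_le_compat_r; lra).
    assert (0 < t * k) by (apply Rmult_lt_0_compat; lra). lra. }
  apply Rnot_le_lt. intros Hle. assert (Cmod e ^ 2 <= Cmod (e + w) ^ 2) by (apply pow_incr; lra). lra.
Qed.

(* With c + i s on the unit circle, (2 c - 4/3 c^3, 4/3 s^3) is its image on the nephroid and
   (4 s^2 c, 2 s (2 s^2 - 1)) an outer normal there: a point f - e of the rectangle is not
   attached to the boundary point f along the outer normal. *)
Lemma nephroid_normal_avoids_box (c s e1 e2 : R) :
  c ^ 2 + s ^ 2 = 1 -> s <> 0 ->
  e1 * (2 * s * (2 * s ^ 2 - 1)) = e2 * (4 * s ^ 2 * c) ->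
  e1 * (4 * s ^ 2 * c) + e2 * (2 * s * (2 * s ^ 2 - 1)) <= 0 ->
  Rabs (2 * c - 4 / 3 * c ^ 3 - e1) < 2 / 3 -> Rabs (4 / 3 * s ^ 3 - e2) <= 1 -> False.
Proof.
  (* The nephroid and the box are symmetric in both axes, so one quadrant suffices. *)
  assert (Main : forall c s e1 e2 : R, c ^ 2 + s ^ 2 = 1 -> 0 <= c -> 0 < s ->
    e1 * (2 * s * (2 * s ^ 2 - 1)) = e2 * (4 * s ^ 2 * c) ->
    e1 * (4 * s ^ 2 * c) + e2 * (2 * s * (2 * s ^ 2 - 1)) <= 0 ->
    Rabs (2 * c - 4 / 3 * c ^ 3 - e1) < 2 / 3 -> Rabs (4 / 3 * s ^ 3 - e2) <= 1 -> False).
  { clear. intros c s e1 e2 H1 Hc Hs Hi Hr B1 B2.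
    apply Rabs_def2 in B1. apply Rabs_le_between in B2.
    set (n1 := 4 * s ^ 2 * c) in *. set (n2 := 2 * s * (2 * s ^ 2 - 1)) in *.
    assert (S2 : 0 < s ^ 2) by (apply pow_lt; assumption).
    assert (N1 : 0 <= n1) by (unfold n1; nra).
    assert (NN : n1 ^ 2 + n2 ^ 2 = 4 * s ^ 2).
    { unfold n1, n2. replace ((4 * s ^ 2 * c) ^ 2) with (16 * (s ^ 2) ^ 2 * c ^ 2) by ring.
      replace (c ^ 2) with (1 - s ^ 2) by lra. ring. }
    (* The error e is parallel to the normal n, so e = (e.n) n / |n|^2. As e.n <= 0, a nonnegative
       coordinate of n forces the same coordinate of e to be nonpositive. *)
    assert (E1 : e1 * (n1 ^ 2 + n2 ^ 2) = (e1 * n1 + e2 * n2) * n1).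
    { replace (e1 * (n1 ^ 2 + n2 ^ 2)) with (e1 * n1 ^ 2 + e1 * n2 * n2) by ring. rewrite Hi. ring. }
    assert (E2 : e2 * (n1 ^ 2 + n2 ^ 2) = (e1 * n1 + e2 * n2) * n2).
    { replace (e2 * (n1 ^ 2 + n2 ^ 2)) with (e2 * n1 * n1 + e2 * n2 ^ 2) by ring. rewrite <- Hi. ring. }
    assert (P : 0 < n1 ^ 2 + n2 ^ 2) by lra.
    assert (L1 : e1 <= 0) by nra.
    assert (C1 : c < 1) by nra.
    (* With e1 <= 0 the nephroid point has abscissa below 2/3, and 1 - 3 c + 2 c^3 = (1 - c) (1 - 2
       c - 2 c^2). *)
    assert (F : 0 < (1 - c) * (1 - 2 * c - 2 * c ^ 2)) by lra.
    assert (F' : 0 < 1 - 2 * c - 2 * c ^ 2) by nra.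
    (* The positive root of the quadratic is (sqrt 3 - 1) / 2 < 0.37. Hence s is so large that 4/3
       s^3 > 4/3 0.9 0.86 > 1, while e2 <= 0 requires 4/3 s^3 <= 1. *)
    assert (c < 0.37) by nra. assert (S3 : 0.86 < s ^ 2) by nra.
    assert (N2 : 0 <= n2) by (unfold n2; nra).
    assert (L2 : e2 <= 0) by nra.
    assert (0.9 < s) by nra. nra. }
  intros H1 Hs Hi Hr B1 B2.
  destruct (Rle_dec 0 c), (Rlt_dec 0 s).
  - apply (Main c s e1 e2); assumption.
  - apply (Main c (- s) e1 (- e2)); try lra; try nra.
    replace (4 / 3 * (- s) ^ 3 - - e2) with (- (4 / 3 * s ^ 3 - e2)) by ring. rewrite Rabs_Ropp; assumption.
  - apply (Main (- c) s (- e1) e2); try lra; try nra.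
    replace (2 * - c - 4 / 3 * (- c) ^ 3 - - e1) with (- (2 * c - 4 / 3 * c ^ 3 - e1)) by ring. rewrite Rabs_Ropp; assumption.
  - apply (Main (- c) (- s) (- e1) (- e2)); try lra; try nra.
    + replace (2 * - c - 4 / 3 * (- c) ^ 3 - - e1) with (- (2 * c - 4 / 3 * c ^ 3 - e1)) by ring. rewrite Rabs_Ropp; assumption.
    + replace (4 / 3 * (- s) ^ 3 - - e2) with (- (4 / 3 * s ^ 3 - e2)) by ring. rewrite Rabs_Ropp; assumption.
Qed.

Lemma neph_coords (x y : R) :
  neph (x, y) = (x - x ^ 3 / 3 + x * y ^ 2, y - x ^ 2 * y + y ^ 3 / 3).
Proof.
  unfold neph, Cdiv. rewrite <- RtoC_inv by lra.
  unfold Cpow, Cminus, Cplus, Copp, Cmult, RtoC; simpl. f_equal; field.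
Qed.

(** A closest-point argument takes the place of the argument principle. The distance |neph z - v| is
    minimized over the closed disc. An interior minimum has value 0 because the derivative 1 - z^2
    does not vanish there. At a boundary minimum v would be attached to the nephroid along an outer
    normal, or the minimum would be at a cusp; the box excludes both. *)
Lemma neph_covers_box (v : C) :
  Rabs (Re v) < 2 / 3 -> Rabs (Im v) <= 1 -> exists z, Cmod z < 1 /\ neph z = v.
Proof.
  intros Bx By.
  destruct (closed_disc_max (fun z => - Cmod (neph z - v)%C) 1) as (z0 & Hz0 & Hmax).
  - lra.
  - intros z Hz eps He.
    destruct (is_Cderive_continuous _ _ _ (is_Cderive_neph z) eps He) as [d [Hd L]].
    exists d; split; [assumption|]. intros y _ Hy. specialize (L y Hy).
    eapply Rle_lt_trans; [|exact L].
    assert (T1 := Cmod_triangle (neph y - neph z) (neph z - v)).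
    assert (T2 := Cmod_triangle (neph y - v) (- (neph y - neph z))).
    rewrite Cmod_opp in T2.
    replace (neph y - neph z + (neph z - v))%C with (neph y - v)%C in T1 by ring.
    replace (neph y - v + - (neph y - neph z))%C with (neph z - v)%C in T2 by ring.
    apply Rabs_le_between; lra.
  - assert (Hmin : forall z, Cmod z <= 1 -> Cmod (neph z0 - v)%C <= Cmod (neph z - v)%C) by (intros z Hz; specialize (Hmax z Hz); lra).
    clear Hmax.
    assert (NoDesc : forall h, (exists t1, 0 < t1 /\ forall t, 0 < t < t1 -> Cmod (z0 + RtoC t * h)%C <= 1) ->
       ~ Re (Cconj (neph z0 - v) * ((1 - z0 ^ 2) * h))%C < 0).
    { intros h [t1 [Ht1 K]] Hneg.
      destruct (descent neph z0 v _ h (is_Cderive_neph z0) Hneg) as [t0 [Ht0 L]].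
      set (t := Rmin t0 t1 / 2). assert (0 < Rmin t0 t1) by (apply Rmin_pos; assumption).
      assert (A1 := Rmin_l t0 t1). assert (A2 := Rmin_r t0 t1).
      specialize (L t ltac:(unfold t; lra)). specialize (K t ltac:(unfold t; lra)).
      specialize (Hmin _ K). lra. }
    destruct Hz0 as [Hlt|Heq].
    + exists z0; split; [assumption|].
      set (e := (neph z0 - v)%C) in *.
      destruct (Ceq_dec e 0) as [E|E].
      * replace v with (neph z0 - e)%C by (unfold e; ring). rewrite E. ring.
      * exfalso. assert (D0 : (1 - z0 ^ 2)%C <> 0).
        { intros E1. assert (E2 : (z0 ^ 2)%C = 1) by (replace (z0 ^ 2)%C with (1 - (1 - z0 ^ 2))%C by ring; rewrite E1; ring).
          assert (E3 : Cmod z0 ^ 2 = 1) by (rewrite <- Cmod_pow, E2; apply Cmod_1).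
          generalize (Cmod_ge_0 z0). nra. }
        (* Newton's direction: the first-order change of the error is -e, so the derivative in
           question is -|e|^2. *)
        apply (NoDesc (- (e / (1 - z0 ^ 2)))%C).
        -- set (h := (- (e / (1 - z0 ^ 2)))%C). assert (Nh := Cmod_ge_0 h).
           exists ((1 - Cmod z0) / (Cmod h + 1)). split; [apply Rdiv_lt_0_compat; lra|].
           intros t [Ht Ht1]. eapply Rle_trans; [apply Cmod_triangle|]. rewrite Cmod_mult, Cmod_R, (Rabs_pos_eq t) by lra.
           assert (t * (Cmod h + 1) < 1 - Cmod z0).
           { apply Rlt_le_trans with ((1 - Cmod z0) / (Cmod h + 1) * (Cmod h + 1)); [apply Rmult_lt_compat_r; lra|right; field; lra]. }
           lra.
        -- replace ((1 - z0 ^ 2) * - (e / (1 - z0 ^ 2)))%C with (- e)%C by (field; assumption).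
           apply Cmod_gt_0 in E. assert (S : Cmod e ^ 2 = Re e ^ 2 + Im e ^ 2) by apply Cmod2_alt.
           assert (0 < Cmod e ^ 2) by (apply pow_lt; assumption). destruct e; simpl in *. nra.
    + exfalso. destruct z0 as [c s]. destruct v as [vx vy]. simpl in Bx, By.
      assert (Hcs : c ^ 2 + s ^ 2 = 1).
      { assert (T := Cmod2_alt (c, s)). rewrite Heq in T. simpl in T. simpl. lra. }
      set (e1 := c - c ^ 3 / 3 + c * s ^ 2 - vx). set (e2 := s - c ^ 2 * s + s ^ 3 / 3 - vy).
      assert (Ee : (neph (c, s) - (vx, vy))%C = (e1, e2)) by (rewrite neph_coords; reflexivity).
      rewrite Ee in *.
      destruct (Req_dec s 0) as [->|Ns].
      * assert (Cc : c = 1 \/ c = - 1) by (destruct (Rle_dec 0 c); [left|right]; nra).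
        (* At a cusp the derivative vanishes, and the step is taken along the real axis: neph (c (1
           - t)) = neph c - c (t^2 - t^3 / 3). The distance to v decreases once 2 c e1 exceeds this
           shift. *)
        assert (Step : forall t, 0 < t <= 1 -> 2 * c * e1 > t ^ 2 - t ^ 3 / 3 -> False).
        { intros t Ht Hlt.
          assert (Hin : Cmod (c * (1 - t), 0) <= 1).
          { eapply Rle_trans; [apply Cmod_le_abs|]. rewrite Rabs_R0, Rabs_mult, (Rabs_pos_eq (1 - t)) by lra.
            destruct Cc as [-> | ->]; [rewrite Rabs_R1|rewrite (Rabs_left (-1)) by lra]; lra. }
          specialize (Hmin _ Hin). rewrite neph_coords in Hmin.
          set (x1 := c * (1 - t) - (c * (1 - t)) ^ 3 / 3 + c * (1 - t) * 0 ^ 2) in Hmin.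
          set (y1 := 0 - (c * (1 - t)) ^ 2 * 0 + 0 ^ 3 / 3) in Hmin.
          change ((x1, y1) - (vx, vy))%C with (x1 - vx, y1 - vy) in Hmin.
          assert (Sq : Cmod (e1, e2) ^ 2 <= Cmod (x1 - vx, y1 - vy) ^ 2)
            by (apply pow_incr; split; [apply Cmod_ge_0|exact Hmin]).
          rewrite !Cmod2_alt in Sq. unfold Re, Im, fst, snd in Sq.
          set (d := t ^ 2 - t ^ 3 / 3) in *. assert (Hd : 0 < d) by (unfold d; simpl; nra).
          assert (X : x1 - vx = e1 - c * d) by (unfold x1, e1, d; destruct Cc as [-> | ->]; field).
          assert (Y : y1 - vy = e2) by (unfold y1, e2; field).
          rewrite X, Y in Sq.
          assert (c ^ 2 = 1) by lra. nra. }
        assert (Ce : 0 < c * e1).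
        { apply Rabs_def2 in Bx. unfold e1. destruct Cc as [-> | ->]; lra. }
        set (t := Rmin 1 (c * e1)). assert (T1 := Rmin_l 1 (c * e1)). assert (T2 := Rmin_r 1 (c * e1)). fold t in T1, T2.
        assert (0 < t) by (apply Rmin_pos; lra).
        apply (Step t); [lra|]. assert (0 < t ^ 3) by (apply pow_lt; lra). nra.
      (* Directions are written z0 (m1 + i m2), with m1 radial and m2 tangential. The coefficients
         [b1] and [b2] are the scalar and cross products of the error with the outer normal, so
         optimality over all m1 < 0 means b2 = 0 and b1 <= 0. *)
      * set (b1 := e1 * (4 * s ^ 2 * c) + e2 * (2 * s * (2 * s ^ 2 - 1))).
        set (b2 := e1 * (2 * s * (2 * s ^ 2 - 1)) - e2 * (4 * s ^ 2 * c)).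
        assert (Hb : forall m1 m2, Re (Cconj (e1, e2) * ((1 - (c, s) ^ 2) * ((c, s) * (m1, m2))))%C = b1 * m1 - b2 * m2).
        { intros m1 m2. unfold b1, b2. simpl.
          assert (N1 : 4 * s ^ 2 * c = c - c ^ 3 + 3 * c * s ^ 2) by (replace (c ^ 3) with (c * c ^ 2) by ring; replace (c ^ 2) with (1 - s ^ 2) by lra; ring).
          assert (N2 : 2 * s * (2 * s ^ 2 - 1) = s - 3 * c ^ 2 * s + s ^ 3) by (replace (c ^ 2) with (1 - s ^ 2) by lra; ring).
          simpl in N1, N2. rewrite N1, N2. ring. }
        assert (Adm : forall m1 m2, m1 < 0 -> exists t1, 0 < t1 /\ forall t, 0 < t < t1 -> Cmod ((c, s) + RtoC t * ((c, s) * (m1, m2)))%C <= 1).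
        { intros m1 m2 Hm. assert (0 < m1 ^ 2 + m2 ^ 2) by nra.
          exists (- (2 * m1) / (m1 ^ 2 + m2 ^ 2)). split; [apply Rdiv_lt_0_compat; lra|]. intros t [Ht Ht1].
          assert (t * (m1 ^ 2 + m2 ^ 2) < - (2 * m1)).
          { apply Rlt_le_trans with (- (2 * m1) / (m1 ^ 2 + m2 ^ 2) * (m1 ^ 2 + m2 ^ 2)); [apply Rmult_lt_compat_r; assumption|right; field; lra]. }
          replace ((c, s) + t * ((c, s) * (m1, m2)))%C with ((c, s) * ((1 + t * m1)%R, (t * m2)%R))%C
            by (unfold Cplus, Cmult, RtoC; simpl; f_equal; ring).
          rewrite Cmod_mult, Heq, Rmult_1_l.
          assert (S : Cmod (1 + t * m1, t * m2) ^ 2 <= 1) by (rewrite Cmod2_alt; simpl; nra).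
          generalize (Cmod_ge_0 (1 + t * m1, t * m2)). nra. }
        destruct (Req_dec b2 0) as [E2|E2].
        -- destruct (Rle_dec b1 0) as [E1|E1].
           ++ apply (nephroid_normal_avoids_box c s e1 e2); try assumption.
              ** unfold b2 in E2; lra.
              ** replace (2 * c - 4 / 3 * c ^ 3 - e1) with vx; [assumption|].
                 unfold e1. replace (s ^ 2) with (1 - c ^ 2) by lra. field.
              ** replace (4 / 3 * s ^ 3 - e2) with vy; [assumption|].
                 unfold e2. replace (c ^ 2) with (1 - s ^ 2) by lra. field.
           ++ apply (NoDesc ((c, s) * ((-1)%R, 0%R))%C); [apply Adm; lra|]. rewrite Hb. lra.
        (* The tangential component b2 gains b2^2. The inward component makes the direction
           admissible and costs less than half of this gain. *)
        -- set (dl := b2 ^ 2 / (2 * (Rabs b1 + 1))).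
           assert (Pb : 0 < b2 ^ 2) by (simpl; nra). assert (Nb := Rabs_pos b1).
           assert (Pd : 0 < dl) by (apply Rdiv_lt_0_compat; lra).
           apply (NoDesc ((c, s) * ((- dl)%R, b2))%C); [apply Adm; lra|]. rewrite Hb.
           assert (dl * (Rabs b1 + 1) = b2 ^ 2 / 2) by (unfold dl; field; lra).
           assert (- b1 <= Rabs b1) by (rewrite <- Rabs_Ropp; apply Rle_abs).
           assert (dl * - b1 <= dl * Rabs b1) by (apply Rmult_le_compat_l; lra).
           simpl in *. lra.
Qed.

(** * Lifting analytic functions through the nephroid map *)

(** Where one factor vanishes, the product rule asks only continuity of the other; for the lift,
    that other factor is an inverse slope known merely to be continuous. *)
Lemma is_Cderive_mult_zero (f g : C -> C) (z a : C) :
  f z = 0 -> is_Cderive f z a -> Ccontinuous_at g z ->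
  is_Cderive (fun y => f y * g y)%C z (a * g z)%C.
Proof.
  intros F0 Hf Hg. apply is_Cderive_eps. intros eps He.
  assert (Na := Cmod_ge_0 a). assert (Ng := Cmod_ge_0 (g z)).
  destruct (proj1 (is_Cderive_eps _ _ _) Hf (eps / (2 * (Cmod (g z) + 1)))) as [d1 [Hd1 L1]]; [apply Rdiv_lt_0_compat; lra|].
  destruct (Hg 1 Rlt_0_1) as [d2 [Hd2 L2]].
  destruct (Hg (eps / (2 * (Cmod a + 1)))) as [d3 [Hd3 L3]]; [apply Rdiv_lt_0_compat; lra|].
  exists (Rmin d1 (Rmin d2 d3)). split; [repeat apply Rmin_pos; assumption|].
  intros y Hy.
  assert (Y1 := Rlt_le_trans _ _ _ Hy (Rmin_l _ _)). assert (Y' := Rlt_le_trans _ _ _ Hy (Rmin_r _ _)).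
  assert (Y2 := Rlt_le_trans _ _ _ Y' (Rmin_l _ _)). assert (Y3 := Rlt_le_trans _ _ _ Y' (Rmin_r _ _)).
  specialize (L1 y Y1). specialize (L2 y Y2). specialize (L3 y Y3). rewrite F0 in *.
  replace (f y * g y - 0 * g z - a * g z * (y - z))%C
    with ((f y - 0 - a * (y - z)) * g y + a * (g y - g z) * (y - z))%C by ring.
  eapply Rle_trans; [apply Cmod_triangle|]. rewrite !Cmod_mult.
  set (h := Cmod (y - z)) in *. assert (0 <= h) by apply Cmod_ge_0.
  assert (G : Cmod (g y) <= Cmod (g z) + 1).
  { assert (T := Cmod_triangle (g y - g z) (g z)). replace (g y - g z + g z)%C with (g y) in T by ring. lra. }
  replace (eps * h) with (eps / (2 * (Cmod (g z) + 1)) * h * (Cmod (g z) + 1) + (Cmod a + 1) * (eps / (2 * (Cmod a + 1))) * h) by (field; lra).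
  apply Rplus_le_compat.
  - apply Rmult_le_compat; try assumption; apply Cmod_ge_0.
  - apply Rmult_le_compat_r; [assumption|]. apply Rmult_le_compat; try apply Cmod_ge_0; lra.
Qed.

Lemma neph_sub (a b : C) : (neph a - neph b)%C = ((a - b) * (1 - (a * a + a * b + b * b) / 3))%C.
Proof. unfold neph, Cpow. field. Qed.

(** Quantitative univalence: this factor is (neph a - neph b) / (a - b) for a <> b, and its modulus
    is at least 1 - (1 + |b| + |b|^2) / 3 = (1 - |b|) (2 + |b|) / 3. *)
Lemma neph_slope_bound (a b : C) :
  Cmod a < 1 -> Cmod b < 1 -> (1 - Cmod b) / 2 <= Cmod (1 - (a * a + a * b + b * b) / 3)%C.
Proof.
  intros Ha Hb. set (q := ((a * a + a * b + b * b) / 3)%C).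
  assert (Na := Cmod_ge_0 a). assert (Nb := Cmod_ge_0 b).
  assert (Q : Cmod q <= (Cmod a * Cmod a + Cmod a * Cmod b + Cmod b * Cmod b) / 3).
  { unfold q. rewrite Cmod_div by exact RtoC_3_neq_0. rewrite Cmod_R, (Rabs_pos_eq 3) by lra.
    apply Rmult_le_compat_r; [lra|]. eapply Rle_trans; [apply Cmod_triangle|]. rewrite Cmod_mult.
    apply Rplus_le_compat_r. eapply Rle_trans; [apply Cmod_triangle|]. rewrite !Cmod_mult. lra. }
  assert (T := Cmod_triangle (1 - q) q). replace (1 - q + q)%C with (RtoC 1) in T by ring. rewrite Cmod_1 in T. nra.
Qed.

(** The lift comes from a pointwise choice, so even continuity must be earned. The lower bound on
    the slope [s] gives it, then 1 / s is continuous, and om y = om z + (u y - u z) / s y is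
    differentiated by the product rule with vanishing factor. *)
Lemma neph_lift_derivable (om u : C -> C) (z : C) :
  in_disk z -> (forall y, in_disk y -> Cmod (om y) < 1 /\ neph (om y) = u y) ->
  (exists l, is_Cderive u z l) -> exists l, is_Cderive om z l.
Proof.
  intros Hz Hom [l Hl].
  destruct (Hom z Hz) as [Hz1 Hz2].
  set (s := fun y => (1 - (om y * om y + om y * om z + om z * om z) / 3)%C).
  set (m := (1 - Cmod (om z)) / 2). assert (Hm : 0 < m) by (unfold m; lra).
  assert (Hs : forall y, in_disk y -> m <= Cmod (s y)) by (intros y Hy; apply neph_slope_bound; [apply Hom|]; assumption).
  assert (Es : forall y, in_disk y -> (u y - u z)%C = ((om y - om z) * s y)%C).
  { intros y Hy. rewrite <- (proj2 (Hom y Hy)), <- Hz2. apply neph_sub. }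
  assert (Ns : forall y, in_disk y -> s y <> 0).
  { intros y Hy. apply Cmod_gt_0. generalize (Hs y Hy). lra. }
  assert (Din : forall y, Cmod (y - z) < 1 - Cmod z -> in_disk y).
  { intros y Hy. unfold in_disk in *. assert (T := Cmod_triangle (y - z) z). replace (y - z + z)%C with y in T by ring. lra. }
  assert (Com : Ccontinuous_at om z).
  { intros eps He. destruct (is_Cderive_continuous _ _ _ Hl (eps * m)) as [d [Hd L]]; [apply Rmult_lt_0_compat; assumption|].
    exists (Rmin d (1 - Cmod z)). split; [unfold in_disk in Hz; apply Rmin_pos; lra|]. intros y Hy.
    assert (Hy1 := Rlt_le_trans _ _ _ Hy (Rmin_l _ _)). assert (Hy2 := Din y (Rlt_le_trans _ _ _ Hy (Rmin_r _ _))).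
    specialize (L y Hy1). rewrite Es, Cmod_mult in L by assumption. specialize (Hs y Hy2).
    apply Rmult_lt_reg_r with m; [assumption|]. eapply Rle_lt_trans; [|exact L].
    apply Rmult_le_compat_l; [apply Cmod_ge_0|assumption]. }
  assert (Cs : Ccontinuous_at (fun y => / s y)%C z).
  { intros eps He.
    destruct (Com (eps * (m * m))) as [d [Hd L]]; [apply Rmult_lt_0_compat; [|apply Rmult_lt_0_compat]; assumption|].
    exists (Rmin d (1 - Cmod z)). split; [unfold in_disk in Hz; apply Rmin_pos; lra|]. intros y Hy.
    assert (Hy1 := Rlt_le_trans _ _ _ Hy (Rmin_l _ _)). assert (Hy2 := Din y (Rlt_le_trans _ _ _ Hy (Rmin_r _ _))).
    specialize (L y Hy1).
    replace (/ s y - / s z)%C with ((om y - om z) * (((om y + om z) + om z) / 3) / (s y * s z))%C.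
    2: { transitivity ((s z - s y) / (s y * s z))%C; [unfold s at 3 4; f_equal; field|field; split; apply Ns; assumption]. }
    rewrite Cmod_div by (apply Cmult_neq_0; apply Ns; assumption). rewrite !Cmod_mult.
    rewrite Cmod_div by exact RtoC_3_neq_0. rewrite Cmod_R, (Rabs_pos_eq 3) by lra.
    assert (A : Cmod (om y + om z + om z) / 3 <= 1).
    { destruct (Hom y Hy2) as [Hy3 _].
      assert (T1 := Cmod_triangle (om y + om z) (om z)). assert (T2 := Cmod_triangle (om y) (om z)). lra. }
    assert (Sy := Hs y Hy2). assert (Sz := Hs z Hz).
    assert (SS : m * m <= Cmod (s y) * Cmod (s z)) by (apply Rmult_le_compat; lra).
    assert (Pm : 0 < m * m) by (apply Rmult_lt_0_compat; assumption).
    apply Rmult_lt_reg_r with (Cmod (s y) * Cmod (s z)); [lra|].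
    unfold Rdiv at 1. rewrite Rmult_assoc, Rinv_l, Rmult_1_r by lra.
    apply Rle_lt_trans with (Cmod (om y - om z)); [|eapply Rlt_le_trans; [exact L|apply Rmult_le_compat_l; lra]].
    rewrite <- (Rmult_1_r (Cmod (om y - om z))) at 2. apply Rmult_le_compat_l; [apply Cmod_ge_0|exact A]. }
  exists (0 + (l + - 0) * / s z)%C.
  apply (is_Cderive_ext_loc (fun y => om z + (u y + - u z) * / s y)%C om z _ (1 - Cmod z)).
  - unfold in_disk in Hz; lra.
  - intros y Hy. assert (Hy2 := Din y Hy).
    replace (u y + - u z)%C with (u y - u z)%C by ring. rewrite Es by assumption. field. apply Ns; assumption.
  - apply is_Cderive_plus; [apply is_Cderive_const|].
    apply (is_Cderive_mult_zero (fun y => u y + - u z)%C (fun y => / s y)%C); [ring| |exact Cs].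
    apply is_Cderive_plus; [exact Hl|]. replace (- 0)%C with (RtoC 0) by ring. apply is_Cderive_const.
Qed.

Lemma analytic_on_disk_phi_Ne : analytic_on_disk phi_Ne.
Proof.
  intros z _. apply (is_Cderive_ex _ _ (0 + (1 - z ^ 2))%C).
  apply (is_Cderive_ext_loc (fun z => 1 + neph z)%C phi_Ne z _ 1 Rlt_0_1); [intros; symmetry; apply phi_Ne_neph|].
  apply is_Cderive_plus; [apply is_Cderive_const|apply is_Cderive_neph].
Qed.

Lemma subordinate_phi_Ne (p : C -> C) :
  analytic_on_disk p -> p (RtoC 0) = RtoC 1 ->
  (forall z, in_disk z -> Rabs (Re (p z) - 1) < 2 / 3 /\ Rabs (Im (p z)) <= 1) ->
  subordinate p phi_Ne.
Proof.
  intros Hp P0 Box.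
  assert (Ex : forall z, exists w, in_disk z -> Cmod w < 1 /\ neph w = (p z - 1)%C).
  { intros z. destruct (classic (in_disk z)) as [Hz|N]; [|exists (RtoC 0); intros; contradiction].
    destruct (Box z Hz) as [B1 B2].
    destruct (neph_covers_box (p z - 1)%C) as [w Hw].
    - destruct (p z); simpl in *. exact B1.
    - destruct (p z); simpl in *. replace (r0 + - 0) with r0 by ring. exact B2.
    - exists w. intros _. exact Hw. }
  set (om := fun z => proj1_sig (constructive_indefinite_description _ (Ex z))).
  assert (Hom : forall z, in_disk z -> Cmod (om z) < 1 /\ neph (om z) = (p z - 1)%C)
    by (intros z; exact (proj2_sig (constructive_indefinite_description _ (Ex z)))).
  clearbody om.
  split; [exact Hp|split; [exact analytic_on_disk_phi_Ne|]].
  exists om. split; [|split; [|split]].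
  - intros z Hz. destruct (neph_lift_derivable om (fun y => p y - 1)%C z Hz Hom) as [l Hl].
    + destruct (Hp z Hz) as [l Hl]. exists (l + 0)%C. apply is_Cderive_plus; [exact Hl|apply is_Cderive_const].
    + exact (is_Cderive_ex _ _ _ Hl).
  (* The choice is forced to send 0 to 0: [neph] vanishes at both [om 0] and 0, and the slope
     between them is nonzero. *)
  - assert (D0 : in_disk 0) by (unfold in_disk; rewrite Cmod_0; lra).
    destruct (Hom _ D0) as [H1 H2]. rewrite P0 in H2.
    assert (E := neph_sub (om 0) 0). rewrite H2 in E.
    assert (N0 : neph 0 = 0) by (unfold neph, Cpow; field). rewrite N0 in E.
    assert (S := neph_slope_bound (om 0) 0 H1 ltac:(rewrite Cmod_0; lra)). rewrite Cmod_0 in S.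
    set (k := (1 - (om 0 * om 0 + om 0 * 0 + 0 * 0) / 3)%C) in *.
    destruct (Ceq_dec (om 0) 0) as [|N]; [assumption|exfalso].
    assert (K : ((om 0 - 0) * k)%C <> 0).
    { apply Cmult_neq_0; [replace (om 0 - 0)%C with (om 0) by ring; assumption|]. apply Cmod_gt_0; lra. }
    apply K. rewrite <- E. ring.
  - intros z Hz. apply Hom; assumption.
  - intros z Hz. rewrite phi_Ne_neph, (proj2 (Hom z Hz)). ring.
Qed.

(** * The function tanh (t / 2) and the value of ell (1) *)

(* [th t = tanh (t / 2)] and [Cth z = tanh (z / 2) = phi_SG z - 1]. *)
Definition th (t : R) : R := (exp t - 1) / (exp t + 1).
Definition Cth (z : C) : C := ((Cexp z - 1) / (Cexp z + 1))%C.

(** The integrand of [ell] on the real axis, with the removable value th'(0) = 1/2 filled in so that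
    it is continuous everywhere. *)
Definition thq (t : R) : R := if Req_EM_T t 0 then 1 / 2 else th t / t.

Definition thq_int (x : R) : R := RInt thq 0 x.

Lemma nondecreasing_of_derive (f df : R -> R) (a b : R) :
  a <= b -> (forall t, a < t < b -> is_derive f t (df t)) ->
  (forall t, a <= t <= b -> continuous f t) -> (forall t, a < t < b -> 0 <= df t) -> f a <= f b.
Proof.
  intros Hab Hd Hc Hp.
  (* The intermediate point may be an endpoint, where the sign of [df] is unknown; hence the
     positive part. *)
  destruct (MVT_gen f a b (fun t => Rmax 0 (df t))) as (c & Hcc & E).
  - intros t Ht. rewrite Rmin_left, Rmax_right in Ht by lra. rewrite Rmax_right by (apply Hp; lra). apply Hd; lra.
  - intros t Ht. rewrite Rmin_left, Rmax_right in Ht by lra. apply continuity_pt_filterlim. apply Hc; lra.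
  - assert (0 <= Rmax 0 (df c)) by apply Rmax_l. nra.
Qed.

Lemma is_derive_continuous (f : R -> R) (t l : R) : is_derive f t l -> continuous f t.
Proof. intros H. apply (ex_derive_continuous (K := R_AbsRing) (V := R_NormedModule)). exists l; exact H. Qed.

Lemma is_derive_th (t : R) : is_derive th t ((1 - th t ^ 2) / 2).
Proof.
  unfold th. assert (P := exp_pos t). auto_derive; [lra|]. field. lra.
Qed.

Lemma th_0 : th 0 = 0.
Proof. unfold th. rewrite exp_0. lra. Qed.

Lemma th_pos (t : R) : 0 < t -> 0 < th t.
Proof.
  intros Ht. unfold th. assert (1 < exp t) by (rewrite <- exp_0; apply exp_increasing; assumption).
  apply Rdiv_lt_0_compat; lra.
Qed.

Lemma th_le (s t : R) : s <= t -> th s <= th t.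
Proof.
  intros H. assert (Ps := exp_pos s). assert (Pt := exp_pos t).
  assert (E : exp s <= exp t) by (destruct H as [H| ->]; [left; apply exp_increasing; assumption|right; reflexivity]).
  unfold th. apply Rmult_le_reg_r with ((exp s + 1) * (exp t + 1)); [apply Rmult_lt_0_compat; lra|].
  replace ((exp s - 1) / (exp s + 1) * ((exp s + 1) * (exp t + 1))) with ((exp s - 1) * (exp t + 1)) by (field; lra).
  replace ((exp t - 1) / (exp t + 1) * ((exp s + 1) * (exp t + 1))) with ((exp t - 1) * (exp s + 1)) by (field; lra).
  lra.
Qed.

Lemma continuous_thq (t : R) : continuous thq t.
Proof.
  destruct (Req_dec t 0) as [->|Nt].
  - apply (filterlim_locally (U := R_UniformSpace)). intros eps.
    assert (D := is_derive_th 0). rewrite th_0 in D. replace ((1 - 0 ^ 2) / 2) with (1 / 2) in D by field.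
    apply is_derive_Reals in D. destruct (D eps (cond_pos eps)) as [d Hd].
    exists d. intros y Hy. unfold thq. destruct (Req_EM_T 0 0) as [_|n]; [|lra].
    destruct (Req_EM_T y 0) as [|Ny]; [apply ball_center|].
    assert (Hy' : Rabs y < d) by (replace y with (y - 0) by ring; exact Hy).
    specialize (Hd y Ny Hy'). rewrite Rplus_0_l, th_0, Rminus_0_r in Hd. exact Hd.
  - apply (continuous_ext_loc _ (fun t => th t / t)).
    + exists (mkposreal _ (Rabs_pos_lt t Nt)). intros y Hy. unfold thq. destruct (Req_EM_T y 0) as [->|]; [|reflexivity].
      exfalso. assert (H : Rabs (0 - t) < Rabs t) by exact Hy. rewrite Rminus_0_l, Rabs_Ropp in H. lra.
    + apply (ex_derive_continuous (K := R_AbsRing) (V := R_NormedModule)).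
      auto_derive. repeat split; try assumption. eexists; apply is_derive_th.
Qed.

Lemma RInt_primitive (a : R -> R) (lo hi : R) :
  lo < 0 < hi -> (forall t, lo < t < hi -> continuous a t) ->
  forall t, lo < t < hi -> is_derive (fun x => RInt a 0 x) t (a t).
Proof.
  intros H0 Hc t Ht. apply (is_derive_RInt (V := R_NormedModule) a (fun x => RInt a 0 x) 0 t); [|apply Hc; assumption].
  assert (Hd : 0 < Rmin (t - lo) (hi - t)) by (apply Rmin_pos; lra).
  exists (mkposreal _ Hd). intros y Hy.
  assert (Hy' : Rabs (y - t) < Rmin (t - lo) (hi - t)) by exact Hy.
  assert (A1 := Rmin_l (t - lo) (hi - t)). assert (A2 := Rmin_r (t - lo) (hi - t)). apply Rabs_def2 in Hy'.
  apply (RInt_correct (V := R_CompleteNormedModule)). apply (ex_RInt_continuous (V := R_CompleteNormedModule)).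
  intros z Hz. apply Hc.
  split; [eapply Rlt_le_trans; [|apply Hz]; apply Rmin_glb_lt; lra|eapply Rle_lt_trans; [apply Hz|]; apply Rmax_lub_lt; lra].
Qed.

Lemma is_derive_thq_int (t : R) : is_derive thq_int t (thq t).
Proof.
  apply (RInt_primitive thq (- Rabs t - 1) (Rabs t + 1)).
  - generalize (Rabs_pos t). lra.
  - intros; apply continuous_thq.
  - generalize (Rle_abs t) (Rle_abs (- t)). rewrite Rabs_Ropp. lra.
Qed.

Lemma thq_pos (t : R) : 0 < t -> 0 < thq t.
Proof.
  intros H. unfold thq. destruct (Req_EM_T t 0); [lra|]. apply Rdiv_lt_0_compat; [apply th_pos|]; assumption.
Qed.

Lemma thq_int_0 : thq_int 0 = 0.
Proof. unfold thq_int. rewrite RInt_point. reflexivity. Qed.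

Lemma thq_int_lt (s t : R) : 0 <= s < t -> thq_int s < thq_int t.
Proof.
  intros H. destruct (MVT_gen thq_int s t (fun t => thq t)) as (c & Hcc & E).
  - intros; apply is_derive_thq_int.
  - intros x _. apply continuity_pt_filterlim. eapply is_derive_continuous, is_derive_thq_int.
  - rewrite Rmin_left, Rmax_right in Hcc by lra.
    destruct (Rlt_dec 0 c) as [Pc|].
    + assert (P := thq_pos c Pc). nra.
    + assert (c = 0) by lra. subst c. unfold thq in E. destruct (Req_EM_T 0 0); nra.
Qed.

Lemma Cexp_RtoC (t : R) : Cexp (RtoC t) = RtoC (exp t).
Proof. unfold Cexp, RtoC; simpl. rewrite cos_0, sin_0. f_equal; ring. Qed.

(** The two integrands agree on the open interval, so the value produced by division at 0 does not
    matter. *)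
Lemma ell1_eq : ell1 = thq_int 1.
Proof.
  unfold ell1, ell.
  assert (H : is_RInt (V := C_R_NormedModule) (fun s => ell_integrand (RtoC s * RtoC 1)) 0 1 (RtoC (thq_int 1))).
  { apply (is_RInt_ext (V := C_R_NormedModule) (fun s => RtoC (thq s))).
    - intros s Hs. rewrite Rmin_left, Rmax_right in Hs by lra. rewrite Cmult_1_r.
      unfold ell_integrand. rewrite Cexp_RtoC. unfold thq. destruct (Req_EM_T s 0); [lra|].
      unfold th. assert (P := exp_pos s).
      rewrite !RtoC_div, RtoC_plus, RtoC_minus by lra.
      match goal with |- ?a = ?b => change (@eq C a b) end. field.
      split; intros E; injection E; lra.
    - apply (is_RInt_fct_extend_pair (U := R_NormedModule) (V := R_NormedModule) (fun s => RtoC (thq s)) 0 1 (thq_int 1) 0).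
      + apply (RInt_correct (V := R_CompleteNormedModule)). apply (ex_RInt_continuous (V := R_CompleteNormedModule)).
        intros; apply continuous_thq.
      + generalize (is_RInt_const (V := R_NormedModule) 0 1 0).
        unfold scal; simpl; unfold mult; simpl. rewrite Rmult_0_r. intros Z; exact Z. }
  rewrite (is_RInt_unique (V := C_R_CompleteNormedModule) _ _ _ _ H). rewrite Cmult_1_l. reflexivity.
Qed.

(* [u' <= (1 - u^2) / 2] with [u 0 = 0] makes [u] a subsolution of the Riccati equation of [th]. *)
Lemma le_th_of_riccati (u du : R -> R) (t : R) :
  0 <= t -> u 0 = 0 -> (forall s, 0 <= s <= t -> is_derive u s (du s)) ->
  (forall s, 0 <= s <= t -> -1 < u s < 1) -> (forall s, 0 <= s <= t -> 2 * du s <= 1 - u s ^ 2) -> u t <= th t.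
Proof.
  intros Ht U0 Du B Hr.
  (* The logarithms form the inverse function of [th]: m s = s - 2 artanh (u s), nondecreasing by
     the Riccati inequality. *)
  set (m := fun s => s - ln (1 + u s) + ln (1 - u s)).
  assert (M : m 0 <= m t).
  { assert (D : forall s, 0 <= s <= t -> is_derive m s (1 - 2 * du s / (1 - u s ^ 2))).
    { intros s Hs. assert (Bs := B s Hs). assert (Ds := Du s Hs). unfold m.
      auto_derive; [repeat split; try lra; try (exists (du s); exact Ds)|].
      rewrite (is_derive_unique _ _ _ Ds : Derive (fun x => u x) s = du s). field. split; nra. }
    apply (nondecreasing_of_derive m (fun s => 1 - 2 * du s / (1 - u s ^ 2)) 0 t Ht).
    - intros s Hs; apply D; lra.
    - intros s Hs; eapply is_derive_continuous, D; lra.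
    - intros s Hs. assert (Bs := B s ltac:(lra)). assert (Rs := Hr s ltac:(lra)). assert (0 < 1 - u s ^ 2) by nra.
      apply Rmult_le_reg_r with (1 - u s ^ 2); [assumption|].
      replace ((1 - 2 * du s / (1 - u s ^ 2)) * (1 - u s ^ 2)) with (1 - u s ^ 2 - 2 * du s) by (field; lra). lra. }
  unfold m in M. rewrite U0, Rplus_0_r, Rminus_0_r, ln_1 in M.
  assert (Bt := B t ltac:(lra)).
  assert (E : (1 + u t) / (1 - u t) <= exp t).
  { rewrite <- (exp_ln ((1 + u t) / (1 - u t))) by (apply Rdiv_lt_0_compat; lra).
    rewrite ln_div by lra. destruct (Rle_lt_or_eq_dec (ln (1 + u t) - ln (1 - u t)) t) as [L|L]; [lra| |rewrite L; lra].
    left; apply exp_increasing; assumption. }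
  assert (P := exp_pos t).
  apply Rmult_le_compat_r with (r := 1 - u t) in E; [|lra].
  unfold Rdiv in E. rewrite Rmult_assoc, Rinv_l in E by lra.
  unfold th. apply Rmult_le_reg_r with (exp t + 1); [lra|]. unfold Rdiv. rewrite Rmult_assoc, Rinv_l by lra. lra.
Qed.

(** The mirrored comparison, with [u] a supersolution. *)
Lemma th_le_of_riccati (u du : R -> R) (t : R) :
  0 <= t -> u 0 = 0 -> (forall s, 0 <= s <= t -> is_derive u s (du s)) ->
  (forall s, 0 <= s <= t -> -1 < u s < 1) -> (forall s, 0 <= s <= t -> 1 - u s ^ 2 <= 2 * du s) -> th t <= u t.
Proof.
  intros Ht U0 Du B Hr.
  set (m := fun s => ln (1 + u s) - ln (1 - u s) - s).
  assert (M : m 0 <= m t).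
  { assert (D : forall s, 0 <= s <= t -> is_derive m s (2 * du s / (1 - u s ^ 2) - 1)).
    { intros s Hs. assert (Bs := B s Hs). assert (Ds := Du s Hs). unfold m.
      auto_derive; [repeat split; try lra; try (exists (du s); exact Ds)|].
      rewrite (is_derive_unique _ _ _ Ds : Derive (fun x => u x) s = du s). field. split; nra. }
    apply (nondecreasing_of_derive m (fun s => 2 * du s / (1 - u s ^ 2) - 1) 0 t Ht).
    - intros s Hs; apply D; lra.
    - intros s Hs; eapply is_derive_continuous, D; lra.
    - intros s Hs. assert (Bs := B s ltac:(lra)). assert (Rs := Hr s ltac:(lra)). assert (0 < 1 - u s ^ 2) by nra.
      apply Rmult_le_reg_r with (1 - u s ^ 2); [assumption|].
      replace ((2 * du s / (1 - u s ^ 2) - 1) * (1 - u s ^ 2)) with (2 * du s - (1 - u s ^ 2)) by (field; lra). lra. }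
  unfold m in M. rewrite U0, Rplus_0_r, !Rminus_0_r, ln_1 in M.
  assert (Bt := B t ltac:(lra)).
  assert (E : exp t <= (1 + u t) / (1 - u t)).
  { rewrite <- (exp_ln ((1 + u t) / (1 - u t))) by (apply Rdiv_lt_0_compat; lra).
    rewrite ln_div by lra. destruct (Rle_lt_or_eq_dec t (ln (1 + u t) - ln (1 - u t))) as [L|L]; [lra| |rewrite <- L; lra].
    left; apply exp_increasing; assumption. }
  assert (P := exp_pos t).
  apply Rmult_le_compat_r with (r := 1 - u t) in E; [|lra].
  unfold Rdiv in E. rewrite Rmult_assoc, Rinv_l in E by lra.
  unfold th. apply Rmult_le_reg_r with (exp t + 1); [lra|]. unfold Rdiv. rewrite Rmult_assoc, Rinv_l by lra. lra.
Qed.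

(** Taylor polynomial of tanh (t / 2) at 0. The signs alternate, so degree 9 bounds from above and
    degree 11 from below; these degrees give the six decimals required. *)
Definition th_taylor9 (t : R) : R :=
  t / 2 - t ^ 3 / 24 + t ^ 5 / 240 - 17 * t ^ 7 / 40320 + 31 * t ^ 9 / 725760.
Definition th_taylor11 (t : R) : R := th_taylor9 t - 691 * t ^ 11 / 159667200.

Lemma th_taylor9_range (s : R) : 0 <= s <= 1 -> 0 <= th_taylor9 s <= 0.6.
Proof.
  intros Hs. unfold th_taylor9.
  assert (P : forall n, 0 <= s ^ n <= 1) by (intros n; split; [apply pow_le; lra|rewrite <- (pow1 n); apply pow_incr; lra]).
  assert (Q : s ^ 3 <= s /\ s ^ 7 <= s ^ 5).
  { replace (s ^ 3) with (s * s ^ 2) by ring. replace (s ^ 7) with (s ^ 5 * s ^ 2) by ring.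
    generalize (P 2%nat) (P 5%nat). nra. }
  generalize (P 3%nat) (P 5%nat) (P 7%nat) (P 9%nat). lra.
Qed.

Lemma th_le_taylor9 (t : R) : 0 <= t <= 1 -> th t <= th_taylor9 t.
Proof.
  intros Ht.
  apply (th_le_of_riccati th_taylor9 (fun t => 1 / 2 - t ^ 2 / 8 + t ^ 4 / 48 - 17 * t ^ 6 / 5760 + 31 * t ^ 8 / 80640)).
  - lra.
  - unfold th_taylor9; simpl; lra.
  - intros s _. unfold th_taylor9. auto_derive; [exact I|]. field.
  - intros s Hs. generalize (th_taylor9_range s). lra.
  - intros s Hs. apply Rminus_le.
    (* The Riccati residual of the degree 9 polynomial begins at degree 10, and on [0, 1] its first
       coefficient outweighs the others, which settles its sign. The same happens from degree 12 on
       for the lower bound. *)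
    replace (_ - _) with (s ^ 10 * (- 691 / 7257600 + 11 / 1555200 * s ^ 2 - 2603 / 4877107200 * s ^ 4 + 527 / 14631321600 * s ^ 6 - 961 / 526727577600 * s ^ 8))
      by (unfold th_taylor9; field).
    assert (P : forall n, 0 <= s ^ n <= 1) by (intros n; split; [apply pow_le; lra|rewrite <- (pow1 n); apply pow_incr; lra]).
    assert (T : 0 <= s ^ 10 * - (- 691 / 7257600 + 11 / 1555200 * s ^ 2 - 2603 / 4877107200 * s ^ 4 + 527 / 14631321600 * s ^ 6 - 961 / 526727577600 * s ^ 8)).
    { apply Rmult_le_pos; [apply P|]. generalize (P 2%nat) (P 4%nat) (P 6%nat) (P 8%nat). lra. }
    lra.
Qed.

Lemma taylor11_le_th (t : R) : 0 <= t <= 1 -> th_taylor11 t <= th t.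
Proof.
  intros Ht.
  apply (le_th_of_riccati th_taylor11 (fun t => 1 / 2 - t ^ 2 / 8 + t ^ 4 / 48 - 17 * t ^ 6 / 5760 + 31 * t ^ 8 / 80640 - 691 * t ^ 10 / 14515200)).
  - lra.
  - unfold th_taylor11, th_taylor9; simpl; lra.
  - intros s _. unfold th_taylor11, th_taylor9. auto_derive; [exact I|]. field.
  - intros s Hs. generalize (th_taylor9_range s ltac:(lra)). unfold th_taylor11.
    assert (P : 0 <= s ^ 11 <= 1) by (split; [apply pow_le; lra|rewrite <- (pow1 11); apply pow_incr; lra]). lra.
  - intros s Hs. apply Rminus_le.
    replace (_ - _) with (- (s ^ 12 * (5461 / 479001600 - 47981 / 53648179200 * s ^ 2 + 58007 / 804722688000 * s ^ 4 - 11327 / 2069286912000 * s ^ 6 + 21421 / 57940033536000 * s ^ 8 - 477481 / 25493614755840000 * s ^ 10)))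
      by (unfold th_taylor11, th_taylor9; field).
    assert (P : forall n, 0 <= s ^ n <= 1) by (intros n; split; [apply pow_le; lra|rewrite <- (pow1 n); apply pow_incr; lra]).
    assert (T : 0 <= s ^ 12 * (5461 / 479001600 - 47981 / 53648179200 * s ^ 2 + 58007 / 804722688000 * s ^ 4 - 11327 / 2069286912000 * s ^ 6 + 21421 / 57940033536000 * s ^ 8 - 477481 / 25493614755840000 * s ^ 10)).
    { apply Rmult_le_pos; [apply P|]. generalize (P 2%nat) (P 4%nat) (P 6%nat) (P 8%nat) (P 10%nat). lra. }
    lra.
Qed.

(** The Taylor bounds on [th] are divided by t and integrated term by term, the comparison being
    made on derivatives. Their gap at 1 is 691 / 1756339200, below 4 10^-7. *)
Lemma ell1_bounds : 0.48688856 <= ell1 <= 0.48688896.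
Proof.
  rewrite ell1_eq.
  set (hi := fun t => t / 2 - t ^ 3 / 72 + t ^ 5 / 1200 - 17 * t ^ 7 / 282240 + 31 * t ^ 9 / 6531840 - thq_int t).
  assert (Up : hi 0 <= hi 1).
  { assert (D : forall t, is_derive hi t
      (1 / 2 - t ^ 2 / 24 + t ^ 4 / 240 - 17 * t ^ 6 / 40320 + 31 * t ^ 8 / 725760 - thq t)).
    { intros t. assert (Dt := is_derive_thq_int t). unfold hi. auto_derive; [exists (thq t); exact Dt|].
      rewrite (is_derive_unique _ _ _ Dt : Derive (fun x => thq_int x) t = thq t). field. }
    eapply nondecreasing_of_derive; [lra|intros; apply D|intros; eapply is_derive_continuous, D|].
    intros t Ht. cbv beta. unfold thq. destruct (Req_EM_T t 0); [lra|].
    assert (T := th_le_taylor9 t ltac:(lra)). unfold th_taylor9 in T.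
    apply Rmult_le_reg_r with t; [lra|].
    match goal with |- _ <= ?X => replace X with (t / 2 - t ^ 3 / 24 + t ^ 5 / 240 - 17 * t ^ 7 / 40320 + 31 * t ^ 9 / 725760 - th t) by (field; assumption) end. lra. }
  set (lo := fun t => thq_int t - (t / 2 - t ^ 3 / 72 + t ^ 5 / 1200 - 17 * t ^ 7 / 282240 + 31 * t ^ 9 / 6531840 - 691 * t ^ 11 / 1756339200)).
  assert (Lo : lo 0 <= lo 1).
  { assert (D : forall t, is_derive lo t
      (thq t - (1 / 2 - t ^ 2 / 24 + t ^ 4 / 240 - 17 * t ^ 6 / 40320 + 31 * t ^ 8 / 725760 - 691 * t ^ 10 / 159667200))).
    { intros t. assert (Dt := is_derive_thq_int t). unfold lo. auto_derive; [exists (thq t); exact Dt|].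
      rewrite (is_derive_unique _ _ _ Dt : Derive (fun x => thq_int x) t = thq t). field. }
    eapply nondecreasing_of_derive; [lra|intros; apply D|intros; eapply is_derive_continuous, D|].
    intros t Ht. cbv beta. unfold thq. destruct (Req_EM_T t 0); [lra|].
    assert (T := taylor11_le_th t ltac:(lra)). unfold th_taylor11, th_taylor9 in T.
    apply Rmult_le_reg_r with t; [lra|].
    match goal with |- _ <= ?X => replace X with (th t - (t / 2 - t ^ 3 / 24 + t ^ 5 / 240 - 17 * t ^ 7 / 40320 + 31 * t ^ 9 / 725760 - 691 * t ^ 11 / 159667200)) by (field; assumption) end. lra. }
  unfold hi in Up. unfold lo in Lo. simpl in Up, Lo. rewrite thq_int_0 in *. lra.
Qed.

Lemma th_ln (y : R) : 0 < y -> th (ln y) = (y - 1) / (y + 1).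
Proof. intros H. unfold th. rewrite exp_ln by assumption. reflexivity. Qed.

(** Since [th] is monotone with the exact value 1/4 at ln (5/3), its Taylor bounds at two nearby
    points enclose this logarithm. *)
Lemma ln_5_3_bounds : 0.5108255 < ln (5 / 3) < 0.5108257.
Proof.
  assert (T := th_ln (5 / 3) ltac:(lra)). replace ((5 / 3 - 1) / (5 / 3 + 1)) with (1 / 4) in T by field.
  split; apply Rnot_le_lt; intros H; apply th_le in H; rewrite T in H.
  - assert (U := th_le_taylor9 0.5108255 ltac:(lra)). unfold th_taylor9 in U. simpl in U. lra.
  - assert (U := taylor11_le_th 0.5108257 ltac:(lra)). unfold th_taylor11, th_taylor9 in U. simpl in U. lra.
Qed.

Lemma beta_a_approx : Rabs (3 * ell1 / 2 - 730333 / 1000000) < 1 / 1000000.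
Proof. assert (H := ell1_bounds). apply Rabs_def1; lra. Qed.

Lemma beta_b_bounds : 953140 / 1000000 < ell1 / ln (5 / 3) < 953142 / 1000000.
Proof.
  assert (H := ell1_bounds). assert (L := ln_5_3_bounds).
  assert (E : ell1 / ln (5 / 3) * ln (5 / 3) = ell1) by (field; lra).
  split; apply Rmult_lt_reg_r with (ln (5 / 3)); lra.
Qed.

Lemma beta_b_approx : Rabs (ell1 / ln (5 / 3) - 953141 / 1000000) < 1 / 1000000.
Proof. assert (H := beta_b_bounds). apply Rabs_def1; lra. Qed.

Lemma beta_c_approx : Rabs (5 * ell1 / 2 - 121722 / 100000) < 1 / 100000.
Proof. assert (H := ell1_bounds). apply Rabs_def1; lra. Qed.

(** * Bounds along rays *)

Lemma cos_ge_parabola (y : R) : 1 - y ^ 2 / 2 <= cos y.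
Proof.
  assert (P : forall y, 0 <= y -> 1 - y ^ 2 / 2 <= cos y).
  { clear y. intros y Hy. set (f := fun t => cos t + t ^ 2 / 2).
    assert (D : forall t, is_derive f t (t - sin t)) by (intros t; unfold f; auto_derive; [exact I|field]).
    assert (M : f 0 <= f y).
    { apply (nondecreasing_of_derive f (fun t => t - sin t)); [assumption|intros; apply D| |].
      - intros; eapply is_derive_continuous, D.
      - intros t Ht. generalize (sin_lt_x t). lra. }
    unfold f in M. rewrite cos_0 in M. simpl in *. lra. }
  destruct (Rle_dec 0 y); [apply P; assumption|].
  rewrite <- cos_neg. replace (y ^ 2) with ((- y) ^ 2) by ring. apply P; lra.
Qed.

(** A bound on tan (y / 2) = sin y / (1 + cos y). With u = y^2, comparing 1 - u/6 + u^2/120 with a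
    multiple of 2 - u/2 requires 101/180 at u = 1; 0.562 is just above it. *)
Lemma sin_le_half_angle_bound (y : R) : 0 <= y <= 1 -> sin y <= 0.562 * y * (1 + cos y).
Proof.
  intros Hy. destruct (pre_sin_bound y 0) as [_ U]; [lra|lra|].
  unfold sin_approx, sin_term in U. simpl in U.
  assert (Cy := cos_ge_parabola y). simpl in Cy.
  set (u := y ^ 2). assert (Hu : 0 <= u <= 1) by (unfold u; simpl; nra).
  assert (U' : sin y <= y * (1 - u / 6 + u ^ 2 / 120)) by (unfold u; simpl; lra).
  assert (K : 1 - u / 6 + u ^ 2 / 120 <= 0.562 * (2 - u / 2)) by nra.
  apply Rle_trans with (y * (0.562 * (2 - u / 2))); [eapply Rle_trans; [exact U'|apply Rmult_le_compat_l; lra]|].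
  replace (0.562 * y * (1 + cos y)) with (y * (0.562 * (1 + cos y))) by ring.
  apply Rmult_le_compat_l; [lra|]. unfold u; simpl; lra.
Qed.

Lemma cosh_ge_1 (x : R) : 1 <= cosh x.
Proof.
  unfold cosh. assert (Hm : exp x * exp (- x) = 1) by (rewrite <- exp_plus, Rplus_opp_r; apply exp_0).
  assert (0 < exp x) by apply exp_pos. assert (0 < exp (- x)) by apply exp_pos.
  assert (0 <= (exp x - exp (- x)) ^ 2) by apply pow2_ge_0. simpl in *. nra.
Qed.

Lemma cosh_le_2 (r : R) : 0 <= r <= 1 -> cosh r <= 2.
Proof.
  intros H. unfold cosh.
  assert (exp r <= 3).
  { apply Rle_trans with (exp 1); [|exact exp_le_3].
    destruct (Rle_lt_or_eq_dec r 1) as [L| ->]; [lra| |lra]. left; apply exp_increasing; assumption. }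
  assert (exp (- r) <= 1).
  { rewrite <- exp_0. destruct (Rle_lt_or_eq_dec 0 r) as [L|L]; [lra| |].
    - left; apply exp_increasing; lra.
    - rewrite <- L, Ropp_0. lra. }
  lra.
Qed.

(** The real part of tanh ((x + i y) / 2) is sinh x / (cosh x + cos y). Bounding cos y below by 1 -
    (r^2 - x^2) / 2 leaves an inequality in r alone: [psi] vanishes at x and increases up to r. *)
Lemma sinh_cosh_ineq (x y r : R) :
  0 <= x <= r -> r <= 1 -> x ^ 2 + y ^ 2 <= r ^ 2 ->
  sinh x * (cosh r + 1) <= sinh r * (cosh x + cos y).
Proof.
  intros Hx Hr Hy. assert (Cy := cos_ge_parabola y).
  set (psi := fun s => sinh s * (cosh x + 1 - (s ^ 2 - x ^ 2) / 2) - sinh x * (cosh s + 1)).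
  assert (D : forall s, is_derive psi s (cosh s * (cosh x + 1 - (s ^ 2 - x ^ 2) / 2) - sinh s * s - sinh x * sinh s)).
  { intros s. unfold psi, sinh, cosh. auto_derive; [exact I|]. field. }
  assert (M : psi x <= psi r).
  { eapply nondecreasing_of_derive; [lra|intros; apply D|intros; eapply is_derive_continuous, D|].
    intros s Hs. cbv beta.
    assert (E : cosh s * cosh x - sinh x * sinh s = cosh (s - x)).
    { unfold cosh, sinh. replace (- (s - x)) with (- s + x) by ring. unfold Rminus. rewrite !exp_plus. field. }
    assert (G := cosh_ge_1 (s - x)). assert (G2 := cosh_le_2 s ltac:(lra)). assert (G3 := cosh_ge_1 s).
    assert (S : sinh s <= cosh s) by (unfold sinh, cosh; generalize (exp_pos (- s)); lra).
    assert (S0 : sinh s * s <= cosh s * s) by (apply Rmult_le_compat_r; lra).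
    (* The parenthesis is nonnegative up to s = 1 thanks to the added 1/2, whose cost cosh s / 2 <=
       1 is paid by cosh (s - x) >= 1. *)
    assert (S1 : 0 <= cosh s * (1 - s ^ 2 / 2 + x ^ 2 / 2 - s + 1 / 2)) by (apply Rmult_le_pos; simpl; nra).
    nra. }
  assert (P0 : psi x = 0) by (unfold psi; field).
  unfold psi in P0, M. rewrite P0 in M.
  assert (Sr : 0 <= sinh r).
  { destruct (Rle_lt_or_eq_dec 0 r) as [L|L]; [lra| |].
    - left. rewrite <- sinh_0. apply sinh_lt; assumption.
    - rewrite <- L, sinh_0. lra. }
  assert (sinh r * (cosh x + 1 - (r ^ 2 - x ^ 2) / 2) <= sinh r * (cosh x + cos y)) by (apply Rmult_le_compat_l; simpl in *; lra).
  lra.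
Qed.

Lemma th_sinh_cosh (r : R) : th r = sinh r / (cosh r + 1).
Proof.
  unfold th, sinh, cosh. rewrite exp_Ropp. assert (P := exp_pos r). field. repeat split; nra.
Qed.

Lemma Cexp_plus_1_neq_0 (z : C) : Rabs (Im z) <= 3 / 2 -> (Cexp z + 1)%C <> 0.
Proof.
  intros H E. apply Rabs_le_between in H. assert (Hp := PI2_3_2).
  assert (P : 0 < cos (Im z)) by (apply cos_gt_0; lra).
  assert (P2 := exp_pos (Re z)). assert (E1 := f_equal Re E). simpl in E1. nra.
Qed.

Lemma Cth_coords (x y : R) : 0 < cos y -> Cth (x, y) = (sinh x / (cosh x + cos y), sin y / (cosh x + cos y)).
Proof.
  intros Hc. assert (G := cosh_ge_1 x). assert (P := exp_pos x).
  assert (N : (Cexp (x, y) + 1)%C <> 0).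
  { intros E. assert (E1 := f_equal Re E). simpl in E1. nra. }
  assert (E2 : exp x * exp (- x) = 1) by (rewrite <- exp_plus, Rplus_opp_r; apply exp_0).
  unfold Cth.
  assert (K : (Cexp (x, y) - 1)%C = (((sinh x / (cosh x + cos y))%R, (sin y / (cosh x + cos y))%R) * (Cexp (x, y) + 1))%C).
  { unfold Cexp, Cminus, Cplus, Copp, Cmult, RtoC; simpl.
    assert (SC : sin y * sin y = 1 - cos y * cos y) by (generalize (sin2_cos2 y); unfold Rsqr; lra).
    set (D := cosh x + cos y) in *. assert (Dp : D <> 0) by (unfold D; lra).
    assert (G1 : (exp x * cos y - 1) * D = sinh x * (exp x * cos y + 1) - sin y * (exp x * sin y)).
    { replace (sin y * (exp x * sin y)) with (exp x * (1 - cos y * cos y)) by (rewrite <- SC; ring).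
      unfold D, sinh, cosh. set (e := exp x) in *. set (f := exp (- x)) in *. set (c := cos y) in *.
      transitivity (c * (e * e) / 2 + c * (e * f) / 2 + e * c ^ 2 - (e + f) / 2 - c); [field|].
      transitivity (c * (e * e) / 2 - c * (e * f) / 2 + (e - f) / 2 - e + e * c ^ 2); [rewrite E2; field|field]. }
    assert (G2 : exp x * sin y * D = sinh x * (exp x * sin y) + sin y * (exp x * cos y + 1)).
    { unfold D, sinh, cosh. set (e := exp x) in *. set (f := exp (- x)) in *. set (c := cos y) in *. set (t := sin y) in *.
      transitivity (t * (e * e) / 2 + t * (e * f) / 2 + e * t * c); [field|].
      transitivity (t * (e * e) / 2 - t * (e * f) / 2 + t + e * t * c); [rewrite E2; field|field]. }
    f_equal.
    - transitivity ((sinh x * (exp x * cos y + 1) - sin y * (exp x * sin y)) / D); [rewrite <- G1|]; field; assumption.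
    - transitivity ((sinh x * (exp x * sin y) + sin y * (exp x * cos y + 1)) / D); [rewrite <- G2|]; field; assumption. }
  rewrite K. field. exact N.
Qed.

Lemma cos_pos_le_1 (y : R) : Rabs y <= 1 -> 1 / 2 <= cos y.
Proof.
  intros H. apply Rabs_le_between in H. assert (C := cos_ge_parabola y). simpl in C. nra.
Qed.

Lemma Cth_Re_bound (z : C) (r : R) : Cmod z <= r -> r <= 1 -> Rabs (Re (Cth z)) <= th r.
Proof.
  destruct z as [x y]. intros Hz Hr.
  assert (N := Cmod_ge_0 (x, y)).
  assert (S : x ^ 2 + y ^ 2 <= r ^ 2).
  { assert (T := Cmod2_alt (x, y)). simpl in T. simpl. nra. }
  assert (Ay : Rabs y <= 1) by (apply Rabs_le_between; simpl in S; split; nra).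
  assert (Cy := cos_pos_le_1 y Ay). rewrite Cth_coords by lra. simpl.
  assert (G := cosh_ge_1 x). assert (Gr := cosh_ge_1 r). assert (R0 : 0 <= r) by lra.
  rewrite th_sinh_cosh.
  assert (P : forall x, 0 <= x -> x ^ 2 + y ^ 2 <= r ^ 2 -> sinh x / (cosh x + cos y) <= sinh r / (cosh r + 1) /\ 0 <= sinh x / (cosh x + cos y)).
  { clear x G Hz S N. intros x Hx S. assert (G := cosh_ge_1 x).
    assert (Ineq := sinh_cosh_ineq x y r ltac:(simpl in S; split; nra) Hr S).
    split.
    - apply Rmult_le_reg_r with ((cosh x + cos y) * (cosh r + 1)); [apply Rmult_lt_0_compat; lra|].
      replace (sinh x / (cosh x + cos y) * ((cosh x + cos y) * (cosh r + 1))) with (sinh x * (cosh r + 1)) by (field; lra).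
      replace (sinh r / (cosh r + 1) * ((cosh x + cos y) * (cosh r + 1))) with (sinh r * (cosh x + cos y)) by (field; lra).
      exact Ineq.
    - apply Rmult_le_pos; [|left; apply Rinv_0_lt_compat; lra].
      destruct Hx as [L|<-]; [left; rewrite <- sinh_0; apply sinh_lt; assumption|rewrite sinh_0; lra]. }
  destruct (Rle_dec 0 x) as [L|L].
  - destruct (P x L S). rewrite Rabs_pos_eq; assumption.
  - destruct (P (- x)) as [P1 P2]; [lra|simpl in *; lra|].
    assert (E1 : sinh (- x) = - sinh x) by (unfold sinh; rewrite Ropp_involutive; field).
    assert (E2 : cosh (- x) = cosh x) by (unfold cosh; rewrite Ropp_involutive; field).
    rewrite E1, E2 in *. rewrite <- Rabs_Ropp, Rabs_pos_eq; unfold Rdiv in *; lra.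
Qed.

(** As cosh x >= 1, the worst case is x = 0, where the imaginary part is tan (y / 2). *)
Lemma Cth_Im_bound (z : C) : Cmod z <= 1 -> Rabs (Im (Cth z)) <= 0.562 * Cmod z.
Proof.
  destruct z as [x y]. intros Hz.
  assert (M := Rmax_Cmod (x, y)). simpl in M. assert (M2 := Rmax_r (Rabs x) (Rabs y)).
  assert (Ay : Rabs y <= 1) by lra.
  assert (Cy := cos_pos_le_1 y Ay). rewrite Cth_coords by lra. simpl.
  assert (G := cosh_ge_1 x).
  apply Rle_trans with (0.562 * Rabs y); [|lra].
  unfold Rdiv. rewrite Rabs_mult, (Rabs_pos_eq (/ _)) by (left; apply Rinv_0_lt_compat; lra).
  assert (S : Rabs (sin y) <= 0.562 * Rabs y * (1 + cos y)).
  { apply Rabs_le_between in Ay. destruct (Rle_dec 0 y) as [L|L].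
    - rewrite !Rabs_pos_eq; try lra; [apply sin_le_half_angle_bound; lra|]. apply sin_ge_0; generalize PI2_3_2; lra.
    - rewrite <- (Rabs_Ropp y), <- (Rabs_Ropp (sin y)), <- sin_neg, <- cos_neg.
      rewrite !Rabs_pos_eq; try lra; [apply sin_le_half_angle_bound; lra|]. apply sin_ge_0; generalize PI2_3_2; lra. }
  assert (A := Rabs_pos y).
  apply Rmult_le_reg_r with (cosh x + cos y); [lra|]. rewrite Rmult_assoc, Rinv_l by lra. rewrite Rmult_1_r.
  eapply Rle_trans; [exact S|]. apply Rmult_le_compat_l; lra.
Qed.

Lemma phi_SG_Cth (z : C) : Cmod z < 1 -> phi_SG z = (1 + Cth z)%C.
Proof.
  intros H. unfold phi_SG, Cth. rewrite Cexp_opp.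
  assert (N : (Cexp z + 1)%C <> 0).
  { apply Cexp_plus_1_neq_0. assert (M := Rmax_Cmod z). assert (M2 := Rmax_r (Rabs (fst z)) (Rabs (snd z))). unfold Im. lra. }
  field. repeat split; first [apply Cexp_neq_0 | exact N | rewrite Cplus_comm; exact N].
Qed.

(** * Integration along rays *)

Lemma ray_derive (f : C -> C) (z l : C) (t : R) :
  is_Cderive f (RtoC t * z)%C l ->
  is_derive (fun s => Re (f (RtoC s * z)%C)) t (Re (l * z)%C) /\
  is_derive (fun s => Im (f (RtoC s * z)%C)) t (Im (l * z)%C).
Proof.
  destruct z as [x y]. intros H.
  assert (E : forall s : R, (RtoC s * (x, y))%C = ((s * x)%R, (s * y)%R)).
  { intros s. unfold Cmult, RtoC; simpl. f_equal; ring. }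
  rewrite E in H. destruct (differentiable_of_is_Cderive _ _ _ _ H) as [HU HV].
  assert (Dx : forall c, derivable_pt_lim (fun s => s * c) t c).
  { intros c. apply is_derive_Reals. auto_derive; [exact I|ring]. }
  split; apply is_derive_Reals.
  - assert (D := derivable_pt_lim_comp_2d _ _ _ _ _ _ _ _ HU (Dx x) (Dx y)).
    replace (Re (l * (x, y))%C) with (Re l * x + - Im l * y) by (destruct l; simpl; ring).
    apply is_derive_Reals. apply is_derive_Reals in D. revert D. apply is_derive_ext. intros s. rewrite E. reflexivity.
  - assert (D := derivable_pt_lim_comp_2d _ _ _ _ _ _ _ _ HV (Dx x) (Dx y)).
    replace (Im (l * (x, y))%C) with (Im l * x + Re l * y) by (destruct l; simpl; ring).
    apply is_derive_Reals. apply is_derive_Reals in D. revert D. apply is_derive_ext. intros s. rewrite E. reflexivity.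
Qed.

Lemma difference_quotient_extension (f : R -> R) (l lo hi : R) :
  f 0 = 0 -> lo < 0 < hi -> is_derive f 0 l -> (forall t, lo < t < hi -> continuous f t) ->
  forall t, lo < t < hi -> continuous (fun t => if Req_EM_T t 0 then l else f t / t) t.
Proof.
  intros F0 H0 D Hc t Ht.
  destruct (Req_dec t 0) as [->|Nt].
  - apply (filterlim_locally (U := R_UniformSpace)). intros eps.
    apply is_derive_Reals in D. destruct (D eps (cond_pos eps)) as [d Hd].
    exists d. intros y Hy. destruct (Req_EM_T 0 0) as [_|n]; [|lra].
    destruct (Req_EM_T y 0) as [|Ny]; [apply ball_center|].
    assert (Hy' : Rabs y < d) by (replace y with (y - 0) by ring; exact Hy).
    specialize (Hd y Ny Hy'). rewrite Rplus_0_l, F0, Rminus_0_r in Hd. exact Hd.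
  - apply (continuous_ext_loc _ (fun t => mult (f t) (/ t))).
    + exists (mkposreal _ (Rabs_pos_lt t Nt)). intros y Hy. destruct (Req_EM_T y 0) as [->|]; [|reflexivity].
      exfalso. assert (H : Rabs (0 - t) < Rabs t) by exact Hy. rewrite Rminus_0_l, Rabs_Ropp in H. lra.
    + apply (continuous_mult f (fun t => / t)); [apply Hc; assumption|].
      apply (ex_derive_continuous (K := R_AbsRing) (V := R_NormedModule)). auto_derive. assumption.
Qed.

Lemma Rabs_increment_le (f g df dg : R -> R) :
  (forall t, 0 < t < 1 -> is_derive f t (df t)) -> (forall t, 0 <= t <= 1 -> continuous f t) ->
  (forall t, 0 < t < 1 -> is_derive g t (dg t)) -> (forall t, 0 <= t <= 1 -> continuous g t) ->
  (forall t, 0 < t < 1 -> Rabs (df t) <= dg t) -> Rabs (f 1 - f 0) <= g 1 - g 0.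
Proof.
  intros Df Cf Dg Cg H.
  assert (M1 : (fun t => minus (g t) (f t)) 0 <= (fun t => minus (g t) (f t)) 1).
  { apply (nondecreasing_of_derive (fun t => minus (g t) (f t)) (fun t => minus (dg t) (df t))); [lra| | |].
    - intros t Ht. apply (is_derive_minus (K := R_AbsRing) (V := R_NormedModule)); auto.
    - intros t Ht. apply (continuous_minus (V := R_NormedModule)); auto.
    - intros t Ht. assert (T := H t Ht). apply Rabs_le_between in T. unfold minus, plus, opp; simpl. lra. }
  assert (M2 : (fun t => plus (g t) (f t)) 0 <= (fun t => plus (g t) (f t)) 1).
  { apply (nondecreasing_of_derive (fun t => plus (g t) (f t)) (fun t => plus (dg t) (df t))); [lra| | |].
    - intros t Ht. apply (is_derive_plus (K := R_AbsRing) (V := R_NormedModule)); auto.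
    - intros t Ht. apply (continuous_plus (V := R_NormedModule)); auto.
    - intros t Ht. assert (T := H t Ht). apply Rabs_le_between in T. unfold plus; simpl. lra. }
  unfold minus, plus, opp in M1, M2; simpl in M1, M2. apply Rabs_le_between. lra.
Qed.

(** A + i B at t is the integral of h (s z) / s over [0, t], kept in real coordinates. The real
    integrand is at most |z| thq (t |z|) in absolute value, so |A 1| <= thq_int |z|; |z| < 1 makes
    the bound by [ell1] strict. *)
Lemma radial_potential (h w : C -> C) (z : C) :
  in_disk z -> h 0 = 0 -> (forall y, in_disk y -> exists l, is_Cderive h y l) ->
  (forall y, in_disk y -> Cmod (w y) <= Cmod y) -> (forall y, in_disk y -> h y = Cth (w y)) ->
  exists A B : R -> R, A 0 = 0 /\ B 0 = 0 /\
    (forall t, 0 <= t <= 1 -> continuous A t /\ continuous B t) /\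
    (forall t, 0 < t <= 1 -> is_derive A t (Re (h (RtoC t * z)%C) / t) /\ is_derive B t (Im (h (RtoC t * z)%C) / t)) /\
    Rabs (A 1) < ell1 /\ Rabs (B 1) <= 0.562.
Proof.
  intros Hz H0 Hd Hw Hh. unfold in_disk in Hz. assert (Nz := Cmod_ge_0 z).
  (* Here hi > 1 while hi |z| = 2 - hi < 1: the ray extends beyond z inside the disc, so derivatives
     at t = 1 are two-sided. *)
  set (hi := 2 / (1 + Cmod z)).
  assert (Hhi : 1 < hi).
  { apply Rmult_lt_reg_r with (1 + Cmod z); [lra|]. unfold hi, Rdiv. rewrite Rmult_assoc, Rinv_l by lra. lra. }
  assert (Ehi : hi * (1 + Cmod z) = 2) by (unfold hi; field; lra).
  assert (Din : forall t, - hi < t < hi -> in_disk (RtoC t * z)%C).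
  { intros t Ht. unfold in_disk. rewrite Cmod_mult, Cmod_R.
    assert (Rabs t < hi) by (apply Rabs_def1; lra). assert (Rabs t * Cmod z <= hi * Cmod z) by (apply Rmult_le_compat_r; lra).
    lra. }
  destruct (Hd 0) as [l0 Hl0]; [unfold in_disk; rewrite Cmod_0; lra|].
  assert (R0 : (RtoC 0 * z)%C = 0) by ring.
  destruct (ray_derive h z l0 0) as [D0r D0i]; [rewrite R0; exact Hl0|].
  set (fr := fun s => Re (h (RtoC s * z)%C)) in *. set (fi := fun s => Im (h (RtoC s * z)%C)) in *.
  assert (Fr0 : fr 0 = 0) by (unfold fr; rewrite R0, H0; reflexivity).
  assert (Fi0 : fi 0 = 0) by (unfold fi; rewrite R0, H0; reflexivity).
  assert (Cont : forall t, - hi < t < hi -> continuous fr t /\ continuous fi t).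
  { intros t Ht. destruct (Hd _ (Din t Ht)) as [l Hl]. destruct (ray_derive h z l t Hl).
    split; eapply is_derive_continuous; eassumption. }
  set (a := fun t => if Req_EM_T t 0 then Re (l0 * z)%C else fr t / t).
  set (b := fun t => if Req_EM_T t 0 then Im (l0 * z)%C else fi t / t).
  assert (Ca : forall t, - hi < t < hi -> continuous a t)
    by (apply difference_quotient_extension; try assumption; [lra|intros; apply Cont; assumption]).
  assert (Cb : forall t, - hi < t < hi -> continuous b t)
    by (apply difference_quotient_extension; try assumption; [lra|intros; apply Cont; assumption]).
  assert (DA := RInt_primitive a (- hi) hi ltac:(lra) Ca).
  assert (DB := RInt_primitive b (- hi) hi ltac:(lra) Cb).
  set (A := fun x => RInt a 0 x) in *. set (B := fun x => RInt b 0 x) in *.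
  assert (A0 : A 0 = 0) by (unfold A; rewrite RInt_point; reflexivity).
  assert (B0 : B 0 = 0) by (unfold B; rewrite RInt_point; reflexivity).
  assert (CA : forall t, 0 <= t <= 1 -> continuous A t) by (intros t Ht; eapply is_derive_continuous, DA; lra).
  assert (CB : forall t, 0 <= t <= 1 -> continuous B t) by (intros t Ht; eapply is_derive_continuous, DB; lra).
  assert (DA' : forall t, 0 < t <= 1 -> is_derive A t (fr t / t)).
  { intros t Ht. assert (T := DA t ltac:(lra)). unfold a in T. destruct (Req_EM_T t 0); [lra|exact T]. }
  assert (DB' : forall t, 0 < t <= 1 -> is_derive B t (fi t / t)).
  { intros t Ht. assert (T := DB t ltac:(lra)). unfold b in T. destruct (Req_EM_T t 0); [lra|exact T]. }
  assert (Wt : forall t, 0 < t <= 1 -> Cmod (w (RtoC t * z)%C) <= t * Cmod z).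
  { intros t Ht. eapply Rle_trans; [apply Hw, Din; lra|]. rewrite Cmod_mult, Cmod_R, Rabs_pos_eq; lra. }
  assert (Tz : forall t, 0 < t <= 1 -> t * Cmod z <= 1) by (intros; nra).
  exists A, B. split; [exact A0|split; [exact B0|split; [intros; split; auto|split; [intros; split; [apply DA'|apply DB']; assumption|split]]]].
  - apply Rle_lt_trans with (thq_int (Cmod z)); [|rewrite ell1_eq; apply thq_int_lt; lra].
    assert (DL : forall t, is_derive (fun t => thq_int (t * Cmod z)) t (Cmod z * thq (t * Cmod z))).
    { intros t. apply (is_derive_comp (K := R_AbsRing) (V := R_NormedModule) thq_int (fun t => t * Cmod z)); [apply is_derive_thq_int|].
      auto_derive; [exact I|ring]. }
    assert (K := Rabs_increment_le A (fun t => thq_int (t * Cmod z)) (fun t => fr t / t) (fun t => Cmod z * thq (t * Cmod z))).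
    simpl in K. rewrite A0, Rmult_0_l, Rmult_1_l, thq_int_0, !Rminus_0_r in K. apply K; clear K.
    + intros; apply DA'; lra.
    + assumption.
    + intros; apply DL.
    + intros; eapply is_derive_continuous, DL.
    + intros t Ht. unfold Rdiv. rewrite Rabs_mult, (Rabs_pos_eq (/ t)) by (left; apply Rinv_0_lt_compat; lra).
      apply Rmult_le_reg_r with t; [lra|]. rewrite Rmult_assoc, Rinv_l, Rmult_1_r by lra.
      unfold fr. rewrite Hh by (apply Din; lra).
      eapply Rle_trans; [apply (Cth_Re_bound _ (t * Cmod z)); [apply Wt; lra|apply Tz; lra]|].
      unfold thq. destruct (Req_EM_T (t * Cmod z) 0) as [E|E].
      * rewrite E, th_0. nra.
      * right. field. split; [|lra]. intros E2; apply E; rewrite E2; ring.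
  - assert (K := Rabs_increment_le B (fun t => 0.562 * t) (fun t => fi t / t) (fun t => 0.562)).
    simpl in K. rewrite B0, Rmult_0_r, Rmult_1_r, !Rminus_0_r in K. apply K; clear K.
    + intros; apply DB'; lra.
    + assumption.
    + intros; auto_derive; [exact I|ring].
    + intros; apply (ex_derive_continuous (K := R_AbsRing) (V := R_NormedModule)); auto_derive; exact I.
    + intros t Ht. unfold Rdiv. rewrite Rabs_mult, (Rabs_pos_eq (/ t)) by (left; apply Rinv_0_lt_compat; lra).
      apply Rmult_le_reg_r with t; [lra|]. rewrite Rmult_assoc, Rinv_l, Rmult_1_r by lra.
      unfold fi. rewrite Hh by (apply Din; lra).
      assert (W := Wt t ltac:(lra)). assert (T := Tz t ltac:(lra)).
      eapply Rle_trans; [apply Cth_Im_bound; lra|]. apply Rmult_le_compat_l; [lra|]. nra.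
Qed.

(** * Sufficiency *)

Lemma constant_of_derive_zero (f : R -> R) (a b : R) :
  a <= b -> (forall t, a < t < b -> is_derive f t 0) -> (forall t, a <= t <= b -> continuous f t) -> f b = f a.
Proof.
  intros Hab Hd Hc. destruct (MVT_gen f a b (fun _ => 0)) as (c & _ & E).
  - intros t Ht. rewrite Rmin_left, Rmax_right in Ht by lra. apply Hd; lra.
  - intros t Ht. rewrite Rmin_left, Rmax_right in Ht by lra. apply continuity_pt_filterlim. apply Hc; lra.
  - lra.
Qed.

(** Continuous induction on [0, 1]: the last hypothesis carries nonvanishing up to the supremum, and
    continuity carries it beyond. *)
Lemma continuous_nonvanishing (f : R -> R) :
  (forall t, 0 <= t <= 1 -> continuous f t) -> f 0 <> 0 ->
  (forall s, 0 < s <= 1 -> (forall t, 0 <= t < s -> f t <> 0) -> f s <> 0) ->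
  forall t, 0 <= t <= 1 -> f t <> 0.
Proof.
  intros Hc F0 Hs.
  destruct (completeness (fun s => 0 <= s <= 1 /\ forall t, 0 <= t <= s -> f t <> 0)) as [s [S1 S2]].
  - exists 1. intros x [Hx _]. lra.
  - exists 0. split; [lra|]. intros t Ht. replace t with 0 by lra. assumption.
  - assert (P0 : 0 <= s). { apply S1. split; [lra|]. intros t Ht. replace t with 0 by lra. assumption. }
    assert (P1 : s <= 1) by (apply S2; intros x [Hx _]; lra).
    assert (Below : forall t, 0 <= t < s -> f t <> 0).
    { intros t Ht Z. assert (s <= t); [|lra]. apply S2. intros x [Hx Hf].
      apply Rnot_lt_le; intros L. apply (Hf t); [lra|assumption]. }
    assert (Fs : f s <> 0).
    { destruct (Rle_lt_or_eq_dec 0 s P0) as [L|<-]; [apply Hs; [lra|assumption]|assumption]. }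
    destruct (Rle_lt_or_eq_dec s 1 P1) as [L|E].
    + exfalso. assert (I1 : 0 <= s <= 1) by lra.
      assert (C := proj1 (filterlim_locally (U := R_UniformSpace) _ _) (Hc s I1) (mkposreal _ (Rabs_pos_lt _ Fs))).
      destruct C as [d Hd]. assert (Pd := cond_pos d).
      set (s' := Rmin 1 (s + d / 2)).
      assert (A1 : s' <= 1) by apply Rmin_l. assert (A2 : s' <= s + d / 2) by apply Rmin_r.
      assert (A3 : s < s') by (apply Rmin_glb_lt; lra).
      assert (s' <= s); [|lra]. apply S1. split; [lra|]. intros t Ht.
      destruct (Rlt_dec t s); [apply Below; lra|]. intros Z.
      assert (Bt : Rabs (t - s) < d) by (rewrite Rabs_pos_eq; lra).
      assert (K : Rabs (f t - f s) < Rabs (f s)) by exact (Hd t Bt).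
      rewrite Z, Rminus_0_l, Rabs_Ropp in K. lra.
    + intros t Ht. subst s. destruct (Rle_lt_or_eq_dec t 1) as [L| ->]; [lra|apply Below; lra|assumption].
Qed.

Lemma phi_SG_subordinate_potential (f : C -> C) (z : C) :
  subordinate f phi_SG -> in_disk z ->
  exists A B : R -> R, A 0 = 0 /\ B 0 = 0 /\
    (forall t, 0 <= t <= 1 -> continuous A t /\ continuous B t) /\
    (forall t, 0 < t <= 1 -> is_derive A t (Re (f (RtoC t * z)%C - 1)%C / t) /\
                             is_derive B t (Im (f (RtoC t * z)%C - 1)%C / t)) /\
    Rabs (A 1) < ell1 /\ Rabs (B 1) <= 0.562.
Proof.
  intros (Hf & _ & w & Hw & W0 & W1 & Hfw) Hz.
  assert (Eh : forall y, in_disk y -> (f y - 1)%C = Cth (w y)).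
  { intros y Hy. rewrite Hfw, phi_SG_Cth by auto. ring. }
  apply (radial_potential (fun y => f y - 1)%C w z Hz).
  - rewrite Eh, W0 by (unfold in_disk; rewrite Cmod_0; lra). unfold Cth. rewrite Cexp_0.
    replace (1 - 1)%C with (RtoC 0) by ring. unfold Cdiv. ring.
  - intros y Hy. destruct (Hf y Hy) as [l Hl]. exists (l + - 0)%C. apply is_Cderive_plus; [exact Hl|].
    replace (- 0)%C with (RtoC 0) by ring. apply is_Cderive_const.
  - apply schwarz; assumption.
  - assumption.
Qed.

Lemma in_disk_ray (z : C) (t : R) : in_disk z -> 0 <= t <= 1 -> in_disk (RtoC t * z)%C.
Proof.
  unfold in_disk. intros Hz Ht. rewrite Cmod_mult, Cmod_R, Rabs_pos_eq by lra. generalize (Cmod_ge_0 z). nra.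
Qed.

Lemma C_derive_analytic (p : C -> C) (y : C) :
  analytic_on_disk p -> in_disk y -> is_Cderive p y (C_derive p y).
Proof.
  intros Hp Hy. destruct (Hp y Hy) as [l Hl]. rewrite (is_C_derive_unique p y l Hl). exact Hl.
Qed.

Lemma ray_continuous (p : C -> C) (z : C) : analytic_on_disk p -> in_disk z ->
  forall t, 0 <= t <= 1 -> continuous (fun s => Re (p (RtoC s * z)%C)) t /\ continuous (fun s => Im (p (RtoC s * z)%C)) t.
Proof.
  intros Hp Hz t Ht.
  destruct (ray_derive p z _ t (C_derive_analytic p _ Hp (in_disk_ray z t Hz Ht))).
  split; eapply is_derive_continuous; eassumption.
Qed.

(** Serves (a) with p itself and (c) with 1 / p and [- beta], since (1 / p)' = - p' / p^2. *)
Lemma ray_affine (u U dU : R -> R) (beta s : R) :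
  beta <> 0 -> 0 <= s -> U 0 = 0 ->
  (forall t, 0 < t < s -> is_derive u t (dU t / beta)) -> (forall t, 0 <= t <= s -> continuous u t) ->
  (forall t, 0 < t < s -> is_derive U t (dU t)) -> (forall t, 0 <= t <= s -> continuous U t) ->
  u s = u 0 + U s / beta.
Proof.
  intros Hb Hs U0 Du Cu DU CU.
  assert (E : (fun t => minus (u t) (scal (/ beta) (U t))) s = (fun t => minus (u t) (scal (/ beta) (U t))) 0).
  { apply (constant_of_derive_zero (fun t => minus (u t) (scal (/ beta) (U t)))); [assumption| |].
    - intros t Ht. replace 0 with (minus (dU t / beta) (scal (/ beta) (dU t)))
        by (unfold minus, plus, opp, scal; simpl; unfold mult; simpl; field; assumption).
      apply (is_derive_minus (K := R_AbsRing) (V := R_NormedModule)); [apply Du; assumption|].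
      apply (is_derive_scal U). apply DU; assumption.
    - intros t Ht. apply (continuous_minus (V := R_NormedModule)); [apply Cu; assumption|].
      apply (continuous_scal_r (V := R_NormedModule)). apply CU; assumption. }
  unfold minus, plus, opp, scal in E; simpl in E; unfold mult in E; simpl in E. rewrite U0 in E.
  unfold Rdiv. lra.
Qed.

Lemma ell1_pos : 0 < ell1.
Proof. generalize ell1_bounds. lra. Qed.

(** The parameter [k] is the admissible size of Re (G / beta), namely 2/3, ln (5/3) or 2/5, so each
    threshold for [beta] has the form ell1 / k. *)
Lemma scaled_bounds (a b beta k : R) :
  Rabs a < ell1 -> Rabs b <= 0.562 -> 0 < k -> beta >= ell1 / k ->
  Rabs (a / beta) < k /\ Rabs (b / beta) <= 0.562 * k / ell1.
Proof.
  intros Ha Hb Hk Hbeta. assert (P := ell1_pos).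
  assert (Q : 0 < ell1 / k) by (apply Rdiv_lt_0_compat; assumption).
  assert (Pb : 0 < beta) by lra.
  assert (Kb : ell1 <= k * beta) by (replace ell1 with (k * (ell1 / k)) by (field; lra); apply Rmult_le_compat_l; lra).
  unfold Rdiv at 1 2. rewrite !Rabs_mult, (Rabs_pos_eq (/ beta)) by (left; apply Rinv_0_lt_compat; lra).
  split.
  - apply Rmult_lt_reg_r with beta; [assumption|]. rewrite Rmult_assoc, Rinv_l, Rmult_1_r by lra. lra.
  - apply Rmult_le_reg_r with (beta * ell1); [apply Rmult_lt_0_compat; assumption|].
    replace (Rabs b * / beta * (beta * ell1)) with (Rabs b * ell1) by (field; lra).
    replace (0.562 * k / ell1 * (beta * ell1)) with (0.562 * (k * beta)) by (field; lra).
    apply Rmult_le_compat; try lra. apply Rabs_pos.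
Qed.

Lemma sufficient_a (beta : R) : beta >= 3 * ell1 / 2 -> sufficient_for_Ne expr_a beta.
Proof.
  intros Hb p Hp P0 Hsub. assert (Pl := ell1_pos). assert (L := ell1_bounds).
  apply subordinate_phi_Ne; [assumption..|]. intros z Hz.
  destruct (phi_SG_subordinate_potential _ z Hsub Hz) as (A & B & A0 & B0 & CAB & DAB & BA & BB).
  assert (Nb : beta <> 0) by lra.
  assert (Dp : forall t, 0 < t <= 1 ->
     is_derive (fun s => Re (p (RtoC s * z)%C)) t (Re (expr_a beta p (RtoC t * z)%C - 1)%C / t / beta) /\
     is_derive (fun s => Im (p (RtoC s * z)%C)) t (Im (expr_a beta p (RtoC t * z)%C - 1)%C / t / beta)).
  { intros t Ht.
    assert (D := ray_derive p z _ t (C_derive_analytic p _ Hp (in_disk_ray z t Hz ltac:(lra)))).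
    set (l := C_derive p (RtoC t * z)%C) in *.
    assert (E : (expr_a beta p (RtoC t * z) - 1)%C = (RtoC (beta * t) * (l * z))%C).
    { unfold expr_a. fold l. rewrite RtoC_mult. ring. }
    rewrite E. set (m := (l * z)%C) in *.
    replace (Re (RtoC (beta * t) * m)%C / t / beta) with (Re m) by (destruct m; simpl; field; lra).
    replace (Im (RtoC (beta * t) * m)%C / t / beta) with (Im m) by (destruct m; simpl; field; lra).
    exact D. }
  assert (C := ray_continuous p z Hp Hz).
  assert (E1 : Re (p (RtoC 1 * z)%C) = Re (p (RtoC 0 * z)%C) + A 1 / beta).
  { apply (ray_affine (fun s => Re (p (RtoC s * z)%C)) A (fun t => Re (expr_a beta p (RtoC t * z)%C - 1)%C / t) beta 1); try assumption; try lra;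
      intros t Ht; [apply (Dp t)|apply (C t)|apply (DAB t)|apply (CAB t)]; lra. }
  assert (E2 : Im (p (RtoC 1 * z)%C) = Im (p (RtoC 0 * z)%C) + B 1 / beta).
  { apply (ray_affine (fun s => Im (p (RtoC s * z)%C)) B (fun t => Im (expr_a beta p (RtoC t * z)%C - 1)%C / t) beta 1); try assumption; try lra;
      intros t Ht; [apply (Dp t)|apply (C t)|apply (DAB t)|apply (CAB t)]; lra. }
  replace (RtoC 1 * z)%C with z in E1, E2 by ring. replace (RtoC 0 * z)%C with (RtoC 0) in E1, E2 by ring.
  rewrite P0 in E1, E2. simpl in E1, E2. rewrite E1, E2.
  destruct (scaled_bounds (A 1) (B 1) beta (2 / 3) BA BB) as [F1 F2]; [lra| |].
  - replace (ell1 / (2 / 3)) with (3 * ell1 / 2) by field. assumption.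
  - split; [replace (1 + A 1 / beta - 1) with (A 1 / beta) by ring; assumption|].
    rewrite Rplus_0_l. eapply Rle_trans; [exact F2|].
    apply Rmult_le_reg_r with ell1; [assumption|]. unfold Rdiv at 1. rewrite Rmult_assoc, Rinv_l by lra. lra.
Qed.

(* [u + i v] solves [(u + i v)' = (dA + i dB) / beta * (u + i v)]; multiply by [exp (- (A + i B) / beta)]. *)
Lemma ray_exponential (u v A B dA dB : R -> R) (beta s : R) :
  beta <> 0 -> 0 <= s -> A 0 = 0 -> B 0 = 0 -> u 0 = 1 -> v 0 = 0 ->
  (forall t, 0 < t < s -> is_derive u t ((dA t * u t - dB t * v t) / beta) /\
                          is_derive v t ((dA t * v t + dB t * u t) / beta)) ->
  (forall t, 0 <= t <= s -> continuous u t /\ continuous v t) ->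
  (forall t, 0 < t < s -> is_derive A t (dA t) /\ is_derive B t (dB t)) ->
  (forall t, 0 <= t <= s -> continuous A t /\ continuous B t) ->
  u s = exp (A s / beta) * cos (B s / beta) /\ v s = exp (A s / beta) * sin (B s / beta).
Proof.
  intros Hb Hs A0 B0 U0 V0 Duv Cuv DAB CAB.
  assert (Ce : forall t, 0 <= t <= s -> continuous (fun t => exp (- A t / beta)) t).
  { intros t Ht. apply (continuous_comp A (fun x => exp (- x / beta))); [apply CAB; assumption|].
    apply (ex_derive_continuous (K := R_AbsRing) (V := R_NormedModule)). auto_derive; exact I. }
  assert (Cc : forall t, 0 <= t <= s -> continuous (fun t => cos (B t / beta)) t).
  { intros t Ht. apply (continuous_comp B (fun x => cos (x / beta))); [apply CAB; assumption|].
    apply (ex_derive_continuous (K := R_AbsRing) (V := R_NormedModule)). auto_derive; exact I. }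
  assert (Cs : forall t, 0 <= t <= s -> continuous (fun t => sin (B t / beta)) t).
  { intros t Ht. apply (continuous_comp B (fun x => sin (x / beta))); [apply CAB; assumption|].
    apply (ex_derive_continuous (K := R_AbsRing) (V := R_NormedModule)). auto_derive; exact I. }
  set (dr := fun t => exp (- A t / beta) * (u t * cos (B t / beta) + v t * sin (B t / beta))).
  set (di := fun t => exp (- A t / beta) * (v t * cos (B t / beta) - u t * sin (B t / beta))).
  assert (E1 : dr s = dr 0).
  { apply constant_of_derive_zero; [assumption| |].
    - intros t Ht. destruct (Duv t Ht) as [Du Dv]. destruct (DAB t Ht) as [DA DB]. unfold dr.
      auto_derive; [repeat split; eexists; eassumption|].
      rewrite (is_derive_unique _ _ _ Du : Derive (fun x => u x) t = _), (is_derive_unique _ _ _ Dv : Derive (fun x => v x) t = _),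
        (is_derive_unique _ _ _ DA : Derive (fun x => A x) t = _), (is_derive_unique _ _ _ DB : Derive (fun x => B x) t = _).
      field. assumption.
    - intros t Ht. destruct (Cuv t Ht) as [Cu Cv].
      exact (continuous_mult (K := R_AbsRing) _ _ t (Ce t Ht) (continuous_plus (V := R_NormedModule) _ _ t
        (continuous_mult (K := R_AbsRing) _ _ t Cu (Cc t Ht)) (continuous_mult (K := R_AbsRing) _ _ t Cv (Cs t Ht)))). }
  assert (E2 : di s = di 0).
  { apply constant_of_derive_zero; [assumption| |].
    - intros t Ht. destruct (Duv t Ht) as [Du Dv]. destruct (DAB t Ht) as [DA DB]. unfold di.
      auto_derive; [repeat split; eexists; eassumption|].
      rewrite (is_derive_unique _ _ _ Du : Derive (fun x => u x) t = _), (is_derive_unique _ _ _ Dv : Derive (fun x => v x) t = _),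
        (is_derive_unique _ _ _ DA : Derive (fun x => A x) t = _), (is_derive_unique _ _ _ DB : Derive (fun x => B x) t = _).
      field. assumption.
    - intros t Ht. destruct (Cuv t Ht) as [Cu Cv].
      exact (continuous_mult (K := R_AbsRing) _ _ t (Ce t Ht) (continuous_minus (V := R_NormedModule) _ _ t
        (continuous_mult (K := R_AbsRing) _ _ t Cv (Cc t Ht)) (continuous_mult (K := R_AbsRing) _ _ t Cu (Cs t Ht)))). }
  unfold dr in E1; unfold di in E2. rewrite A0, B0, U0, V0 in E1, E2.
  replace (- 0 / beta) with 0 in E1, E2 by (field; assumption).
  replace (0 / beta) with 0 in E1, E2 by (field; assumption).
  rewrite exp_0, cos_0, sin_0 in E1, E2.
  assert (X : exp (A s / beta) * exp (- A s / beta) = 1).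
  { rewrite <- exp_plus. replace (A s / beta + - A s / beta) with 0 by (field; assumption). apply exp_0. }
  set (c := cos (B s / beta)) in *. set (d := sin (B s / beta)) in *.
  assert (SC : d * d + c * c = 1) by exact (sin2_cos2 (B s / beta)).
  set (e := exp (A s / beta)) in *. set (f := exp (- A s / beta)) in *.
  split.
  - transitivity (e * (f * (u s * c + v s * d) * c - f * (v s * c - u s * d) * d)); [|rewrite E1, E2; ring].
    transitivity (e * f * (u s * (d * d + c * c))); [rewrite X, SC|]; ring.
  - transitivity (e * (f * (u s * c + v s * d) * d + f * (v s * c - u s * d) * c)); [|rewrite E1, E2; ring].
    transitivity (e * f * (v s * (d * d + c * c))); [rewrite X, SC|]; ring.
Qed.

Lemma Cmod2_zero_iff (c : C) : Re c ^ 2 + Im c ^ 2 = 0 <-> c = 0.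
Proof.
  rewrite <- Cmod2_alt. split.
  - intros H. apply Cmod_eq_0. generalize (Cmod_ge_0 c). intros; nra.
  - intros ->. rewrite Cmod_0. ring.
Qed.

Lemma ray_nonvanishing (p : C -> C) (z : C) :
  analytic_on_disk p -> p 0 = 1 -> in_disk z ->
  (forall s, 0 < s <= 1 -> (forall t, 0 <= t < s -> p (RtoC t * z)%C <> 0) -> p (RtoC s * z)%C <> 0) ->
  forall t, 0 <= t <= 1 -> p (RtoC t * z)%C <> 0.
Proof.
  intros Hp P0 Hz Hs t Ht Z.
  set (n := fun t => plus (mult (Re (p (RtoC t * z)%C)) (Re (p (RtoC t * z)%C))) (mult (Im (p (RtoC t * z)%C)) (Im (p (RtoC t * z)%C)))).
  assert (En : forall t, n t = Re (p (RtoC t * z)%C) ^ 2 + Im (p (RtoC t * z)%C) ^ 2)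
    by (intros x; unfold n, plus, mult; simpl; ring).
  assert (Nn : forall t, n t <> 0 <-> p (RtoC t * z)%C <> 0).
  { intros x. rewrite En, Cmod2_zero_iff. tauto. }
  revert Z. apply Nn. revert t Ht. apply continuous_nonvanishing.
  - intros t Ht. destruct (ray_continuous p z Hp Hz t Ht) as [Cu Cv].
    apply (continuous_plus (V := R_NormedModule)); apply (continuous_mult (K := R_AbsRing)); assumption.
  - apply Nn. replace (RtoC 0 * z)%C with (RtoC 0) by ring. rewrite P0. intros E; injection E; lra.
  - intros s Hs1 H. apply Nn, Hs; [assumption|]. intros t Ht. apply Nn, H; assumption.
Qed.

Lemma sufficient_b (beta : R) : beta >= ell1 / ln (5 / 3) -> sufficient_for_Ne expr_b beta.
Proof.
  intros Hb p Hp P0 Hsub. assert (Pl := ell1_pos). assert (L := ell1_bounds). assert (Ln := ln_5_3_bounds).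
  assert (BBd := beta_b_bounds).
  apply subordinate_phi_Ne; [assumption..|]. intros z Hz.
  destruct (phi_SG_subordinate_potential _ z Hsub Hz) as (A & B & A0 & B0 & CAB & DAB & BA & BB).
  assert (Nb : beta <> 0) by lra.
  set (k := fun t => (expr_b beta p (RtoC t * z) - 1)%C) in *.
  assert (Dp : forall t, 0 < t <= 1 -> p (RtoC t * z)%C <> 0 ->
     is_derive (fun s => Re (p (RtoC s * z)%C)) t
       ((Re (k t) / t * Re (p (RtoC t * z)%C) - Im (k t) / t * Im (p (RtoC t * z)%C)) / beta) /\
     is_derive (fun s => Im (p (RtoC s * z)%C)) t
       ((Re (k t) / t * Im (p (RtoC t * z)%C) + Im (k t) / t * Re (p (RtoC t * z)%C)) / beta)).
  { intros t Ht Np.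
    assert (D := ray_derive p z _ t (C_derive_analytic p _ Hp (in_disk_ray z t Hz ltac:(lra)))).
    unfold k. set (l := C_derive p (RtoC t * z)%C) in *. set (q := p (RtoC t * z)%C) in *.
    assert (E : ((expr_b beta p (RtoC t * z) - 1) * q)%C = (RtoC (beta * t) * (l * z))%C).
    { unfold expr_b. fold l q. rewrite RtoC_mult. field. assumption. }
    set (m := (l * z)%C) in *. set (h := (expr_b beta p (RtoC t * z) - 1)%C) in *.
    assert (Er := f_equal Re E). assert (Ei := f_equal Im E).
    replace (Re (RtoC (beta * t) * m)%C) with (beta * t * Re m) in Er by (destruct m; simpl; ring).
    replace (Im (RtoC (beta * t) * m)%C) with (beta * t * Im m) in Ei by (destruct m; simpl; ring).
    replace (Re (h * q)%C) with (Re h * Re q - Im h * Im q) in Er by reflexivity.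
    replace (Im (h * q)%C) with (Re h * Im q + Im h * Re q) in Ei by reflexivity.
    replace ((Re h / t * Re q - Im h / t * Im q) / beta) with (Re m)
      by (transitivity ((Re h * Re q - Im h * Im q) / (beta * t)); [rewrite Er|]; field; lra).
    replace ((Re h / t * Im q + Im h / t * Re q) / beta) with (Im m)
      by (transitivity ((Re h * Im q + Im h * Re q) / (beta * t)); [rewrite Ei|]; field; lra).
    exact D. }
  assert (C := ray_continuous p z Hp Hz).
  assert (R0 : (RtoC 0 * z)%C = 0) by ring.
  (* The differential equation is used on the open segment only, and p is continuous at s. The
     formula therefore reaches s itself and shows p <> 0 there, which drives the induction below. *)
  assert (Exp : forall s, 0 < s <= 1 -> (forall t, 0 <= t < s -> p (RtoC t * z)%C <> 0) ->
     Re (p (RtoC s * z)%C) = exp (A s / beta) * cos (B s / beta) /\ Im (p (RtoC s * z)%C) = exp (A s / beta) * sin (B s / beta)).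
  { intros s Hs Np.
    apply (ray_exponential (fun s => Re (p (RtoC s * z)%C)) (fun s => Im (p (RtoC s * z)%C)) A B
      (fun t => Re (k t) / t) (fun t => Im (k t) / t) beta s); try assumption; try lra.
    - rewrite R0, P0. reflexivity.
    - rewrite R0, P0. reflexivity.
    - intros t Ht. apply Dp; [lra|apply Np; lra].
    - intros t Ht. apply C; lra.
    - intros t Ht. apply DAB; lra.
    - intros t Ht. apply CAB; lra. }
  assert (Nv : forall t, 0 <= t <= 1 -> p (RtoC t * z)%C <> 0).
  { apply ray_nonvanishing; try assumption. intros s Hs Np Z.
    destruct (Exp s Hs Np) as [X Y]. rewrite Z in X, Y. simpl in X, Y.
    assert (P := exp_pos (A s / beta)). assert (SC := sin2_cos2 (B s / beta)). unfold Rsqr in SC.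
    symmetry in X, Y. apply Rmult_integral in X. apply Rmult_integral in Y.
    destruct X as [X|X]; [lra|]. destruct Y as [Y|Y]; [lra|]. rewrite X, Y in SC. lra. }
  destruct (Exp 1) as [E1 E2]; [lra|intros; apply Nv; lra|].
  replace (RtoC 1 * z)%C with z in E1, E2 by ring. rewrite E1, E2.
  destruct (scaled_bounds (A 1) (B 1) beta (ln (5 / 3)) BA BB) as [F1 F2]; [lra|assumption|].
  set (a := A 1 / beta) in *. set (b := B 1 / beta) in *.
  (* 0.562 ln (5/3) / ell1 is about 0.5897, and 5/3 0.59 < 1 is the height available at the end. *)
  assert (Fb : Rabs b <= 0.59).
  { eapply Rle_trans; [exact F2|]. apply Rmult_le_reg_r with ell1; [assumption|].
    unfold Rdiv. rewrite Rmult_assoc, Rinv_l by lra. lra. }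
  apply Rabs_def2 in F1.
  assert (Up : exp a < 5 / 3) by (rewrite <- (exp_ln (5 / 3)) by lra; apply exp_increasing; lra).
  assert (Lo : 3 / 5 < exp a).
  { replace (3 / 5) with (/ (5 / 3)) by field. rewrite <- (exp_ln (5 / 3)) by lra. rewrite <- exp_Ropp. apply exp_increasing; lra. }
  assert (Cb := cos_ge_parabola b). assert (Cb1 := COS_bound b).
  assert (Qb : b ^ 2 <= 0.3481) by (apply Rabs_le_between in Fb; simpl; nra).
  assert (Sb : Rabs (sin b) <= Rabs b).
  { assert (S : forall x, 0 <= x <= 1 -> Rabs (sin x) <= x).
    { intros x Hx. rewrite Rabs_pos_eq by (apply sin_ge_0; generalize PI2_3_2; lra).
      destruct (Rle_lt_or_eq_dec 0 x) as [G|<-]; [lra|left; apply sin_lt_x; assumption|rewrite sin_0; lra]. }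
    destruct (Rle_dec 0 b) as [G|G].
    - rewrite (Rabs_pos_eq b) in * by assumption. apply S; lra.
    - rewrite (Rabs_left b) in * by lra. rewrite <- Rabs_Ropp, <- sin_neg. apply S; lra. }
  split.
  - apply Rabs_def1; [nra|]. assert (3 / 5 * 0.82 <= exp a * cos b) by (apply Rmult_le_compat; lra). lra.
  - rewrite Rabs_mult, (Rabs_pos_eq (exp a)) by lra.
    apply Rle_trans with (5 / 3 * 0.59); [|lra]. apply Rmult_le_compat; try lra. apply Rabs_pos.
Qed.

Lemma sufficient_c (beta : R) : beta >= 5 * ell1 / 2 -> sufficient_for_Ne expr_c beta.
Proof.
  intros Hb p Hp P0 Hsub. assert (Pl := ell1_pos). assert (L := ell1_bounds).
  apply subordinate_phi_Ne; [assumption..|]. intros z Hz.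
  destruct (phi_SG_subordinate_potential _ z Hsub Hz) as (A & B & A0 & B0 & CAB & DAB & BA & BB).
  assert (Nb : beta <> 0) by lra.
  set (k := fun t => (expr_c beta p (RtoC t * z) - 1)%C) in *.
  set (P := fun y => (/ p y)%C).
  assert (Dp : forall t, 0 <= t <= 1 -> p (RtoC t * z)%C <> 0 ->
     exists a b, is_derive (fun s => Re (P (RtoC s * z)%C)) t a /\ is_derive (fun s => Im (P (RtoC s * z)%C)) t b /\
       (0 < t -> a = Re (k t) / t / (- beta) /\ b = Im (k t) / t / (- beta))).
  { intros t Ht Np.
    set (l := C_derive p (RtoC t * z)%C). set (q := p (RtoC t * z)%C) in *.
    assert (DP : is_Cderive P (RtoC t * z)%C (l * - / (q * q))%C).
    { apply (is_Cderive_comp Cinv p); [apply is_Cderive_inv_id; assumption|].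
      apply C_derive_analytic; [assumption|apply in_disk_ray; assumption]. }
    destruct (ray_derive P z _ t DP) as [D1 D2]. do 2 eexists. split; [exact D1|split; [exact D2|]].
    intros Pt. unfold k.
    assert (E : (expr_c beta p (RtoC t * z) - 1)%C = (RtoC (- beta * t) * (l * - / (q * q) * z))%C).
    { unfold expr_c. fold l q. rewrite RtoC_mult, RtoC_opp. unfold Cpow. field. assumption. }
    rewrite E. set (m := (l * - / (q * q) * z)%C).
    split; destruct m; simpl; field; lra. }
  assert (R0 : (RtoC 0 * z)%C = 0) by ring.
  assert (E0 : P (RtoC 0 * z)%C = 1) by (unfold P; rewrite R0, P0; field; intros E; injection E; lra).
  (* Unlike p, its inverse may be discontinuous at a zero of p, so the zero-free segment is closed
     here and its endpoint is treated separately. *)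
  assert (Aff : forall s, 0 <= s <= 1 -> (forall t, 0 <= t <= s -> p (RtoC t * z)%C <> 0) ->
     Re (P (RtoC s * z)%C) = 1 + A s / (- beta) /\ Im (P (RtoC s * z)%C) = B s / (- beta)).
  { intros s Hs Np.
    assert (T1 : Re (P (RtoC s * z)%C) = Re (P (RtoC 0 * z)%C) + A s / (- beta)).
    { apply (ray_affine (fun s => Re (P (RtoC s * z)%C)) A (fun t => Re (k t) / t) (- beta) s); try assumption; try lra.
      - intros t Ht. destruct (Dp t ltac:(lra) (Np t ltac:(lra))) as (a & b & D1 & D2 & E). rewrite <- (proj1 (E ltac:(lra))). exact D1.
      - intros t Ht. destruct (Dp t ltac:(lra) (Np t ltac:(lra))) as (a & b & D1 & D2 & E). eapply is_derive_continuous; exact D1.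
      - intros t Ht. exact (proj1 (DAB t ltac:(lra))).
      - intros t Ht. exact (proj1 (CAB t ltac:(lra))). }
    assert (T2 : Im (P (RtoC s * z)%C) = Im (P (RtoC 0 * z)%C) + B s / (- beta)).
    { apply (ray_affine (fun s => Im (P (RtoC s * z)%C)) B (fun t => Im (k t) / t) (- beta) s); try assumption; try lra.
      - intros t Ht. destruct (Dp t ltac:(lra) (Np t ltac:(lra))) as (a & b & D1 & D2 & E). rewrite <- (proj2 (E ltac:(lra))). exact D2.
      - intros t Ht. destruct (Dp t ltac:(lra) (Np t ltac:(lra))) as (a & b & D1 & D2 & E). eapply is_derive_continuous; exact D2.
      - intros t Ht. exact (proj2 (DAB t ltac:(lra))).
      - intros t Ht. exact (proj2 (CAB t ltac:(lra))). }
    rewrite T1, T2, E0. simpl. split; ring. }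
  assert (C := ray_continuous p z Hp Hz).
  assert (Nv : forall t, 0 <= t <= 1 -> p (RtoC t * z)%C <> 0).
  { apply ray_nonvanishing; try assumption. intros s Hs Np Z.
    (* [p (1 - (A + i B) / beta) = 1] on [0, s), so the left-hand side cannot tend to [0] at [s]. *)
    set (F := fun t => minus (mult (Re (p (RtoC t * z)%C)) (1 + A t / (- beta))) (mult (Im (p (RtoC t * z)%C)) (B t / (- beta)))).
    assert (CF : continuous F s).
    { destruct (C s ltac:(lra)) as [Cu Cv]. destruct (CAB s ltac:(lra)) as [Ca Cb].
      apply (continuous_minus (V := R_NormedModule)); apply (continuous_mult (K := R_AbsRing)); try assumption.
      - apply (continuous_comp A (fun x => 1 + x / (- beta))); [assumption|].
        apply (ex_derive_continuous (K := R_AbsRing) (V := R_NormedModule)). auto_derive; exact I.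
      - apply (continuous_comp B (fun x => x / (- beta))); [assumption|].
        apply (ex_derive_continuous (K := R_AbsRing) (V := R_NormedModule)). auto_derive; exact I. }
    assert (F0 : F s = 0) by (unfold F; rewrite Z; unfold minus, plus, opp, mult; simpl; ring).
    assert (F1 : forall t, 0 <= t < s -> F t = 1).
    { intros t Ht. destruct (Aff t ltac:(lra)) as [X Y]; [intros; apply Np; lra|].
      unfold F. rewrite <- X, <- Y. assert (N := Np t Ht).
      assert (K : (p (RtoC t * z) * P (RtoC t * z))%C = 1) by (unfold P; field; assumption).
      apply (f_equal Re) in K. exact K. }
    assert (Cl := proj1 (filterlim_locally (U := R_UniformSpace) _ _) CF (mkposreal _ Rlt_0_1)).
    destruct Cl as [d Hd]. assert (Pd := cond_pos d).
    set (t := Rmax 0 (s - d / 2)). assert (T1 : 0 <= t) by apply Rmax_l. assert (T2 : s - d / 2 <= t) by apply Rmax_r.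
    assert (T3 : t < s) by (apply Rmax_lub_lt; lra).
    assert (Bt : Rabs (t - s) < d) by (rewrite Rabs_left; lra).
    assert (K : Rabs (F t - F s) < 1) by exact (Hd t Bt).
    rewrite F0, F1, Rminus_0_r, Rabs_R1 in K by lra. lra. }
  destruct (Aff 1) as [E1 E2]; [lra|intros; apply Nv; lra|].
  assert (N1 := Nv 1 ltac:(lra)).
  replace (RtoC 1 * z)%C with z in E1, E2, N1 by ring.
  destruct (scaled_bounds (A 1) (B 1) beta (2 / 5) BA BB) as [F1 F2]; [lra| |].
  { replace (ell1 / (2 / 5)) with (5 * ell1 / 2) by field. assumption. }
  assert (Fb : Rabs (B 1 / beta) <= 0.6).
  { eapply Rle_trans; [exact F2|]. apply Rmult_le_reg_r with ell1; [assumption|].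
    unfold Rdiv at 1. rewrite Rmult_assoc, Rinv_l by lra. lra. }
  apply Rabs_def2 in F1. apply Rabs_le_between in Fb.
  set (x := Re (P z)) in *. set (y := Im (P z)) in *.
  assert (X : 3 / 5 < x < 7 / 5) by (rewrite E1; replace (A 1 / - beta) with (- (A 1 / beta)) by (field; assumption); lra).
  assert (Y : - 0.6 <= y <= 0.6) by (rewrite E2; replace (B 1 / - beta) with (- (B 1 / beta)) by (field; assumption); lra).
  assert (Ep : p z = (x / (x ^ 2 + y ^ 2), - y / (x ^ 2 + y ^ 2))).
  { replace (p z) with (/ P z)%C by (unfold P; field; assumption).
    unfold x, y. destruct (P z); reflexivity. }
  rewrite Ep. simpl. set (n := x * (x * 1) + y * (y * 1)).
  (* With x > 3/5 and n >= x^2, x / n <= 1 / x < 5/3; also y^2 + 9/25 > |y| because 9/25 > 1/4, so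
     |y| < n. *)
  assert (Hn : 9 / 25 < n) by (unfold n; nra).
  assert (D1 : x / n < 5 / 3) by (apply Rmult_lt_reg_r with n; [lra|]; unfold Rdiv at 1; rewrite Rmult_assoc, Rinv_l by lra; unfold n; nra).
  assert (D2 : 1 / 3 < x / n) by (apply Rmult_lt_reg_r with n; [lra|]; unfold Rdiv at 2; rewrite Rmult_assoc, Rinv_l by lra; unfold n; nra).
  split; [apply Rabs_def1; lra|].
  apply Rabs_le_between; split; apply Rmult_le_reg_r with n; try lra; unfold Rdiv; rewrite ?Rmult_assoc, ?Rinv_l by lra; unfold n; nra.
Qed.

(** * Sharpness *)

Lemma is_Cderive_Cth (z : C) : Rabs (Im z) <= 3 / 2 -> is_Cderive Cth z ((1 - Cth z * Cth z) / 2)%C.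
Proof.
  intros Hz. assert (N := Cexp_plus_1_neq_0 z Hz).
  assert (D1 := is_Cderive_plus _ _ _ _ _ (is_Cderive_Cexp z) (is_Cderive_const (- RtoC 1)%C z)).
  assert (D2 := is_Cderive_plus _ _ _ _ _ (is_Cderive_Cexp z) (is_Cderive_const 1 z)).
  assert (D := is_Cderive_div (fun y => Cexp y + - RtoC 1)%C (fun y => Cexp y + RtoC 1)%C z _ _ N D1 D2). cbv beta in D.
  replace ((1 - Cth z * Cth z) / 2)%C with (((Cexp z + 0) * (Cexp z + 1) - (Cexp z + - RtoC 1) * (Cexp z + 0)) / ((Cexp z + 1) * (Cexp z + 1)))%C.
  - exact D.
  - unfold Cth. field. exact N.
Qed.

Lemma th_le_half (r : R) : 0 <= r -> th r <= r / 2.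
Proof.
  intros Hr. set (f := fun t => t / 2 - th t).
  assert (D : forall t, is_derive f t (th t ^ 2 / 2)).
  { intros t. assert (Dt := is_derive_th t). unfold f. auto_derive; [eexists; exact Dt|].
    rewrite (is_derive_unique _ _ _ Dt : Derive (fun x => th x) t = _). field. }
  assert (M : f 0 <= f r).
  { apply (nondecreasing_of_derive f (fun t => th t ^ 2 / 2)); [assumption|intros; apply D|intros; eapply is_derive_continuous, D|].
    intros t _. generalize (pow2_ge_0 (th t)). lra. }
  unfold f in M. rewrite th_0 in M. lra.
Qed.

(** The real part contributes |z| / 2 and the imaginary part 0.562 |z|. *)
Lemma Cth_le (z : C) : Cmod z <= 1 -> Cmod (Cth z) <= 1.1 * Cmod z.
Proof.
  intros Hz. assert (N := Cmod_ge_0 z).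
  assert (R1 := Cth_Re_bound z (Cmod z) (Rle_refl _) Hz). assert (R2 := Cth_Im_bound z Hz).
  assert (R3 := th_le_half (Cmod z) N).
  rewrite (surjective_pairing (Cth z)). eapply Rle_trans; [apply Cmod_le_abs|].
  unfold Re, Im in *. lra.
Qed.

Lemma ray_increment_bound (g : C -> C) (z : C) (M : R) :
  (forall t, 0 <= t <= 1 -> exists l, is_Cderive g (RtoC t * z)%C l /\ Cmod (l * z)%C <= M) ->
  Rabs (Re (g z) - Re (g 0)) <= M /\ Rabs (Im (g z) - Im (g 0)) <= M.
Proof.
  intros H.
  assert (E1 : (RtoC 1 * z)%C = z) by ring. assert (E0 : (RtoC 0 * z)%C = 0) by ring.
  assert (Dr : forall t, 0 <= t <= 1 -> exists a, is_derive (fun s => Re (g (RtoC s * z)%C)) t a /\ Rabs a <= M).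
  { intros t Ht. destruct (H t Ht) as (l & Hl & B). eexists. split; [apply (ray_derive g z l t Hl)|].
    eapply Rle_trans; [apply re_le_Cmod|exact B]. }
  assert (Di : forall t, 0 <= t <= 1 -> exists a, is_derive (fun s => Im (g (RtoC s * z)%C)) t a /\ Rabs a <= M).
  { intros t Ht. destruct (H t Ht) as (l & Hl & B). eexists. split; [apply (ray_derive g z l t Hl)|].
    eapply Rle_trans; [|exact B]. eapply Rle_trans; [|apply Rmax_Cmod]. apply Rmax_r. }
  assert (K : forall f : R -> R, (forall t, 0 <= t <= 1 -> exists a, is_derive f t a /\ Rabs a <= M) -> Rabs (f 1 - f 0) <= M).
  { intros f Hf.
    assert (T := Rabs_increment_le f (fun t => M * t) (Derive f) (fun _ => M)). simpl in T.
    rewrite Rmult_1_r, Rmult_0_r, Rminus_0_r in T. apply T; clear T.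
    - intros t Ht. destruct (Hf t ltac:(lra)) as (a & Da & _). rewrite (is_derive_unique _ _ _ Da). exact Da.
    - intros t Ht. destruct (Hf t Ht) as (a & Da & _). eapply is_derive_continuous; exact Da.
    - intros t Ht. auto_derive; [exact I|ring].
    - intros t Ht. apply (ex_derive_continuous (K := R_AbsRing) (V := R_NormedModule)); auto_derive; exact I.
    - intros t Ht. destruct (Hf t ltac:(lra)) as (a & Da & Ba). rewrite (is_derive_unique _ _ _ Da). exact Ba. }
  assert (Kr := K _ Dr). assert (Ki := K _ Di). cbv beta in Kr, Ki. rewrite E1, E0 in Kr, Ki. split; assumption.
Qed.

Definition Cthq (z : C) : C := if Ceq_dec z 0 then RtoC (1 / 2) else (Cth z / z)%C.

Lemma Cthq_mult (z : C) : (z * Cthq z)%C = Cth z.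
Proof.
  unfold Cthq. destruct (Ceq_dec z 0) as [->|N].
  - unfold Cth. rewrite Cexp_0. replace (1 - 1)%C with (RtoC 0) by ring. unfold Cdiv. ring.
  - field. exact N.
Qed.

Lemma Cth_0 : Cth 0 = 0.
Proof. rewrite <- Cthq_mult. ring. Qed.

Lemma Im_le_Cmod (z : C) : Rabs (Im z) <= Cmod z.
Proof. eapply Rle_trans; [|apply Rmax_Cmod]. apply Rmax_r. Qed.

(** The derivative of tanh (z / 2) - z / 2 is - tanh (z / 2)^2 / 2, quadratically small by the
    linear bound on [Cth]. The estimate makes the quotient [Cthq] derivable at 0. *)
Lemma Cth_cubic_error (z : C) : Cmod z <= 1 -> Cmod (Cth z - RtoC (1 / 2) * z)%C <= 2 * Cmod z ^ 3.
Proof.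
  intros Hz. assert (N := Cmod_ge_0 z).
  destruct (ray_increment_bound (fun y => Cth y + - RtoC (1 / 2) * y)%C z (Cmod z ^ 3)) as [B1 B2].
  - intros t Ht. set (y := (RtoC t * z)%C).
    assert (Hy : Cmod y <= Cmod z).
    { unfold y. rewrite Cmod_mult, Cmod_R, Rabs_pos_eq by lra. nra. }
    exists (- (Cth y * Cth y / 2))%C. split.
    + assert (D := is_Cderive_plus _ _ _ _ _ (is_Cderive_Cth y ltac:(generalize (Im_le_Cmod y); lra))
        (is_Cderive_mult _ _ _ _ _ (is_Cderive_const (- RtoC (1 / 2))%C y) (is_Cderive_id y))).
      cbv beta in D.
      replace (- (Cth y * Cth y / 2))%C with ((1 - Cth y * Cth y) / 2 + (0 * y + - RtoC (1 / 2) * 1))%C; [exact D|].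
      rewrite RtoC_div by lra. field.
    + rewrite Cmod_mult, Cmod_opp, Cmod_div, Cmod_mult, Cmod_R, (Rabs_pos_eq 2) by (lra || (intros E; injection E; lra)).
      assert (T := Cth_le y ltac:(lra)). assert (T0 := Cmod_ge_0 (Cth y)).
      assert (T1 : Cmod (Cth y) * Cmod (Cth y) <= (1.1 * Cmod z) * (1.1 * Cmod z)) by (apply Rmult_le_compat; lra).
      replace (Cmod z ^ 3) with (Cmod z ^ 2 * Cmod z) by ring. apply Rmult_le_compat_r; [assumption|]. simpl.
      assert (0 <= Cmod z * Cmod z) by (apply Rmult_le_pos; assumption). lra.
  - rewrite Cth_0 in B1, B2.
    set (g := (Cth z - RtoC (1 / 2) * z)%C).
    replace (Cth z + - RtoC (1 / 2) * z)%C with g in B1, B2 by (unfold g; ring).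
    replace (0 + - RtoC (1 / 2) * 0)%C with (RtoC 0) in B1, B2 by ring.
    simpl Re in B1 at 2. simpl Im in B2 at 2. rewrite Rminus_0_r in B1, B2.
    rewrite (surjective_pairing g). eapply Rle_trans; [apply Cmod_le_abs|]. unfold Re, Im in *. lra.
Qed.

Lemma Cthq_derivable (z : C) : Rabs (Im z) < 3 / 2 -> exists l, is_Cderive Cthq z l.
Proof.
  intros Hz. destruct (Ceq_dec z 0) as [->|N].
  - exists 0. apply is_Cderive_eps. intros eps He.
    exists (Rmin 1 (eps / 2)). split; [apply Rmin_pos; lra|]. intros y Hy.
    replace (y - 0)%C with y in * by ring.
    assert (Y1 := Rlt_le_trans _ _ _ Hy (Rmin_l _ _)). assert (Y2 := Rlt_le_trans _ _ _ Hy (Rmin_r _ _)).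
    assert (Ny := Cmod_ge_0 y).
    unfold Cthq. destruct (Ceq_dec 0 0) as [_|n]; [|elim n; reflexivity].
    destruct (Ceq_dec y 0) as [->|N].
    + replace (RtoC (1 / 2) - RtoC (1 / 2) - 0 * 0)%C with (RtoC 0) by ring. rewrite Cmod_0. lra.
    + replace (Cth y / y - RtoC (1 / 2) - 0 * y)%C with ((Cth y - RtoC (1 / 2) * y) / y)%C by (field; assumption).
      assert (E := Cth_cubic_error y ltac:(lra)). assert (Py := proj1 (Cmod_gt_0 y) N).
      rewrite Cmod_div by assumption. apply Rmult_le_reg_r with (Cmod y); [assumption|].
      unfold Rdiv at 1. rewrite Rmult_assoc, Rinv_l, Rmult_1_r by lra.
      eapply Rle_trans; [exact E|]. replace (2 * Cmod y ^ 3) with (2 * Cmod y * Cmod y * Cmod y) by ring.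
      apply Rmult_le_compat_r; [assumption|]. apply Rmult_le_compat_r; lra.
  - eexists. apply (is_Cderive_ext_loc (fun y => Cth y / y)%C Cthq z _ (Cmod z)).
    + apply Cmod_gt_0; assumption.
    + intros y Hy. unfold Cthq. destruct (Ceq_dec y 0) as [->|]; [|reflexivity].
      replace (0 - z)%C with (- z)%C in Hy by ring. rewrite Cmod_opp in Hy. lra.
    + apply is_Cderive_div; [assumption|apply is_Cderive_Cth; lra|apply is_Cderive_id].
Qed.

Lemma Cthq_RtoC (t : R) : Cthq (RtoC t) = RtoC (thq t).
Proof.
  unfold Cthq, thq. destruct (Ceq_dec (RtoC t) 0) as [E|E], (Req_EM_T t 0) as [F|F].
  - reflexivity.
  - exfalso. apply F. injection E. auto.
  - exfalso. apply E. rewrite F. reflexivity.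
  - unfold Cth, th. rewrite Cexp_RtoC. assert (P := exp_pos t).
    rewrite !RtoC_div, RtoC_minus, RtoC_plus by lra. reflexivity.
Qed.

(** This [Q] is the function [G] belonging to the Schwarz function w z = z; all three extremal
    functions are built from it. *)
Lemma extremal_potential : exists Q : C -> C,
  (forall z, in_disk z -> is_Cderive Q z (Cthq z)) /\ (forall x : R, Q (RtoC x) = RtoC (thq_int x)).
Proof.
  destruct (strip_primitive Cthq (3 / 2) Cthq_derivable) as [Q [HQ HR]].
  exists Q. split.
  - intros z Hz. apply HQ. unfold in_disk in Hz. generalize (Im_le_Cmod z). lra.
  - intros x. destruct (HR x) as [E1 E2].
    rewrite (RInt_ext _ thq) in E1 by (intros; rewrite Cthq_RtoC; reflexivity).
    rewrite (RInt_ext _ (fun _ => 0)) in E2 by (intros; rewrite Cthq_RtoC; reflexivity).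
    rewrite RInt_const in E2. unfold scal in E2; simpl in E2; unfold mult in E2; simpl in E2. rewrite Rmult_0_r in E2.
    rewrite (surjective_pairing (Q (RtoC x))). unfold Re, Im in *. rewrite E1, E2. reflexivity.
Qed.

Lemma extremal_subordinate (f : C -> C) :
  (forall y, in_disk y -> f y = (1 + Cth y)%C) -> subordinate f phi_SG.
Proof.
  intros Hf.
  assert (An : forall g : C -> C, (forall y, in_disk y -> g y = (1 + Cth y)%C) -> analytic_on_disk g).
  { intros g Hg z Hz. apply (is_Cderive_ex _ _ (0 + (1 - Cth z * Cth z) / 2)%C).
    apply (is_Cderive_ext_loc (fun y => 1 + Cth y)%C g z _ (1 - Cmod z)); unfold in_disk in Hz.
    - lra.
    - intros y Hy. symmetry. apply Hg. unfold in_disk. assert (T := Cmod_triangle (y - z) z).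
      replace (y - z + z)%C with y in T by ring. lra.
    - apply is_Cderive_plus; [apply is_Cderive_const|apply is_Cderive_Cth]. generalize (Im_le_Cmod z). lra. }
  split; [apply An; assumption|split; [apply An; intros; apply phi_SG_Cth; assumption|]].
  exists (fun z => z). split; [|split; [reflexivity|split]].
  - intros z _. apply (is_Cderive_ex _ _ 1), is_Cderive_id.
  - intros z Hz; exact Hz.
  - intros z Hz. rewrite phi_SG_Cth by exact Hz. apply Hf; assumption.
Qed.

(** In the disc [phi_Ne] is real only at real points, as Im (neph (a + i b)) = b (1 - a^2 + b^2 /
    3). At real a it stays below 5/3, because 2/3 - a + a^3 / 3 = (1 - a)^2 (2 + a) / 3. *)
Lemma not_subordinate_phi_Ne (p : C -> C) (x c : R) :
  0 < x < 1 -> p (RtoC x) = RtoC c -> 5 / 3 < c -> ~ subordinate p phi_Ne.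
Proof.
  intros Hx Hp Hc (_ & _ & w & _ & _ & W1 & Hw).
  assert (Dx : in_disk (RtoC x)) by (unfold in_disk; rewrite Cmod_R, Rabs_pos_eq; lra).
  specialize (Hw _ Dx). specialize (W1 _ Dx). rewrite Hp, phi_Ne_neph in Hw.
  destruct (w (RtoC x)) as [a b]. rewrite neph_coords in Hw.
  assert (E1 := f_equal Re Hw). assert (E2 := f_equal Im Hw).
  unfold Re, Im, RtoC, Cplus, fst, snd in E1, E2. clear Hw.
  assert (Ma := Rle_lt_trans _ _ _ (re_le_Cmod (a, b)) W1). simpl in Ma. apply Rabs_def2 in Ma.
  assert (Eb : b * (1 - a ^ 2 + b ^ 2 / 3) = 0) by (transitivity (0 + (b - a ^ 2 * b + b ^ 3 / 3)); [field|lra]).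
  apply Rmult_integral in Eb. destruct Eb as [->|Eb]; [|nra].
  assert (0 <= (1 - a) * (1 - a) * (2 + a)) by (apply Rmult_le_pos; [apply Rle_0_sqr|lra]). nra.
Qed.

Lemma thq_int_exceeds (c : R) : c < ell1 -> exists x, 0 < x < 1 /\ c < thq_int x < ell1.
Proof.
  intros Hc. rewrite ell1_eq in *.
  assert (C := is_derive_continuous _ _ _ (is_derive_thq_int 1)).
  assert (P : 0 < thq_int 1 - c) by lra.
  destruct (proj1 (filterlim_locally (U := R_UniformSpace) _ _) C (mkposreal _ P)) as [d Hd]. assert (Pd := cond_pos d).
  set (x := Rmax (1 / 2) (1 - d / 2)).
  assert (X1 : 1 / 2 <= x) by apply Rmax_l. assert (X2 : 1 - d / 2 <= x) by apply Rmax_r.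
  assert (X3 : x < 1) by (apply Rmax_lub_lt; lra).
  assert (B : Rabs (x - 1) < d) by (rewrite Rabs_left; lra).
  assert (K : Rabs (thq_int x - thq_int 1) < thq_int 1 - c) by exact (Hd x B).
  apply Rabs_def2 in K. exists x. split; [lra|]. split; [lra|]. apply thq_int_lt; lra.
Qed.

Lemma C_derive_is (p : C -> C) (y l : C) : is_Cderive p y l -> C_derive p y = l.
Proof. apply is_C_derive_unique. Qed.

Lemma sharp_a : cannot_be_improved (sufficient_for_Ne expr_a) (3 * ell1 / 2).
Proof.
  intros b Hb Hall. assert (Pl := ell1_pos).
  (* The maximum keeps [beta] positive even for negative [b], and it still lies below the
     threshold. *)
  set (beta := Rmax b ell1). assert (B1 : b <= beta) by apply Rmax_l. assert (B2 : ell1 <= beta) by apply Rmax_r.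
  assert (B3 : beta < 3 * ell1 / 2) by (apply Rmax_lub_lt; lra).
  destruct extremal_potential as [Q [HQ HR]].
  destruct (thq_int_exceeds (2 * beta / 3)) as [x [Hx [Hx1 _]]]; [lra|].
  set (p := fun z => (1 + RtoC (/ beta) * Q z)%C).
  assert (Dp : forall y, in_disk y -> is_Cderive p y (0 + (0 * Q y + RtoC (/ beta) * Cthq y))%C).
  { intros y Hy. apply is_Cderive_plus; [apply is_Cderive_const|].
    apply is_Cderive_mult; [apply is_Cderive_const|apply HQ; assumption]. }
  assert (Nb : RtoC beta <> 0) by (intros E; injection E; lra).
  apply (not_subordinate_phi_Ne p x (1 + / beta * thq_int x)); [assumption| | |].
  - unfold p. rewrite HR, <- RtoC_mult, <- RtoC_plus. reflexivity.
  - assert (2 / 3 < / beta * thq_int x); [|lra]. apply Rmult_lt_reg_l with beta; [lra|].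
    rewrite <- Rmult_assoc, Rinv_r, Rmult_1_l by lra. lra.
  - apply (Hall beta); [lra| | |].
    + intros y Hy. eapply is_Cderive_ex, Dp; assumption.
    + unfold p. rewrite HR, thq_int_0. ring.
    + apply extremal_subordinate. intros y Hy. unfold expr_a. rewrite (C_derive_is _ _ _ (Dp y Hy)), <- Cthq_mult.
      rewrite RtoC_inv by lra. field. assumption.
Qed.

Lemma sharp_b : cannot_be_improved (sufficient_for_Ne expr_b) (ell1 / ln (5 / 3)).
Proof.
  intros b Hb Hall. assert (Pl := ell1_bounds). assert (Ln := ln_5_3_bounds). assert (BB := beta_b_bounds).
  (* [ell1] lies below the threshold since ln (5/3) < 1. *)
  set (beta := Rmax b ell1). assert (B1 : b <= beta) by apply Rmax_l. assert (B2 : ell1 <= beta) by apply Rmax_r.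
  assert (B3 : beta < ell1 / ln (5 / 3)) by (apply Rmax_lub_lt; lra).
  assert (B4 : beta * ln (5 / 3) < ell1).
  { replace ell1 with (ell1 / ln (5 / 3) * ln (5 / 3)) by (field; lra). apply Rmult_lt_compat_r; lra. }
  destruct extremal_potential as [Q [HQ HR]].
  destruct (thq_int_exceeds (beta * ln (5 / 3)) B4) as [x [Hx [Hx1 _]]].
  set (p := fun z => Cexp (RtoC (/ beta) * Q z)%C).
  assert (Dp : forall y, in_disk y -> is_Cderive p y ((0 * Q y + RtoC (/ beta) * Cthq y) * p y)%C).
  { intros y Hy. apply (is_Cderive_comp Cexp (fun z => RtoC (/ beta) * Q z)%C); [apply is_Cderive_Cexp|].
    apply is_Cderive_mult; [apply is_Cderive_const|apply HQ; assumption]. }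
  assert (Nb : RtoC beta <> 0) by (intros E; injection E; lra).
  apply (not_subordinate_phi_Ne p x (exp (/ beta * thq_int x))); [assumption| | |].
  - unfold p. rewrite HR, <- RtoC_mult. apply Cexp_RtoC.
  - rewrite <- (exp_ln (5 / 3)) at 1 by lra. apply exp_increasing. apply Rmult_lt_reg_l with beta; [lra|].
    rewrite <- Rmult_assoc, Rinv_r, Rmult_1_l by lra. lra.
  - apply (Hall beta); [lra| | |].
    + intros y Hy. eapply is_Cderive_ex, Dp; assumption.
    + unfold p. rewrite HR, thq_int_0. replace (RtoC (/ beta) * 0)%C with (RtoC 0) by ring. apply Cexp_0.
    + apply extremal_subordinate. intros y Hy. unfold expr_b. rewrite (C_derive_is _ _ _ (Dp y Hy)), <- Cthq_mult.
      rewrite RtoC_inv by lra. field. split; [assumption|apply Cexp_neq_0].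
Qed.

Lemma sharp_c : cannot_be_improved (sufficient_for_Ne expr_c) (5 * ell1 / 2).
Proof.
  intros b Hb Hall. assert (Pl := ell1_bounds).
  (* The floor 1.2 lies below 5 ell1 / 2, about 1.217, and above the bound 1.1 for |Re Q|. A zero of
     1 - Q / beta would need Re Q = beta, so the extremal function has no pole in the disc. *)
  set (beta := Rmax b 1.2). assert (B1 : b <= beta) by apply Rmax_l. assert (B2 : 1.2 <= beta) by apply Rmax_r.
  assert (B3 : beta < 5 * ell1 / 2) by (apply Rmax_lub_lt; lra).
  destruct extremal_potential as [Q [HQ HR]].
  destruct (thq_int_exceeds (2 * beta / 5)) as [x [Hx [Hx1 Hx2]]]; [lra|].
  set (d := fun z => (1 + - RtoC (/ beta) * Q z)%C).
  set (p := fun z => (/ d z)%C).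
  assert (Q0 : Q 0 = 0) by (rewrite HR, thq_int_0; reflexivity).
  assert (Nb : RtoC beta <> 0) by (intros E; injection E; lra).
  assert (Nd : forall y, in_disk y -> d y <> 0).
  { intros y Hy E. unfold in_disk in Hy.
    destruct (ray_increment_bound Q y 1.1) as [K _].
    - intros t Ht. exists (Cthq (RtoC t * y)%C). split; [apply HQ, in_disk_ray; assumption|].
      assert (Ny := Cmod_ge_0 y).
      rewrite Cmod_mult. apply Rle_trans with (1.1 * 1); [|lra]. apply Rmult_le_compat; try apply Cmod_ge_0; [|lra].
      unfold Cthq. destruct (Ceq_dec (RtoC t * y)%C 0) as [Z|Z]; [rewrite Cmod_R, Rabs_pos_eq; lra|].
      rewrite Cmod_div by assumption. apply Cmod_gt_0 in Z. apply Rmult_le_reg_r with (Cmod (RtoC t * y)%C); [assumption|].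
      unfold Rdiv. rewrite Rmult_assoc, Rinv_l, Rmult_1_r by lra. apply Cth_le.
      assert (T := in_disk_ray y t Hy Ht). unfold in_disk in T. lra.
    - rewrite Q0 in K. simpl Re in K at 2. rewrite Rminus_0_r in K. apply Rabs_le_between in K.
      assert (E1 := f_equal Re E). unfold d in E1.
      replace (Re (1 + - RtoC (/ beta) * Q y)%C) with (1 - / beta * Re (Q y)) in E1 by (destruct (Q y); simpl; ring).
      simpl in E1. assert (E2 : Re (Q y) = beta) by (apply Rmult_eq_reg_l with (/ beta); [rewrite Rinv_l; lra|apply Rinv_neq_0_compat; lra]). lra. }
  assert (Dd : forall y, in_disk y -> is_Cderive d y (0 + (0 * Q y + - RtoC (/ beta) * Cthq y))%C).
  { intros y Hy. apply is_Cderive_plus; [apply is_Cderive_const|].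
    apply (is_Cderive_mult (fun _ => - RtoC (/ beta))%C Q); [apply is_Cderive_const|apply HQ; assumption]. }
  assert (Dp : forall y, in_disk y -> is_Cderive p y ((0 + (0 * Q y + - RtoC (/ beta) * Cthq y)) * - / (d y * d y))%C).
  { intros y Hy. apply (is_Cderive_comp Cinv d); [apply is_Cderive_inv_id; apply Nd; assumption|apply Dd; assumption]. }
  set (v := / beta * thq_int x).
  assert (V1 : 2 / 5 < v).
  { apply Rmult_lt_reg_l with beta; [lra|]. unfold v. rewrite <- Rmult_assoc, Rinv_r, Rmult_1_l by lra. lra. }
  assert (V2 : v < 1).
  { apply Rmult_lt_reg_l with beta; [lra|]. unfold v. rewrite <- Rmult_assoc, Rinv_r, Rmult_1_l by lra. lra. }
  apply (not_subordinate_phi_Ne p x (/ (1 - v))); [assumption| | |].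
  - unfold p, d. rewrite HR, (RtoC_inv (1 - v)), RtoC_minus by lra. unfold v. rewrite RtoC_mult. f_equal. ring.
  - replace (5 / 3) with (/ (3 / 5)) by field. apply Rinv_lt_contravar; [apply Rmult_lt_0_compat; lra|lra].
  - apply (Hall beta); [lra| | |].
    + intros y Hy. eapply is_Cderive_ex, Dp; assumption.
    + unfold p, d. rewrite Q0. replace (1 + - RtoC (/ beta) * 0)%C with (RtoC 1) by ring. field.
    + apply extremal_subordinate. intros y Hy. unfold expr_c. rewrite (C_derive_is _ _ _ (Dp y Hy)), <- Cthq_mult.
      assert (N := Nd y Hy). unfold p. rewrite RtoC_inv by lra. unfold Cpow. field. split; assumption.
Qed.

Theorem theorem2p3 :
  ((forall beta : R, beta >= 3 * ell1 / 2 -> sufficient_for_Ne expr_a beta) /\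
   cannot_be_improved (sufficient_for_Ne expr_a) (3 * ell1 / 2) /\
   Rabs (3 * ell1 / 2 - 730333 / 1000000) < 1 / 1000000) /\
  ((forall beta : R, beta >= ell1 / ln (5 / 3) -> sufficient_for_Ne expr_b beta) /\
   cannot_be_improved (sufficient_for_Ne expr_b) (ell1 / ln (5 / 3)) /\
   Rabs (ell1 / ln (5 / 3) - 953141 / 1000000) < 1 / 1000000) /\
  ((forall beta : R, beta >= 5 * ell1 / 2 -> sufficient_for_Ne expr_c beta) /\
   cannot_be_improved (sufficient_for_Ne expr_c) (5 * ell1 / 2) /\
   Rabs (5 * ell1 / 2 - 121722 / 100000) < 1 / 100000).
Proof.
  split; [|split]; split; [exact sufficient_a|split|exact sufficient_b|split|exact sufficient_c|split].
  - exact sharp_a.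
  - exact beta_a_approx.
  - exact sharp_b.
  - exact beta_b_approx.
  - exact sharp_c.
  - exact beta_c_approx.
Qed.
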